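(* Let $n \geq 2$ and let $f$ be a real analytic function defined on an open neighborhood of the origin $0 \in \mathbb{R}^n$. Suppose that $\operatorname{codim}_{0}(Z_f) \geq 2$, where $Z_f=\{x: f(x)=0\}$. Then there exists an open neighborhood $U$ of $0$ such that $\log|f| \in W^{1,1}(U)$; that is, $\log|f| \in L^1(U)$ and its distributional gradient on $U$ belongs to $L^1(U)$ (and coincides a.e. with the pointwise gradient $\nabla f/f$ computed off $Z_f$).
   Context: For a real analytic subset $X$ of an open set in $\mathbb{R}^n$, a point $p \in X$ is a smooth point of dimension $d$ if there is an open neighborhood $W$ of $p$ such that $W\cap X$ is a real analytic submanifold of $W$ of dimension $d$. The dimension of $X$ at $p$, $\dim_p X$, is the largest $d$ such that $p$ lies in the closure of the set of smooth points of $X$ of dimension $d$, and $\operatorname{codim}_p X := n - \dim_p X$. If $0 \notin Z_f$ the hypothesis is considered satisfied (and the conclusion is trivial). The hypothesis $\operatorname{codim}_0(Z_f)\ge 2$ in particular excludes $f \equiv 0$, so $Z_f$ has Lebesgue measure zero near $0$ and $\log|f|$ is defined a.e. *)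

(* Defs.v *)
From HB Require Import structures.
From mathcomp Require Import all_boot all_order all_algebra.
From mathcomp Require Import all_classical all_reals all_analysis.
Set Implicit Arguments. Unset Strict Implicit. Unset Printing Implicit Defensive.
Import Order.TTheory GRing.Theory Num.Theory.
Import numFieldNormedType.Exports.
Local Open Scope classical_set_scope.
Local Open Scope ring_scope.

(* Euclidean space R^n is 'rV[R]_n (normed space, sup norm).          *)

Definition basisv {R : realType} {n : nat} (i : 'I_n) : 'rV[R]_n := delta_mx 0 i.

Definition partialD {R : realType} {n : nat} (i : 'I_n) (f : 'rV[R]_n -> R)
  (x : 'rV[R]_n) : R := 'D_(basisv i) f x.

(* The power series sum_alpha c_alpha (x-a)^alpha is summed by total    *)
(* degree k, and required to converge absolutely.                       *)

Definition monomial {R : realType} {n : nat} (a x : 'rV[R]_n) (alpha : 'I_n -> nat) : R :=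
  \prod_(i < n) (x ord0 i - a ord0 i) ^+ alpha i.

Definition homog_part {R : realType} {n : nat} (c : ('I_n -> nat) -> R)
  (a x : 'rV[R]_n) (k : nat) : R :=
  \sum_(alpha : {ffun 'I_n -> 'I_k.+1} | (\sum_(i < n) (alpha i : nat))%N == k)
     c (fun i => (alpha i : nat)) * monomial a x (fun i => (alpha i : nat)).

Definition homog_part_abs {R : realType} {n : nat} (c : ('I_n -> nat) -> R)
  (a x : 'rV[R]_n) (k : nat) : R :=
  \sum_(alpha : {ffun 'I_n -> 'I_k.+1} | (\sum_(i < n) (alpha i : nat))%N == k)
     `| c (fun i => (alpha i : nat)) * monomial a x (fun i => (alpha i : nat)) |.

Definition analytic_at {R : realType} {n : nat} (f : 'rV[R]_n -> R) (a : 'rV[R]_n) : Prop :=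
  exists (c : ('I_n -> nat) -> R) (r : R), 0 < r /\
    forall x : 'rV[R]_n, `|x - a| < r ->
      cvg (series (homog_part_abs c a x) @ \oo) /\
      series (homog_part c a x) @ \oo --> f x.

Definition analytic_on {R : realType} {n : nat} (V : set 'rV[R]_n) (f : 'rV[R]_n -> R) : Prop :=
  forall a, V a -> analytic_at f a.

Definition zero_set {R : realType} {n : nat} (V : set 'rV[R]_n) (f : 'rV[R]_n -> R)
  : set 'rV[R]_n := [set x | V x /\ f x = 0].

Definition jacobian {R : realType} {n m : nat} (g : 'I_m -> 'rV[R]_n -> R)
  (x : 'rV[R]_n) : 'M[R]_(m, n) := \matrix_(j < m, i < n) partialD i (g j) x.

Definition analytic_submanifold {R : realType} {n : nat} (W M : set 'rV[R]_n)
  (d : nat) : Prop :=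
  (d <= n)%N /\ M `<=` W /\
  forall q, M q ->
    exists (V' : set 'rV[R]_n) (g : 'I_(n - d) -> 'rV[R]_n -> R),
      [/\ open V', V' `<=` W, V' q &
          (forall j, analytic_on V' (g j))] /\
      (M `&` V' = [set x | V' x /\ forall j, g j x = 0] /\
       (forall x, (M `&` V') x -> \rank (jacobian g x) = (n - d)%N)).

Definition smooth_point {R : realType} {n : nat} (X : set 'rV[R]_n) (d : nat)
  (p : 'rV[R]_n) : Prop :=
  X p /\ exists W : set 'rV[R]_n, [/\ open W, W p & analytic_submanifold W (W `&` X) d].

(* codim_p X >= k, i.e. dim_p X <= n - k: every d such that p lies in the
   closure of the smooth points of dimension d satisfies n - d >= k. *)
Definition codim_ge {R : realType} {n : nat} (X : set 'rV[R]_n) (p : 'rV[R]_n)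
  (k : nat) : Prop :=
  forall d : nat, closure (smooth_point X d) p -> (k <= n - d)%N.

(* lebn n is the n-fold product of the Lebesgue measure on R, a        *)
(* measure on n.-tuple R (product Borel sigma-algebra).                *)

Definition tcons {R : realType} {n : nat} (p : R * n.-tuple R) : n.+1.-tuple R :=
  [tuple of p.1 :: (p.2 : seq R)].

Fixpoint lebn (R : realType) (n : nat) : set (n.-tuple R) -> \bar R :=
  match n with
  | 0%N => fun A => (\d_ [tuple] A)%E
  | n'.+1 => pushforward ((@lebesgue_measure R) \x (@lebn R n'))%E (@tcons R n')
  end.

Definition row_of_tuple {R : realType} {n : nat} (t : n.-tuple R) : 'rV[R]_n :=
  \row_(i < n) tnth t i.

Definition L1_on {R : realType} {n : nat} (U : set 'rV[R]_n) (g : 'rV[R]_n -> R) : Prop :=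
  (@lebn R n).-integrable (row_of_tuple @^-1` U) (fun t => (g (row_of_tuple t))%:E).

Definition integral_on {R : realType} {n : nat} (U : set 'rV[R]_n) (g : 'rV[R]_n -> R)
  : \bar R :=
  (\int[@lebn R n]_(t in row_of_tuple @^-1` U) (g (row_of_tuple t))%:E)%E.

Fixpoint iterD {R : realType} {n : nat} (vs : seq 'rV[R]_n) (phi : 'rV[R]_n -> R)
  : 'rV[R]_n -> R :=
  match vs with
  | [::] => phi
  | v :: vs' => fun x => 'D_v (iterD vs' phi) x
  end.

Definition smooth_fun {R : realType} {n : nat} (phi : 'rV[R]_n -> R) : Prop :=
  forall vs : seq 'rV[R]_n,
    continuous (iterD vs phi) /\ forall x v, derivable (iterD vs phi) x v.

Definition test_function {R : realType} {n : nat} (U : set 'rV[R]_n)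
  (phi : 'rV[R]_n -> R) : Prop :=
  smooth_fun phi /\
  exists K : set 'rV[R]_n, [/\ compact K, K `<=` U & forall x, ~ K x -> phi x = 0].

Definition W11_with_gradient {R : realType} {n : nat} (U : set 'rV[R]_n)
  (u : 'rV[R]_n -> R) (g : 'I_n -> 'rV[R]_n -> R) : Prop :=
  [/\ L1_on U u,
      (forall i, L1_on U (g i)) &
      forall (i : 'I_n) (phi : 'rV[R]_n -> R), test_function U phi ->
        integral_on U (fun x => u x * partialD i phi x)
        = (- integral_on U (fun x => (g i x * phi x)%R))%E].

(* Main.v *)
(** For a suitable direction [v = (1, a)] we use sheared coordinates [x = t v + (0, y)] and
    Weierstrass preparation: near [0], [f] is a unit times a monic polynomial [P_y] in [t]
    with analytic coefficients in [y].  Let [E] be the first coefficient, not identically zero,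
    of the polynomial whose roots are the differences of the roots of [P_y].  A nonreal root [z]
    of [P_y] satisfies [|E y| <= 2 |Im z|].  If [E y <> 0], then [P_y] has no real root: at a
    real root of minimal multiplicity [m] over such [y], the zero set of [f] would be the smooth
    hypersurface [d^(m-1) P / dt^(m-1) = 0], which codimension at least [2] forbids.  Hence
    [|P_y' / P_y| <= sum_z 1 / |t - z| <= C |E y|^-e sum_z |t - Re z|^(e - 1)] for [0 < e < 1],
    whose integral in [t] is at most [C' |E y|^-e].  A small negative power of a nonzero analytic
    function is locally integrable (Weierstrass preparation again), so [D_v f / f] is in [L^1];
    the same fact for [f] gives [ln |f|] in [L^1].  For almost every [y] the function [f] does not
    vanish on the line, and integrating by parts along it gives the weak derivative in the
    direction [v].  Finitely many such directions span the space. *)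
Require Import Defs.
From HB Require Import structures.
From mathcomp Require Import all_boot all_order all_algebra.
From mathcomp Require Import all_classical all_reals all_analysis.
From mathcomp Require Import measurable_realfun ring lra.
From mathcomp.real_closed Require Import complex polyrcf.
Set Implicit Arguments. Unset Strict Implicit. Unset Printing Implicit Defensive.
Import Order.TTheory GRing.Theory Num.Theory.
Import numFieldNormedType.Exports.
Import ComplexField.Normc.
Local Open Scope classical_set_scope.
Local Open Scope ring_scope.

(** * Summable families and absolutely convergent power series *)

(** [f] may have multiple factors, so the usual discriminant of [P_y] may vanish identically; the
    lowest surviving coefficient [E] replaces it and no squarefree factorization is taken. Of [E]
    only one fact is used: where the lower coefficients vanish, [E y] is either zero or the product
    of the nonzero differences of roots. The roots lie in the disc of radius [1/2], so these
    differences have modulus at most [1] and each of them alone bounds [|E y|] from above, in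
    particular the difference of a root and its conjugate. The singularity [1 / |t - z|] just fails
    to be integrable in [t] uniformly in [z], hence the splitting into the powers [e] and [1 - e].
    The estimate on lines holds for every [0 < e < 1], so [e] is dictated by the integrability of
    [|E|^-e]. That integrability needs no induction on the dimension: preparation of [E] itself
    bounds the integrals on lines uniformly. The codimension enters twice: it excludes zero sets
    with interior, so that some direction admits preparation, and it excludes smooth hypersurfaces.
    Series are real, with explicit norms on polydiscs; complex numbers occur only as roots. *)

Section Hassum.
Context {R : realType}.

(** Unordered summation along finite sets: families can be reindexed, regrouped and multiplied
    without enumerating the index type. In [sumle] the number [M] is only an upper bound for the
    absolute sum. *)
Definition hassum {I : choiceType} (u : I -> R) (S : R) :=
  forall e : R, 0 < e -> exists J0 : seq I, forall J : seq I,
    uniq J -> {subset J0 <= J} -> `|\sum_(i <- J) u i - S| <= e.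

Definition sumle {I : choiceType} (u : I -> R) (M : R) :=
  forall J : seq I, uniq J -> \sum_(i <- J) `|u i| <= M.

Lemma eq_hassum (I : choiceType) (u v : I -> R) S :
  u =1 v -> hassum u S -> hassum v S.
Proof. by move=> /funext ->. Qed.

Lemma sumle_ge0 (I : choiceType) (u : I -> R) M : sumle u M -> 0 <= M.
Proof. by move=> /(_ [::] isT); rewrite big_nil. Qed.

Lemma sumle_le (I : choiceType) (u v : I -> R) M N :
  (forall i, `|u i| <= `|v i|) -> M <= N -> sumle v M -> sumle u N.
Proof.
move=> uv MN vM J /vM H; apply: le_trans MN; apply: le_trans H.
exact: ler_sum.
Qed.

Lemma sumleZ (I : choiceType) (u : I -> R) M a :
  sumle u M -> sumle (fun i => a * u i) (`|a| * M).
Proof.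
move=> uM J uJ; under eq_bigr do rewrite normrM.
by rewrite -mulr_sumr ler_wpM2l// uM.
Qed.

Lemma sumleD (I : choiceType) (u v : I -> R) M N :
  sumle u M -> sumle v N -> sumle (fun i => u i + v i) (M + N).
Proof.
move=> uM vN J uJ.
apply: (@le_trans _ _ (\sum_(i <- J) (`|u i| + `|v i|))).
  by apply: ler_sum => i _; apply: ler_normD.
by rewrite big_split lerD// ?uM ?vN.
Qed.


Lemma sum_subset (I : choiceType) (u : I -> R) (s s' : seq I) :
  uniq s -> uniq s' -> {subset s <= s'} ->
  \sum_(i <- s') u i = \sum_(i <- s) u i + \sum_(i <- s' | i \notin s) u i.
Proof.
move=> us us' ss'; rewrite (bigID (mem s)) /=; congr (_ + _).
rewrite -big_filter; apply: perm_big; apply: uniq_perm => //.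
  exact: filter_uniq.
by move=> x; rewrite mem_filter; apply/andP/idP => [[]//|xs]; split=> //; exact: ss'.
Qed.

Lemma hassumD (I : choiceType) (u v : I -> R) S T :
  hassum u S -> hassum v T -> hassum (fun i => u i + v i) (S + T).
Proof.
move=> uS vT e e0; have e2 : 0 < e / 2 by rewrite divr_gt0.
have [J1 H1] := uS _ e2; have [J2 H2] := vT _ e2.
exists (J1 ++ J2) => J uJ sJ.
have {}H1 : `|\sum_(i <- J) u i - S| <= e / 2.
  by apply: H1 => // x xJ; apply: sJ; rewrite mem_cat xJ.
have {}H2 : `|\sum_(i <- J) v i - T| <= e / 2.
  by apply: H2 => // x xJ; apply: sJ; rewrite mem_cat xJ orbT.
rewrite big_split /=.
rewrite (_ : _ - _ = (\sum_(i <- J) u i - S) + (\sum_(i <- J) v i - T)); last by ring.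
apply: le_trans (ler_normD _ _) _; lra.
Qed.

Lemma hassumZ (I : choiceType) (u : I -> R) S a :
  hassum u S -> hassum (fun i => a * u i) (a * S).
Proof.
move=> uS e e0.
have a1 : 0 < `|a| + 1 by rewrite ltr_wpDl.
have [J0 H] := uS (e / (`|a| + 1)) (divr_gt0 e0 a1).
exists J0 => J uJ sJ; rewrite -mulr_sumr -mulrBr normrM.
apply: (@le_trans _ _ ((`|a| + 1) * (e / (`|a| + 1)))).
  by apply: ler_pM => //; [rewrite lerDl | exact: H].
by rewrite mulrC divfK// gt_eqF.
Qed.

Lemma hassum_unique (I : choiceType) (u : I -> R) S T :
  hassum u S -> hassum u T -> S = T.
Proof.
move=> uS uT; apply/eqP; rewrite -subr_eq0 -normr_le0; apply/ler_addgt0Pl => e e0.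
have e2 : 0 < e / 2 by rewrite divr_gt0.
have [J1 H1] := uS _ e2; have [J2 H2] := uT _ e2.
have {}H1 := H1 (undup (J1 ++ J2)) (undup_uniq _).
have {}H2 := H2 (undup (J1 ++ J2)) (undup_uniq _).
set A := \sum_(i <- _) _ in H1 H2.
have {}H1 : `|A - S| <= e / 2.
  by apply: H1 => x xJ; rewrite mem_undup mem_cat xJ.
have {}H2 : `|A - T| <= e / 2.
  by apply: H2 => x xJ; rewrite mem_undup mem_cat xJ orbT.
rewrite addr0 (_ : S - T = (A - T) - (A - S)); last by ring.
apply: le_trans (ler_normB _ _) _; lra.
Qed.

Lemma hassum_norm_le (I : choiceType) (u : I -> R) S M :
  sumle u M -> hassum u S -> `|S| <= M.
Proof.
move=> uM uS; apply/ler_addgt0Pr => e e0; have [J0 H] := uS _ e0.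
have {}H := H (undup J0) (undup_uniq _).
have := uM _ (undup_uniq J0); set A := \sum_(i <- _) u i in H => uA.
have {}H : `|A - S| <= e by apply: H => x; rewrite mem_undup.
have A1 : `|A| <= M by apply: le_trans uA; exact: ler_norm_sum.
rewrite (_ : S = A - (A - S)); last by ring.
apply: le_trans (ler_normB _ _) _; lra.
Qed.

Lemma hassum_nneg (I : choiceType) (u : I -> R) M :
  (forall i, 0 <= u i) -> sumle u M -> exists S, hassum u S.
Proof.
move=> u0 uM; pose E := [set S | exists2 J : seq I, uniq J & S = \sum_(i <- J) u i].
have E0 : has_sup E.
  split; first by exists 0, [::]; rewrite // big_nil.
  exists M => _ [J uJ ->]; apply: le_trans (uM J uJ).
  by apply: ler_sum => i _; exact: ler_norm.
exists (sup E) => e e0.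
have [_ [J0 uJ0 ->] H0] := sup_adherent e0 E0.
exists J0 => J uJ sJ; rewrite distrC ger0_norm; last first.
  rewrite subr_ge0; apply: ub_le_sup; first by case: E0.
  by exists J.
have : \sum_(i <- J0) u i <= \sum_(i <- J) u i.
  by rewrite (@sum_subset _ u J0 J)// lerDl sumr_ge0.
lra.
Qed.

Lemma sumle_hassum (I : choiceType) (u : I -> R) M :
  sumle u M -> exists S, hassum u S.
Proof.
move=> uM.
have [S1 h1] : exists S, hassum (fun i => `|u i|) S.
  apply: (@hassum_nneg _ _ M) => //; apply: sumle_le uM => // i; by rewrite normr_id.
have [S2 h2] : exists S, hassum (fun i => `|u i| + u i) S.
  apply: (@hassum_nneg _ _ (M + M)) => [i|].
    by have := ler_norm (- u i); rewrite normrN; lra.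
  apply: sumleD => //; apply: sumle_le uM => // i; by rewrite normr_id.
exists (S2 + -1 * S1); apply: eq_hassum (hassumD h2 (hassumZ (-1) h1)) => i.
by ring.
Qed.

Definition tsum (I : choiceType) (u : I -> R) : R := xget 0 [set S | hassum u S].

Lemma hassum_tsum (I : choiceType) (u : I -> R) M :
  sumle u M -> hassum u (tsum u).
Proof. by move=> /sumle_hassum[S uS]; exact: (@xgetI _ 0 [set S | hassum u S] S). Qed.

(** A dominated tail estimate: the finite set depends on the dominating family alone, so it serves
    all points of a polydisc at once. *)
Lemma hassum_tail (I : choiceType) (u : I -> R) M : sumle u M ->
  forall e, 0 < e -> exists2 J0 : seq I, uniq J0 & forall (v : I -> R) S,
    (forall i, `|v i| <= `|u i|) -> hassum v S -> `|\sum_(i <- J0) v i - S| <= e.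
Proof.
move=> uM e e0.
have uM' : sumle (fun i => `|u i|) M.
  by apply: sumle_le uM => // i; rewrite normr_id.
have [S1 h1] := sumle_hassum uM'.
have e2 : 0 < e / 4 by rewrite divr_gt0.
have [J0 H0] := h1 _ e2.
exists (undup J0) => [|v S vu vS]; first exact: undup_uniq.
have [J1 H1] := vS _ e2.
set A := undup J0; set B := undup (J0 ++ J1).
have {}H1 : `|\sum_(i <- B) v i - S| <= e / 4.
  by apply: H1 => [|x xJ]; rewrite ?undup_uniq// mem_undup mem_cat xJ orbT.
have HA : `|\sum_(i <- A) `|u i| - S1| <= e / 4.
  by apply: H0 => [|x xJ]; rewrite ?undup_uniq// mem_undup.
have HB : `|\sum_(i <- B) `|u i| - S1| <= e / 4.
  by apply: H0 => [|x xJ]; rewrite ?undup_uniq// mem_undup mem_cat xJ.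
have AB w := @sum_subset _ w A B (undup_uniq _) (undup_uniq _).
have sAB : {subset A <= B}.
  by move=> x; rewrite !mem_undup mem_cat => ->.
move: H1 HB; rewrite (AB v sAB) (AB (fun i => `|u i|) sAB).
set a := \sum_(i <- A) v i; set c := \sum_(i <- A) `|u i| in HA *.
set b := \sum_(i <- B | _) v i; set d := \sum_(i <- B | _) `|u i|.
have : `|b| <= d.
  by apply: le_trans (ler_norm_sum _ _ _) _; apply: ler_sum.
move: HA; rewrite !ler_norml => /andP[? ?] /andP[? ?] /andP[? ?] /andP[? ?].
apply/andP; split; lra.
Qed.

Lemma hassum_fin (I : finType) (u : I -> R) : hassum u (\sum_i u i).
Proof.
move=> e e0; exists (enum I) => J uJ sJ.
rewrite (@perm_big _ _ _ _ J (enum I)); first by rewrite big_enum /= subrr normr0 ltW.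
apply: uniq_perm => //; first exact: enum_uniq.
by move=> x; rewrite mem_enum sJ// mem_enum.
Qed.

Lemma sumle_fin (I : finType) (u : I -> R) : sumle u (\sum_i `|u i|).
Proof.
move=> J uJ; rewrite -big_enum /=.
rewrite (@sum_subset _ _ J (enum I))//; last by move=> x; rewrite mem_enum.
  by rewrite lerDl sumr_ge0.
exact: enum_uniq.
Qed.

Lemma fiber_seq (I : choiceType) (K : I -> choiceType) (J : seq {i : I & K i}) i :
  exists L : seq (K i), [seq x <- J | tag x == i] = map (Tagged K) L.
Proof.
elim: J => [|x J [L IH]] /=; first by exists [::].
case: eqP => [|_]; last by exists L.
case: x => i' k /= ii'; case: _ / ii' k L IH => k L ->.
by exists (k :: L).
Qed.

Lemma hassum_sigma (I : choiceType) (K : I -> choiceType)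
    (u : {i : I & K i} -> R) (S : I -> R) T :
  hassum u T -> (forall i, hassum (fun k : K i => u (Tagged K k)) (S i)) -> hassum S T.
Proof.
move=> uT uS e e0; have e2 : 0 < e / 2 by rewrite divr_gt0.
have [J0 H0] := uT _ e2; exists (map tag J0) => J uJ sJ.
have eJ : 0 < e / 2 / (size J).+1%:R.
  by rewrite divr_gt0// -natr1 ltr_wpDl.
(* Each fibre is truncated to a finite list that contains its part of [J0], with an error small
   enough to be added up over [J]. *)
have {}uS i : exists L : seq (K i), [/\ uniq L,
    forall k : K i, Tagged K k \in J0 -> k \in L &
    `|\sum_(k <- L) u (Tagged K k) - S i| <= e / 2 / (size J).+1%:R].
  have [L1 H1] := uS i _ eJ; have [L2 E2] := fiber_seq J0 i.
  exists (undup (L1 ++ L2)); split; first exact: undup_uniq.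
    move=> k kJ; rewrite mem_undup mem_cat; apply/orP; right.
    have : Tagged K k \in [seq x <- J0 | tag x == i] by rewrite mem_filter eqxx.
    by rewrite E2 => /mapP[k' k'L /eqP]; rewrite eq_Tagged => /eqP /= ->.
  by apply: H1 => [|x xJ]; rewrite ?undup_uniq// mem_undup mem_cat xJ.
pose L i := projT1 (cid (uS i)).
have HL i : [/\ uniq (L i), forall k : K i, Tagged K k \in J0 -> k \in L i &
    `|\sum_(k <- L i) u (Tagged K k) - S i| <= e / 2 / (size J).+1%:R].
  exact: (projT2 (cid (uS i))).
have {H0} : `|\sum_(x <- [seq Tagged K k | i <- J, k <- L i]) u x - T| <= e / 2.
  apply: H0.
    apply: allpairs_uniq_dep => //; first by move=> i _; case: (HL i).
    by move=> [i k] [i' k'] _ _.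
  move=> [i k] xJ; apply/allpairsPdep; exists i, k; split => //.
    by apply: sJ; apply/mapP; exists (existT _ i k).
  by case: (HL i) => _ + _; apply.
rewrite big_allpairs_dep /= => H0.
set A := \sum_(i <- J) _ in H0.
have : `|\sum_(i <- J) S i - A| <= e / 2.
  rewrite distrC /A -sumrB.
  apply: (@le_trans _ _ (\sum_(i <- J) (e / 2 / (size J).+1%:R))).
    apply: le_trans (ler_norm_sum _ _ _) _; apply: ler_sum => i _.
    by case: (HL i).
  rewrite big_const_seq count_predT iter_addr_0 -[leLHS]mulr_natr.
  rewrite mulrAC ler_pdivrMr; last by rewrite -natr1 ltr_wpDl.
  by rewrite ler_wpM2l ?(ltW e2)// -natr1 lerDl.
move: H0; rewrite !ler_norml => /andP[? ?] /andP[? ?]; apply/andP; split; lra.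
Qed.

Lemma sumle_sigma (I : choiceType) (K : I -> choiceType)
    (u : {i : I & K i} -> R) (M_ : I -> R) M :
  (forall i, sumle (fun k : K i => u (Tagged K k)) (M_ i)) -> sumle M_ M -> sumle u M.
Proof.
move=> uM MM J uJ.
apply: le_trans (MM (undup (map tag J)) (undup_uniq _)).
have -> : \sum_(x <- J) `|u x| =
    \sum_(x <- J) \sum_(i <- undup (map tag J) | tag x == i) `|u x|.
  rewrite big_seq [RHS]big_seq; apply: eq_bigr => x xJ.
  rewrite (eq_bigl (fun i => i == tag x)) => [|i]; last by rewrite eq_sym.
  rewrite -big_filter filter_pred1_uniq ?undup_uniq ?big_seq1//.
  by rewrite mem_undup; apply/mapP; exists x.
rewrite (exchange_big_dep predT)//=; apply: ler_sum => i _.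
rewrite -big_filter; have [L E] := fiber_seq J i.
rewrite E big_map; apply: le_trans (ler_norm _).
apply: uM; rewrite -(@map_inj_uniq _ _ (Tagged K)); first by rewrite -E filter_uniq.
by move=> k k' /eqP; rewrite eq_Tagged => /eqP.
Qed.

Lemma hassum_series (u : nat -> R) S : hassum u S -> series u @ \oo --> S.
Proof.
move=> uS; apply/cvgrPdist_le => e e0; have [J0 H] := uS _ e0.
exists (\max_(i <- J0) i).+1 => // N /= hN.
rewrite distrC seriesEnat /= /index_iota subn0; apply: H; first exact: iota_uniq.
move=> x xJ; rewrite mem_iota /= add0n; apply: leq_trans hN; rewrite ltnS.
exact: leq_bigmax_seq.
Qed.

Lemma hassum_inj (I I' : choiceType) (h : I -> I') (u : I' -> R) S :
  injective h -> (forall i', (forall i, i' <> h i) -> u i' = 0) ->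
  hassum (fun i => u (h i)) S -> hassum u S.
Proof.
move=> hI u0 uS e e0; have [J0 H] := uS _ e0.
exists (map h J0) => J uJ sJ.
have [L uL E] : exists2 L, uniq L & perm_eq [seq i' <- J | `[< exists i, i' = h i >]] (map h L).
  have [L E] : exists L, [seq i' <- J | `[< exists i, i' = h i >]] = map h L.
    elim: J {uJ sJ} => [|x J [L E]] /=; first by exists [::].
    case: asboolP => [[i ->]|_]; last by exists L.
    by exists (i :: L); rewrite E.
  by exists L; [rewrite -(map_inj_uniq hI) -E filter_uniq|rewrite E].
rewrite (bigID (fun i' => `[< exists i, i' = h i >])) /=.
rewrite [X in _ + X - _]big1 ?addr0 => [|i' /asboolPn ni]; last first.
  by apply: u0 => i ei; apply: ni; exists i.
rewrite -big_filter (perm_big _ E) big_map; apply: H => // i iJ.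
rewrite -(mem_map hI) -(perm_mem E) mem_filter sJ ?map_f// andbT.
by apply/asboolP; exists i.
Qed.

Lemma hassum_fun1 (I : choiceType) (u : I -> R) (i : I) :
  (forall j, j != i -> u j = 0) -> hassum u (u i).
Proof.
move=> u0; have h0 : injective (fun _ : unit => i) by do 2 case.
apply: (hassum_inj h0) => [j ji|].
  by apply: u0; apply/eqP => e; exact: (ji tt).
have := @hassum_fin unit (fun=> u i); by rewrite big_const card_unit /= addr0.
Qed.
End Hassum.

(** * Power series on polydiscs with explicit norms *)

Section An.
Context {R : realType}.

Definition mono {V : Type} (x : V -> R) (w : seq V) : R := \prod_(v <- w) x v.

Definition polyd {V : Type} (rho x : V -> R) := forall v, `|x v| <= rho v.

(* [F] is the sum, on the polydisc of radii [rho], of a power series with norm at most [M].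
   Monomials are words in the variables, so several indices may carry the same monomial. *)
Definition An {V : Type} (rho : V -> R) (F : (V -> R) -> R) (M : R) : Prop :=
  exists (I : choiceType) (c : I -> R) (w : I -> seq V),
    sumle (fun i => c i * mono rho (w i)) M /\
    forall x, polyd rho x -> hassum (fun i => c i * mono x (w i)) (F x).

Lemma mono_le (V : Type) (rho x : V -> R) w :
  polyd rho x -> `|mono x w| <= `|mono rho w|.
Proof.
move=> H; rewrite /mono !normr_prod; apply: ler_prod => v _.
by rewrite normr_ge0 /=; apply: le_trans (H v) (ler_norm _).
Qed.

Lemma term_le (V : Type) (rho x : V -> R) w c :
  polyd rho x -> `|c * mono x w| <= `|c * mono rho w|.
Proof. by move=> H; rewrite !normrM ler_wpM2l// mono_le. Qed.

Lemma An_eq (V : Type) (rho : V -> R) F G M :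
  (forall x, polyd rho x -> F x = G x) -> An rho F M -> An rho G M.
Proof.
by move=> FG [I [c [w [cM H]]]]; exists I, c, w; split=> // x Hx; rewrite -FG//; exact: H.
Qed.

Lemma An_le (V : Type) (rho rho' : V -> R) F M N :
  polyd rho rho' -> M <= N -> An rho F M -> An rho' F N.
Proof.
move=> r MN [I [c [w [cM H]]]]; exists I, c, w; split=> [|x Hx].
  by apply: sumle_le cM => // i; exact: term_le.
by apply: H => v; apply: le_trans (Hx v) _; apply: le_trans (ler_norm _) (r v).
Qed.

Lemma An_ge0 (V : Type) (rho : V -> R) F M : An rho F M -> 0 <= M.
Proof. by move=> [I [c [w [/sumle_ge0]]]]. Qed.

Lemma An_bound (V : Type) (rho : V -> R) F M x :
  An rho F M -> polyd rho x -> `|F x| <= M.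
Proof.
move=> [I [c [w [cM H]]]] Hx; apply: hassum_norm_le (H x Hx).
by apply: sumle_le cM => // i; exact: term_le.
Qed.

(** As monomials may repeat, the terms of the sum are the disjoint union of the given terms, indexed
    by a sigma type; nothing is regrouped by exponents. *)
Lemma An_sum (V : Type) (I : choiceType) (rho : V -> R) F_ (M_ : I -> R) F M :
  (forall i, An rho (F_ i) (M_ i)) -> sumle M_ M ->
  (forall x, polyd rho x -> hassum (fun i => F_ i x) (F x)) -> An rho F M.
Proof.
move=> FM MM FF.
have {}FM i : exists T : {K : choiceType & ((K -> R) * (K -> seq V))%type},
    sumle (fun k => (projT2 T).1 k * mono rho ((projT2 T).2 k)) (M_ i) /\
    forall x, polyd rho x ->
      hassum (fun k => (projT2 T).1 k * mono x ((projT2 T).2 k)) (F_ i x).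
  by have [K [c [w H]]] := FM i; exists (existT _ K (c, w)).
have [T HT] := choice FM.
pose K i := projT1 (T i).
pose c (p : {i : I & K i}) := (projT2 (T (tag p))).1 (tagged p).
pose w (p : {i : I & K i}) := (projT2 (T (tag p))).2 (tagged p).
have cM : sumle (fun p => c p * mono rho (w p)) M.
  by apply: (@sumle_sigma _ _ _ _ M_) MM => i; case: (HT i).
exists {i : I & K i}, c, w; split => // x Hx.
have [S HS] : exists S, hassum (fun p => c p * mono x (w p)) S.
  apply: (@sumle_hassum _ _ _ M).
  by apply: sumle_le cM => // p; exact: term_le.
have : hassum (fun i => F_ i x) S.
  by apply: (hassum_sigma HS) => i; case: (HT i) => _; exact.
by move=> /(hassum_unique (FF x Hx)) ->.
Qed.

(** Concatenation of words multiplies monomials, so the product is a sum over the terms of [F] of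
    scaled copies of the series of [G]. *)
Lemma An_mul (V : Type) (rho : V -> R) F G M N :
  An rho F M -> An rho G N -> An rho (fun x => F x * G x) (M * N).
Proof.
move=> HF HG; have N0 := An_ge0 HG; case: HF => I [c [w [cM HF]]].
apply: (@An_sum _ I rho (fun i x => c i * mono x (w i) * G x)
    (fun i => `|c i * mono rho (w i)| * N)).
- move=> i; case: HG => J [d [z [dN HG]]].
  exists J, (fun j => c i * d j), (fun j => w i ++ z j); split=> [|x Hx].
    apply: sumle_le (sumleZ (c i * mono rho (w i)) dN) => // j.
    by rewrite /mono big_cat /= mulrACA.
  apply: eq_hassum (hassumZ (c i * mono x (w i)) (HG x Hx)) => j.
  by rewrite /mono big_cat /= mulrACA.
- rewrite mulrC -(ger0_norm N0).
  have := sumleZ N cM; rewrite (ger0_norm N0); apply: sumle_le => // i.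
  by rewrite !normrM !normr_id mulrC -!normrM.
- move=> x Hx; rewrite [F x * _]mulrC.
  by apply: eq_hassum (hassumZ (G x) (HF x Hx)) => i; rewrite mulrC.
Qed.

Lemma An_const (V : Type) (rho : V -> R) a : An rho (fun=> a) `|a|.
Proof.
exists unit, (fun=> a), (fun=> [::]); split=> [|x _].
  have := @sumle_fin R unit (fun=> a); rewrite big_const card_unit /= addr0.
  by apply: sumle_le => // i; rewrite /mono big_nil mulr1.
have := @hassum_fin R unit (fun=> a); rewrite big_const card_unit /= addr0.
by apply: eq_hassum => i; rewrite /mono big_nil mulr1.
Qed.

Lemma An_var (V : Type) (rho : V -> R) v : An rho (fun x => x v) `|rho v|.
Proof.
exists unit, (fun=> 1), (fun=> [:: v]); split=> [|x _].
  have := @sumle_fin R unit (fun=> rho v); rewrite big_const card_unit /= addr0.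
  by apply: sumle_le => // i; rewrite /mono big_seq1 mul1r.
have := @hassum_fin R unit (fun=> x v); rewrite big_const card_unit /= addr0.
by apply: eq_hassum => i; rewrite /mono big_seq1 mul1r.
Qed.

Lemma An_big (V : Type) (I : finType) (rho : V -> R) F_ (M_ : I -> R) :
  (forall i, An rho (F_ i) (M_ i)) ->
  An rho (fun x => \sum_i F_ i x) (\sum_i M_ i).
Proof.
move=> H; apply: (@An_sum _ I rho F_ M_) => //.
  have -> : \sum_i M_ i = \sum_i `|M_ i|.
    by apply: eq_bigr => i _; rewrite ger0_norm// (An_ge0 (H i)).
  exact: sumle_fin.
by move=> x _; exact: hassum_fin.
Qed.

Lemma An_add (V : Type) (rho : V -> R) F G M N :
  An rho F M -> An rho G N -> An rho (fun x => F x + G x) (M + N).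
Proof.
move=> HF HG.
have := @An_big V bool rho (fun b => if b then F else G) (fun b => if b then M else N).
rewrite big_bool /= => /(_ _)H; apply: An_eq (H _) => [x _|[]//].
by rewrite big_bool.
Qed.

Lemma An_scale (V : Type) (rho : V -> R) F M a :
  An rho F M -> An rho (fun x => a * F x) (`|a| * M).
Proof. by move=> HF; apply: An_mul => //; exact: An_const. Qed.

Lemma An_opp (V : Type) (rho : V -> R) F M :
  An rho F M -> An rho (fun x => - F x) M.
Proof.
move=> HF; have := An_scale (-1) HF; rewrite normrN1 mul1r.
by apply: An_eq => x _; rewrite mulN1r.
Qed.

Lemma An_sub (V : Type) (rho : V -> R) F G M N :
  An rho F M -> An rho G N -> An rho (fun x => F x - G x) (M + N).
Proof. by move=> HF HG; apply: An_add => //; exact: An_opp. Qed.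

Lemma An_exp (V : Type) (rho : V -> R) F M n :
  An rho F M -> An rho (fun x => F x ^+ n) (M ^+ n).
Proof.
move=> HF; elim: n => [|n IH].
  by rewrite expr0 -(@normr1 R); apply: An_eq (An_const rho 1) => x _; rewrite expr0.
by rewrite exprS; apply: An_eq (An_mul HF IH) => x _; rewrite exprS.
Qed.

(** Norms are submultiplicative: a word turns into a product of series whose norms are the radii of
    its letters, and the norm of [F] is kept. *)
Lemma An_subst (V W : Type) (rho : V -> R) (eta : W -> R) F M (L : V -> (W -> R) -> R) :
  An rho F M -> (forall v, An eta (L v) (rho v)) ->
  An eta (fun x => F (fun v => L v x)) M.
Proof.
move=> [I [c [w [cM HF]]]] HL.
apply: (@An_sum _ I eta (fun i x => c i * mono (fun v => L v x) (w i))
   (fun i => `|c i| * mono rho (w i))).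
- move=> i; apply: An_scale; elim: (w i) => [|v s IH].
    rewrite /mono big_nil -(@normr1 R).
    by apply: An_eq (An_const eta 1) => x _; rewrite big_nil normr1.
  by rewrite /mono big_cons; apply: An_eq (An_mul (HL v) IH) => x _; rewrite /mono big_cons.
- by apply: sumle_le cM => // i; rewrite !normrM normr_id.
- by move=> x Hx; apply: HF => v; apply: An_bound (HL v) Hx.
Qed.

Lemma mono0 (V : Type) (w : seq V) : mono (fun=> 0 : R) w = (nilp w)%:R.
Proof. by case: w => [|v w]; rewrite /mono ?big_nil// big_cons mul0r. Qed.

(** A form of the Schwarz lemma: once the empty words are removed, each remaining word has at least
    one letter and gains a factor [theta]. *)
Lemma An_sub0 (V : Type) (rho : V -> R) F M theta : 0 <= theta <= 1 ->
  (forall v, 0 <= rho v) ->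
  An rho F M -> An (fun v => theta * rho v) (fun x => F x - F (fun=> 0)) (theta * M).
Proof.
move=> /andP[t0 t1] r0 [I [c [w [cM HF]]]].
exists I, (fun i => c i * (~~ nilp (w i))%:R), w; split=> [|x Hx].
  have := sumleZ theta cM; rewrite ger0_norm//; apply: sumle_le => // i.
  have -> : mono (fun v => theta * rho v) (w i) = theta ^+ size (w i) * mono rho (w i).
    by rewrite /mono big_split big_const_seq count_predT iter_mulr_1.
  case: (w i) => [|v s] /=; first by rewrite mulr0 mul0r normr0.
  rewrite mulr1 mulrCA normrM [leRHS]normrM ler_wpM2r// ger0_norm ?exprn_ge0//.
  by rewrite (ger0_norm t0) exprS ler_piMr// exprn_ile1.
have Hx' : polyd rho x.
  by move=> v; apply: le_trans (Hx v) _; rewrite ler_piMl.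
have H0 : polyd rho (fun=> 0) by move=> v; rewrite normr0.
have := hassumD (HF x Hx') (hassumZ (-1) (HF _ H0)); rewrite mulN1r.
apply: eq_hassum => i; rewrite mono0; case: (w i) => [|v s] /=.
  by rewrite /mono big_nil; ring.
by ring.
Qed.

Lemma mono_cont (V : Type) (x : V -> R) (w : seq V) (e : R) : 0 < e ->
  exists2 d, 0 < d & forall y, (forall v, `|x v - y v| <= d) -> `|mono x w - mono y w| <= e.
Proof.
elim: w e => [|v w IH] e e0.
  by exists 1 => // y _; rewrite /mono !big_nil subrr normr0 ltW.
pose A := `|x v| + `|mono x w| + 1.
have A0 : 0 < A by rewrite ltr_wpDl// addr_ge0.
pose e1 := Num.min 1 (e / 2 / A).
have e10 : 0 < e1 by rewrite lt_min ltr01 /= !divr_gt0.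
have e1A : e1 * A <= e / 2 by rewrite -ler_pdivlMr// ge_min lexx orbT.
have [d d0 H] := IH _ e10.
exists (Num.min d e1) => [|y Hy]; first by rewrite lt_min d0.
have {}H : `|mono x w - mono y w| <= e1.
  by apply: H => v'; apply: le_trans (Hy v') _; rewrite ge_min lexx.
have Hv : `|x v - y v| <= e1 by apply: le_trans (Hy v) _; rewrite ge_min lexx orbT.
rewrite /mono !big_cons -/(mono x w) -/(mono y w).
rewrite (_ : _ - _ = (x v - y v) * mono x w + x v * (mono x w - mono y w)
   - (x v - y v) * (mono x w - mono y w)); last by ring.
apply: le_trans (ler_normB _ _) _.
apply: (@le_trans _ _ (e1 * `|mono x w| + `|x v| * e1 + e1 * 1)).
  apply: lerD; last first.
    rewrite normrM ler_pM//; apply: le_trans H _; by rewrite ge_min lexx.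
  by apply: le_trans (ler_normD _ _) _; rewrite !normrM lerD// ?ler_wpM2r// ler_wpM2l.
move: e1A; rewrite /A; lra.
Qed.

(** By [hassum_tail] the function is within [e / 3] of one finite sum of monomials on the whole
    polydisc, and monomials are continuous. *)
Lemma An_cont (V : Type) (rho : V -> R) F M x (e : R) :
  An rho F M -> polyd rho x -> 0 < e ->
  exists2 d, 0 < d & forall y, polyd rho y -> (forall v, `|x v - y v| <= d) ->
    `|F x - F y| <= e.
Proof.
move=> [I [c [w [cM HF]]]] Hx e0.
have e3 : 0 < e / 3 by rewrite divr_gt0.
have [J0 uJ0 H0] := hassum_tail cM e3.
have Hb y : polyd rho y -> `|\sum_(i <- J0) c i * mono y (w i) - F y| <= e / 3.
  by move=> Hy; apply: H0 (HF y Hy) => i; exact: term_le.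
have [d d0 Hd] : exists2 d, 0 < d & forall y, (forall v, `|x v - y v| <= d) ->
    `|\sum_(i <- J0) c i * mono x (w i) - \sum_(i <- J0) c i * mono y (w i)| <= e / 3.
  elim: J0 {uJ0 H0 Hb} (e / 3) e3 => [|i J IH] e' e'0.
    by exists 1 => // y _; rewrite !big_nil subrr normr0 ltW.
  have e'2 : 0 < e' / 2 by rewrite divr_gt0.
  have [d1 d10 H1] := IH _ e'2.
  have c0 : 0 < `|c i| + 1 by rewrite ltr_wpDl.
  have [d2 d20 H2] := mono_cont x (w i) (divr_gt0 e'2 c0).
  exists (Num.min d1 d2) => [|y Hy]; first by rewrite lt_min d10.
  have {}H1 := H1 y (fun v => le_trans (Hy v) (_ : Num.min d1 d2 <= d1)).
  have {}H2 := H2 y (fun v => le_trans (Hy v) (_ : Num.min d1 d2 <= d2)).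
  move: H1 H2; rewrite !ge_min !lexx orbT => /(_ isT) H1 /(_ isT) H2.
  rewrite !big_cons.
  set a := \sum_(j <- J) _ in H1 *; set b := \sum_(j <- J) _ in H1 *.
  rewrite (_ : _ - _ = c i * (mono x (w i) - mono y (w i)) + (a - b)); last by ring.
  apply: le_trans (ler_normD _ _) _; rewrite normrM.
  have : `|c i| * `|mono x (w i) - mono y (w i)| <= (`|c i| + 1) * (e' / 2 / (`|c i| + 1)).
    by apply: ler_pM => //; rewrite lerDl.
  rewrite mulrCA divff ?gt_eqF// mulr1; lra.
exists d => // y Hy xy.
have h1 := Hb x Hx; have h2 := Hb y Hy; have h3 := Hd y xy.
move: h1 h2 h3; rewrite !ler_norml => /andP[? ?] /andP[? ?] /andP[? ?].
apply/andP; split; lra.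
Qed.

End An.

(** * Weierstrass preparation *)

Section Split.
Context {R : realType}.

(** [None] is the variable singled out in Weierstrass preparation. The same function builds points
    and radii. *)
Definition ocons {V : Type} (t : R) (y : V -> R) (v : option V) : R :=
  if v is Some v' then y v' else t.

Lemma polyd_ocons (V : Type) (s t : R) (rho y : V -> R) :
  `|t| <= s -> polyd rho y -> polyd (ocons s rho) (ocons t y).
Proof. by move=> ts ry [v|] /=. Qed.

Lemma ocons_eta (V : Type) (x : option V -> R) : ocons (x None) (x \o Some) = x.
Proof. by apply/funext => -[]. Qed.

Definition tcount {V : Type} (w : seq (option V)) := count (fun v => ~~ isSome v) w.

Lemma mono_ocons (V : Type) (t : R) (y : V -> R) (w : seq (option V)) :
  mono (ocons t y) w = t ^+ tcount w * mono y (pmap id w).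
Proof.
rewrite /mono; elim: w => [|[v|] w IH] /=; first by rewrite !big_nil mulr1.
  by rewrite !big_cons IH /= mulrCA.
by rewrite big_cons IH /= exprS mulrA.
Qed.

(** Words are sorted by their number of letters [None], that is by the power of [t]; dividing by
    [t^j] costs [s^j] in norm, which gives Cauchy estimates without contour integrals. *)
Lemma An_split (V : Type) (s : R) (rho : V -> R) F M (k : nat) :
  0 < s -> (forall v, 0 <= rho v) -> An (ocons s rho) F M ->
  exists H r, [/\ An (ocons s rho) H (M / s ^+ k),
    (forall j, An rho (r j) (M / s ^+ j)) &
    forall t y, `|t| <= s -> polyd rho y ->
      F (ocons t y) = t ^+ k * H (ocons t y) + \sum_(j < k) t ^+ j * r j y].
Proof.
move=> s0 r0 [I [c [w [cM HF]]]].
have pr : polyd rho rho by move=> v; rewrite ger0_norm.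
pose d j i := c i * (tcount (w i) == j)%:R.
pose b i := c i * (k <= tcount (w i))%:R.
(* The word with [k] letters [None] removed. It is used only when there are that many, since [b i]
   vanishes otherwise and the truncated subtraction does no harm. *)
pose z i := nseq (tcount (w i) - k) None ++ map Some (pmap id (w i)).
have tz i : tcount (z i) = (tcount (w i) - k)%N.
  rewrite /tcount count_cat count_nseq /= mul1n.
  by rewrite count_map (@eq_count _ _ pred0) ?count_pred0 ?addn0.
have yz i : pmap id (z i) = pmap id (w i).
  rewrite /z pmap_cat (_ : pmap id (nseq _ _) = [::]); last by elim: (_ - _)%N.
  by rewrite cat0s; elim: (pmap id (w i)) => //= v l ->.
have dM j : sumle (fun i => d j i * mono rho (pmap id (w i))) (M / s ^+ j).
  rewrite mulrC -(ger0_norm (_ : 0 <= (s ^+ j)^-1)) ?invr_ge0 ?exprn_ge0 ?ltW//.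
  apply: sumle_le (sumleZ (s ^+ j)^-1 cM) => // i; rewrite /d mono_ocons.
  case: eqP => [->|_]; last by rewrite mulr0 mul0r normr0.
  by rewrite mulr1 mulrCA mulKf// expf_neq0// gt_eqF.
have bM : sumle (fun i => b i * mono (ocons s rho) (z i)) (M / s ^+ k).
  rewrite mulrC -(ger0_norm (_ : 0 <= (s ^+ k)^-1)) ?invr_ge0 ?exprn_ge0 ?ltW//.
  apply: sumle_le (sumleZ (s ^+ k)^-1 cM) => // i; rewrite /b !mono_ocons tz yz.
  case: leqP => [ki|_]; last by rewrite mulr0 mul0r normr0.
  rewrite mulr1 -[in leRHS](subnKC ki) exprD.
  set a := s ^+ (_ - k); set m := mono rho _.
  by rewrite (_ : s ^- k * _ = c i * (a * m))//; field; rewrite expf_neq0// gt_eqF.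
exists (fun x => tsum (fun i => b i * mono x (z i))).
exists (fun j y => tsum (fun i => d j i * mono y (pmap id (w i)))).
have hH x : polyd (ocons s rho) x ->
    hassum (fun i => b i * mono x (z i)) (tsum (fun i => b i * mono x (z i))).
  move=> Hx; apply: (@hassum_tsum _ _ _ (M / s ^+ k)).
  by apply: sumle_le bM => // i; exact: term_le.
have hr j y : polyd rho y -> hassum (fun i => d j i * mono y (pmap id (w i)))
    (tsum (fun i => d j i * mono y (pmap id (w i)))).
  move=> Hy; apply: (@hassum_tsum _ _ _ (M / s ^+ j)).
  by apply: sumle_le (dM j) => // i; exact: term_le.
split; first by exists I, b, z.
  by move=> j; exists I, (d j), (fun i => pmap id (w i)); split; [exact: dM|exact: hr].
move=> t y ts ry; have Hx := polyd_ocons ts ry.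
apply: (hassum_unique (HF _ Hx)).
have := hassumZ (t ^+ k) (hH _ Hx).
have /hassumD H2 : hassum (fun i => \sum_(j < k) t ^+ j * (d j i * mono y (pmap id (w i))))
    (\sum_(j < k) t ^+ j * tsum (fun i => d j i * mono y (pmap id (w i)))).
  elim: k {b z tz yz bM hH} => [|k IH].
    rewrite big_ord0 => e e0; exists [::] => J _ _.
    by under eq_bigr do rewrite big_ord0; rewrite big1// subrr normr0 ltW.
  rewrite big_ord_recr /=; apply: eq_hassum (hassumD IH (hassumZ (t ^+ k) (hr k y ry))) => i.
  by rewrite big_ord_recr.
move=> /H2; rewrite addrC; apply: eq_hassum => i.
rewrite !mono_ocons tz yz /b /d.
case: leqP => ki.
  rewrite big1 ?add0r => [|j _].
    by rewrite mulr1 mulrCA (mulrA (t ^+ k)) -exprD subnKC.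
  by rewrite gtn_eqF ?mulr0 ?mul0r ?mulr0// (leq_trans _ ki).
rewrite mulr0 mul0r mulr0 addr0 (bigD1 (Ordinal ki))//= eqxx mulr1.
rewrite big1 ?addr0 => [|j jk]; first by rewrite mulrCA.
rewrite [_ == _]eq_sym (_ : (_ == _ :> nat) = false) ?mulr0 ?mul0r ?mulr0//.
by apply: negbTE; apply: contra jk => /eqP jk; apply/eqP/val_inj.
Qed.

(* [F (x + h w)] is a power series in the extra variable [h]. *)
Lemma An_deriv (V : Type) (rho rho' w : V -> R) (eta : R) F M :
  0 < eta -> (forall v, 0 <= rho' v) ->
  (forall v, rho' v + eta * `|w v| <= rho v) -> An rho F M ->
  exists G, An rho' G (M / eta) /\ exists K, forall x h, polyd rho' x -> `|h| <= eta ->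
    `|F (fun v => x v + h * w v) - F x - h * G x| <= K * h ^+ 2.
Proof.
move=> e0 r0 re HF.
have HF' : An (ocons eta rho') (fun x => F (fun v => x (Some v) + x None * w v)) M.
  apply: (An_subst HF) => v.
  apply: (An_le _ (re v)); first by move=> u; rewrite ger0_norm//; case: u => //=; rewrite ltW.
  apply: An_add.
    by have := An_var (ocons eta rho') (Some v); rewrite /= ger0_norm.
  have := An_scale (w v) (An_var (ocons eta rho') None).
  rewrite /= (gtr0_norm e0) mulrC; apply: An_eq => x _; exact: mulrC.
have [H [r [HH Hr E]]] := An_split 2 e0 r0 HF'.
exists (r 1%N); split; first by have := Hr 1%N; rewrite expr1.
exists (M / eta ^+ 2) => x h Hx he.
have E0 := E 0 x; rewrite normr0 in E0; have {}E0 := E0 (ltW e0) Hx.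
have {E} := E h x he Hx; rewrite big_ord_recr big_ord1 /= !expr0 !mul1r expr1.
move: E0; rewrite big_ord_recr big_ord1 /= (expr0n _ 2) /= mul0r add0r expr0 expr1 mul0r mul1r addr0.
rewrite (_ : (fun v => x v + 0 * w v) = x); last by apply/funext => v; rewrite mul0r addr0.
move=> -> ->; rewrite (_ : _ - _ - _ = h ^+ 2 * H (ocons h x)); last by ring.
rewrite normrM mulrC normrX real_normK ?num_real// ler_wpM2r ?sqr_ge0//.
by apply: An_bound HH _; apply: polyd_ocons.
Qed.

End Split.

Section Weierstrass.
Context {R : realType}.

Lemma sumle_geo (e : R) : 0 <= e <= 2^-1 -> sumle (fun n => e ^+ n) 2.
Proof.
move=> /andP[e0 e1] J uJ.
apply: (@le_trans _ _ (\sum_(n < (\max_(i <- J) i).+1) e ^+ n)).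
  rewrite -(big_mkord predT (fun n => e ^+ n)) /index_iota subn0.
  rewrite (@sum_subset _ _ _ J (iota _ _)) ?iota_uniq//; last first.
    by move=> x xJ; rewrite mem_iota /= add0n ltnS; exact: leq_bigmax_seq.
  rewrite (eq_bigr (fun i => e ^+ i)) => [|i _]; last by rewrite ger0_norm// exprn_ge0.
  by rewrite lerDl sumr_ge0// => i _; rewrite exprn_ge0.
move: (_.+1) => N; apply: (@le_trans _ _ (2 - 2 * e ^+ N)); last first.
  by rewrite gerBl mulr_ge0// exprn_ge0.
elim: N => [|N IH]; first by rewrite big_ord0 expr0; lra.
rewrite big_ord_recr /= exprS.
have : e * e ^+ N <= 2^-1 * e ^+ N by rewrite ler_wpM2r// exprn_ge0.
lra.
Qed.

Lemma hassum_recl (u : nat -> R) S :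
  hassum (fun n => u n.+1) S -> hassum u (u 0%N + S).
Proof.
move=> uS.
pose v n := if n is 0%N then u 0%N else 0; pose z n := if n is 0%N then 0 else u n.
have h1 : hassum v (v 0%N) by apply: hassum_fun1 => -[].
have h2 : hassum z S.
  apply: (@hassum_inj _ _ _ succn) => //; first exact: succn_inj.
  by case=> // n /(_ n).
by apply: eq_hassum (hassumD h1 h2) => -[|n] /=; rewrite ?addr0 ?add0r.
Qed.

(* [Q] is the Neumann series of the map [q |-> - H], where
   [q * err = t^k H + lower order terms in t]. *)
Lemma weierstrass_normalized (V : Type) (s : R) (rho : V -> R) (k : nat) err (e : R) :
  0 < s -> (forall v, 0 <= rho v) -> 0 <= e <= 2^-1 ->
  An (ocons s rho) err (e * s ^+ k) ->
  exists Q r, [/\ An (ocons s rho) Q 2,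
    (forall x, polyd (ocons s rho) x -> `|Q x - 1| <= 2 * e),
    (forall j, An rho (r j) (2 * e * s ^+ k / s ^+ j)) &
    forall t y, `|t| <= s -> polyd rho y ->
      Q (ocons t y) * (t ^+ k + err (ocons t y)) = t ^+ k + \sum_(j < k) t ^+ j * r j y].
Proof.
move=> s0 r0 He Herr; have /andP[e0 e1] := He.
pose T := (option V -> R) -> R.
have sn0 j : s ^+ j != 0 by rewrite expf_neq0// gt_eqF.
(* The choice is made for every pair of a function and a norm, analyticity being a premise; thus the
   iteration [q_] can be defined before its terms are known to be analytic. *)
have step (p : T * R) : exists Hr : T * (nat -> (V -> R) -> R),
    An (ocons s rho) p.1 p.2 -> [/\ An (ocons s rho) Hr.1 (p.2 * e),
    (forall j, An rho (Hr.2 j) (p.2 * e * s ^+ k / s ^+ j)) &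
    forall t y, `|t| <= s -> polyd rho y -> p.1 (ocons t y) * err (ocons t y) =
      t ^+ k * Hr.1 (ocons t y) + \sum_(j < k) t ^+ j * Hr.2 j y].
  have [Hp|nHp] := pselect (An (ocons s rho) p.1 p.2); last first.
    by exists (fun=> 0, fun _ _ => 0) => /nHp.
  have [H [r [HH Hr E]]] := An_split k s0 r0 (An_mul Hp Herr).
  exists (H, r) => _; split => //=; first by move: HH; rewrite mulrA mulfK.
  by move=> j; rewrite -(mulrA p.2); exact: Hr.
have [st Hst] := choice step.
pose q_ := fix q n : T := if n is n'.+1 then (fun x => - (st (q n', e ^+ n')).1 x) else fun=> 1.
pose r_ n := (st (q_ n, e ^+ n)).2.
have qn n : An (ocons s rho) (q_ n) (e ^+ n).
  elim: n => [|n IH]; first by rewrite expr0 -(@normr1 R); exact: An_const.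
  by have [+ _ _] := Hst (q_ n, e ^+ n) IH; rewrite /= -exprSr; exact: An_opp.
have rn n j : An rho (r_ n j) (e ^+ n * (e * s ^+ k / s ^+ j)).
  by have [_ + _] := Hst (q_ n, e ^+ n) (qn n); move=> /(_ j); rewrite /= !mulrA.
have en n t y : `|t| <= s -> polyd rho y -> q_ n (ocons t y) * err (ocons t y) =
    - t ^+ k * q_ n.+1 (ocons t y) + \sum_(j < k) t ^+ j * r_ n j y.
  move=> ts ry; have [_ _ /(_ t y ts ry)] := Hst (q_ n, e ^+ n) (qn n).
  by rewrite /= => ->; rewrite mulrNN.
have geo := sumle_geo He.
have geo1 : sumle (fun n => e ^+ n.+1) (2 * e).
  have := sumleZ e geo; rewrite ger0_norm// mulrC; apply: sumle_le => // n.
  by rewrite exprS.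
have geoj j : sumle (fun n => e ^+ n * (e * s ^+ k / s ^+ j)) (2 * e * s ^+ k / s ^+ j).
  have c0 : 0 <= e * s ^+ k / s ^+ j by rewrite !mulr_ge0 ?invr_ge0 ?exprn_ge0// ltW.
  have := sumleZ (e * s ^+ k / s ^+ j) geo; rewrite ger0_norm//.
  apply: sumle_le => [i|]; first by rewrite mulrC.
  by rewrite mulrC !mulrA.
pose A x := tsum (fun n => q_ n.+1 x).
have hA x : polyd (ocons s rho) x -> hassum (fun n => q_ n.+1 x) (A x).
  move=> Hx; apply: hassum_tsum; apply: sumle_le geo1 => // n.
  by rewrite [leRHS]ger0_norm ?exprn_ge0//; exact: An_bound (qn n.+1) Hx.
have AnA : An (ocons s rho) A (2 * e).
  by apply: (An_sum (fun n => qn n.+1)).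
have hr j y : polyd rho y -> hassum (fun n => r_ n j y) (tsum (fun n => r_ n j y)).
  move=> Hy; apply: hassum_tsum; apply: sumle_le (geoj j) => // n.
  by apply: le_trans (ler_norm _); exact: An_bound (rn n j) Hy.
have hQ x : polyd (ocons s rho) x -> hassum (fun n => q_ n x) (1 + A x).
  by move=> Hx; apply: (hassum_recl (u := fun n => q_ n x)); exact: hA.
exists (fun x => 1 + A x), (fun j y => tsum (fun n => r_ n j y)); split.
- by apply: (An_sum qn).
- by move=> x Hx; rewrite addrAC subrr add0r; exact: An_bound AnA Hx.
- by move=> j; exact: (An_sum (fun n => rn n j) (geoj j) (hr j)).
- move=> t y ts ry; have Hx := polyd_ocons ts ry.
  have h1 := hassumZ (err (ocons t y)) (hQ _ Hx).
  have h2 := hassumZ (- t ^+ k) (hA _ Hx).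
  have h3 : hassum (fun n => \sum_(j < k) t ^+ j * r_ n j y)
      (\sum_(j < k) t ^+ j * tsum (fun n => r_ n j y)).
    elim: (k) => [|k' IH].
      rewrite big_ord0 => d d0; exists [::] => J _ _.
      by under eq_bigr do rewrite big_ord0; rewrite big1// subrr normr0 ltW.
    rewrite big_ord_recr /=; apply: eq_hassum (hassumD IH (hassumZ (t ^+ k') (hr k' y ry))) => i.
    by rewrite big_ord_recr.
  have E : err (ocons t y) * (1 + A (ocons t y)) = - t ^+ k * A (ocons t y) +
      \sum_(j < k) t ^+ j * tsum (fun n => r_ n j y).
    apply: (hassum_unique h1); apply: eq_hassum (hassumD h2 h3) => n.
    by rewrite -en// mulrC.
  by rewrite mulrDr [_ * err _]mulrC E; ring.
Qed.

(** The order of vanishing in [t] on the axis is finite: if the first [K] coefficients were all zero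
    at [0], the value at [t0] would be at most [M (|t0| / s0)^K], too small for large [K]. *)
Lemma leading_coef_exists (V : Type) (s0 : R) (rho : V -> R) F M t0 :
  0 < s0 -> (forall v, 0 <= rho v) -> An (ocons s0 rho) F M ->
  `|t0| < s0 -> F (ocons t0 (fun=> 0)) != 0 ->
  exists K H r k, [/\ An (ocons s0 rho) H (M / s0 ^+ K),
    (forall j, An rho (r j) (M / s0 ^+ j)),
    (forall t y, `|t| <= s0 -> polyd rho y ->
      F (ocons t y) = t ^+ K * H (ocons t y) + \sum_(j < K) t ^+ j * r j y),
    (k < K)%N & r k (fun=> 0) != 0 /\ forall j, (j < k)%N -> r j (fun=> 0) = 0].
Proof.
move=> s00 r0 HF ts Ft0.
have p0 : polyd rho (fun=> 0) by move=> v; rewrite normr0.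
have [K HK] : exists K : nat, M * (`|t0| / s0) ^+ K < `|F (ocons t0 (fun=> 0))|.
  have /cvgrPdist_lt/(_ `|F (ocons t0 (fun=> 0))|) :
      (fun K => M * (`|t0| / s0) ^+ K) @ \oo --> M * 0.
    apply: cvgMr; apply: cvg_expr.
    by rewrite normrM normr_id gtr0_norm ?invr_gt0// ltr_pdivrMr// mul1r.
  rewrite normr_gt0 => /(_ Ft0)[K _ /(_ K (leqnn K))] /=.
  rewrite mulr0 sub0r normrN => H; exists K; apply: le_lt_trans H; exact: ler_norm.
have [H [r [HH Hr E]]] := An_split K s00 r0 HF.
have [k /andP[kK rk] kmin] : exists2 k, (k < K)%N && (r k (fun=> 0) != 0) &
    forall j, (j < K)%N && (r j (fun=> 0) != 0) -> (k <= j)%N.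
  have ex : exists k, (k < K)%N && (r k (fun=> 0) != 0).
    apply: contrapT => nex; move: HK; rewrite ltNge => /negP; apply.
    rewrite (E _ _ (ltW ts) p0) big1 ?addr0 => [|j _].
      rewrite normrM normrX expr_div_n mulrCA ler_wpM2l ?exprn_ge0//.
      by apply: An_bound HH (polyd_ocons (ltW ts) p0).
    apply: contrapT => /eqP; rewrite mulf_eq0 => /norP[_ rj].
    by apply: nex; exists j; rewrite ltn_ord.
  by case: (ex_minnP ex) => k h1 h2; exists k.
exists K, H, r, k; split => //; split => // j jk; apply: contrapT => /eqP rj.
by have := kmin j; rewrite rj (ltn_trans jk kK) => /(_ isT); rewrite leqNgt jk.
Qed.

(** First [s] is shrunk against the powers of [t] above [k], then [theta] against the variation of
    the coefficients in [y], once [s] is fixed. The tolerance [eps] is a function because the degree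
    [k] is found only inside the proof. *)
Lemma weierstrass_normalize (V : Type) (s0 : R) (rho : V -> R) F M t0 (s1 : R)
    (eps : nat -> R) :
  0 < s0 -> (forall v, 0 <= rho v) -> An (ocons s0 rho) F M ->
  `|t0| < s0 -> F (ocons t0 (fun=> 0)) != 0 -> 0 < s1 -> (forall k, 0 < eps k) ->
  exists (k : nat) (c s theta : R), [/\ c != 0, 0 < s <= s1, s <= s0, 0 < theta <= 1 &
    An (ocons s (fun v => theta * rho v)) (fun x => F x / c - x None ^+ k) (eps k * s ^+ k)].
Proof.
move=> s00 r0 HF ts Ft0 s10 eps0.
have [K [H [r [k [HH Hr E kK [rk rj]]]]]] := leading_coef_exists s00 r0 HF ts Ft0.
set c := r k (fun=> 0) in rk.
have M0 : 0 <= M := An_ge0 HF.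
have p0 : polyd rho (fun=> 0) by move=> v; rewrite normr0.
have c0 : 0 < `|c| by rewrite normr_gt0.
pose B := K.+1%:R * M / s0 ^+ k.+1 + 1.
have B0 : 0 < B by rewrite ltr_wpDl// divr_ge0 ?mulr_ge0 ?exprn_ge0// ltW.
(* Half of the allowed error [|c| eps s^k]: the at most [K + 1] terms of order above [k] carry an
   additional factor [s]. *)
pose s := Num.min (Num.min s1 s0) (`|c| * eps k / 2 / B).
have sB : s * B <= `|c| * eps k / 2 by rewrite -ler_pdivlMr// ge_min lexx orbT.
have s_gt0 : 0 < s by rewrite !lt_min s10 s00 !divr_gt0// mulr_gt0.
have ss1 : s <= s1 by rewrite !ge_min lexx.
have ss0 : s <= s0 by rewrite !ge_min lexx orbT.
pose D := K%:R * M + 1.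
have D0 : 0 < D by rewrite ltr_wpDl// mulr_ge0.
(* The other half of the error: by [An_sub0] each coefficient [r j] varies by at most [theta] times
   its norm. *)
pose theta := Num.min 1 (`|c| * eps k / 2 * s ^+ k / D).
have tD : theta * D <= `|c| * eps k / 2 * s ^+ k by rewrite -ler_pdivlMr// ge_min lexx orbT.
have t0' : 0 < theta by rewrite lt_min ltr01 !divr_gt0 ?mulr_gt0 ?exprn_gt0.
have t1 : theta <= 1 by rewrite ge_min lexx.
have th : 0 <= theta <= 1 by rewrite ltW.
exists k, c, s, theta; split; rewrite ?s_gt0 ?ss1 ?t0' ?t1//.
pose rho' v := theta * rho v.
have r'0 v : 0 <= rho' v by rewrite mulr_ge0// ltW.
have pr : polyd rho rho' by move=> v; rewrite ger0_norm// ler_piMl.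
have ps : polyd (ocons s0 rho) (ocons s rho') by apply: polyd_ocons; rewrite ?gtr0_norm.
have p' x : polyd rho' x -> polyd rho x.
  by move=> Hx v; apply: le_trans (Hx v) _; rewrite ler_piMl.
(* The error has three pieces: the remainder beyond [t^K] in [H1], the powers between [k] and [K]
   with coefficients frozen at [y = 0] in [H2], and the variation of the coefficients in [H3]. *)
have H1 : An (ocons s rho') (fun x => x None ^+ K * H x) ((s / s0) ^+ k.+1 * M).
  have := An_mul (An_exp K (An_var (ocons s rho') None)) (An_le ps (lexx _) HH).
  apply: An_le; first by move=> [v|] /=; rewrite ger0_norm// ltW.
  rewrite /= gtr0_norm// mulrCA -expr_div_n mulrC ler_wpM2r//.
  by rewrite ler_wiXn2l// ?divr_ge0 ?ler_pdivrMr ?mul1r// ltW.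
have sj (j : nat) : (k < j)%N -> s ^+ j * (M / s0 ^+ j) <= (s / s0) ^+ k.+1 * M.
  move=> kj; rewrite mulrCA -expr_div_n mulrC ler_wpM2r//.
  by rewrite ler_wiXn2l// ?divr_ge0 ?ler_pdivrMr ?mul1r// ltW.
have H2 : An (ocons s rho') (fun x => \sum_(j < K | (k < j)%N) x None ^+ j * r j (fun=> 0))
    (K%:R * ((s / s0) ^+ k.+1 * M)).
  have G0 : 0 <= (s / s0) ^+ k.+1 * M by rewrite mulr_ge0 ?exprn_ge0 ?divr_ge0// ltW.
  have h (j : 'I_K) : An (ocons s rho') (fun x => x None ^+ j *
      (if (k < j)%N then r j (fun=> 0) else 0)) ((s / s0) ^+ k.+1 * M).
    have h := An_mul (An_exp j (An_var (ocons s rho') None))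
      (An_const (ocons s rho') (if (k < j)%N then r j (fun=> 0) else 0)).
    apply: An_le h; first by move=> [v|] /=; rewrite ger0_norm// ltW.
    rewrite /= gtr0_norm//; case: ifP => kj; last by rewrite normr0 mulr0.
    apply: le_trans (sj j kj); apply: ler_wpM2l; last exact: An_bound (Hr j) p0.
    by apply: exprn_ge0; exact: ltW.
  have := An_big h; rewrite sumr_const card_ord -[(_ *+ K)]mulr_natl.
  apply: An_eq => x _; rewrite [RHS]big_mkcond; apply: eq_bigr => j _.
  by case: ifP; rewrite ?mulr0.
have H3 : An (ocons s rho') (fun x => \sum_(j < K) x None ^+ j *
    (r j (x \o Some) - r j (fun=> 0))) (K%:R * (theta * M)).
  have h (j : 'I_K) : An (ocons s rho') (fun x => x None ^+ j *
      (r j (x \o Some) - r j (fun=> 0))) (theta * M).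
    have h0 := An_sub0 th r0 (Hr j).
    have h1 : An (ocons s rho') (fun x => r j (x \o Some) - r j (fun=> 0)) (theta * (M / s0 ^+ j)).
      apply: (An_subst (L := fun v x => x (Some v)) h0) => v.
      by have := An_var (ocons s rho') (Some v); rewrite /= ger0_norm.
    have h2 := An_mul (An_exp j (An_var (ocons s rho') None)) h1.
    apply: An_le h2; first by move=> [v|] /=; rewrite ger0_norm// ltW.
    rewrite /= gtr0_norm// mulrCA ler_wpM2l ?(ltW t0')// mulrCA -expr_div_n ler_piMr//.
    by rewrite exprn_ile1 ?divr_ge0 ?ler_pdivrMr ?mul1r// ltW.
  by have := An_big h; rewrite sumr_const card_ord -[(_ *+ K)]mulr_natl.
have := An_scale c^-1 (An_add (An_add H1 H2) H3).
have Hb : `|c^-1| * ((s / s0) ^+ k.+1 * M + K%:R * ((s / s0) ^+ k.+1 * M) + K%:R * (theta * M))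
    <= eps k * s ^+ k.
  rewrite normfV ler_pdivrMl//.
  have b1 : (s / s0) ^+ k.+1 * M + K%:R * ((s / s0) ^+ k.+1 * M) <= `|c| * eps k / 2 * s ^+ k.
    apply: (@le_trans _ _ (s * B * s ^+ k)); last by rewrite ler_wpM2r// exprn_ge0// ltW.
    rewrite -mulrA [B * _]mulrC (mulrA s) -(exprS s k) /B mulrDr mulr1 expr_div_n -natr1.
    rewrite (_ : _ + _ = s ^+ k.+1 * ((K%:R + 1) * M / s0 ^+ k.+1)); last by ring.
    by rewrite lerDl exprn_ge0// ltW.
  have b2 : K%:R * (theta * M) <= `|c| * eps k / 2 * s ^+ k.
    by apply: le_trans tD; rewrite /D mulrDr mulr1 mulrCA lerDl ltW.
  lra.
move=> h; apply: An_eq (An_le _ Hb h) => [x Hx|]; last first.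
  by move=> [v|] /=; [rewrite (ger0_norm (r'0 v))|rewrite gtr0_norm].
have := E (x None) (x \o Some); rewrite ocons_eta => ->; last 2 first.
- by apply: le_trans (Hx None) _.
- by apply: p' => v; exact: (Hx (Some v)).
have -> : \sum_(j < K) x None ^+ j * r j (x \o Some) =
    \sum_(j < K) x None ^+ j * (r j (x \o Some) - r j (fun=> 0)) +
    (\sum_(j < K | (k < j)%N) x None ^+ j * r j (fun=> 0) + x None ^+ k * c).
  have -> : \sum_(j < K | (k < j)%N) x None ^+ j * r j (fun=> 0) + x None ^+ k * c =
      \sum_(j < K) x None ^+ j * r j (fun=> 0).
    rewrite [RHS](bigID (fun j : 'I_K => (k < j)%N)) /=; congr (_ + _).
    rewrite (bigD1 (Ordinal kK))/= ?ltnn// big1 ?addr0// => j /andP[jk /eqP nj].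
    rewrite rj ?mulr0// ltn_neqAle leqNgt jk andbT; apply/eqP => e.
    by apply: nj; apply: val_inj.
  by rewrite -big_split /=; apply: eq_bigr => j _; ring.
by field.
Qed.

(** The unit [Q] stands on the side of [F] and stays near [1], so [F] and the polynomial bound each
    other. The weighted bound on the [r j] confines all roots to the disc of radius [s], see
    [root_norm_lt]. *)
Theorem weierstrass (V : Type) (s0 : R) (rho : V -> R) F M t0 (s1 : R) :
  0 < s0 -> (forall v, 0 <= rho v) -> An (ocons s0 rho) F M ->
  `|t0| < s0 -> F (ocons t0 (fun=> 0)) != 0 -> 0 < s1 ->
  exists (k : nat) (c s theta : R) Q (r : nat -> (V -> R) -> R),
   [/\ c != 0, 0 < s <= s1, s <= s0 & 0 < theta <= 1] /\
   [/\ An (ocons s (fun v => theta * rho v)) Q 2,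
     (forall x, polyd (ocons s (fun v => theta * rho v)) x -> `|Q x - 1| <= 2^-1),
     (forall j, exists N, An (fun v => theta * rho v) (r j) N),
     (forall y, polyd (fun v => theta * rho v) y ->
        \sum_(j < k) s ^+ j * `|r j y| <= s ^+ k / 2) &
     forall t y, `|t| <= s -> polyd (fun v => theta * rho v) y ->
        Q (ocons t y) * F (ocons t y) = c * (t ^+ k + \sum_(j < k) t ^+ j * r j y)].
Proof.
move=> s00 r0 HF ts Ft0 s10.
(* Each of the [k] lower coefficients contributes at most [2 * eps k * s ^+ k], and these must add
   up to at most [s ^+ k / 2]. *)
pose eps (k : nat) : R := (4 * k.+1%:R)^-1.
have eps0 k : 0 < eps k by rewrite invr_gt0 mulr_gt0.
have epsk k : k.+1%:R * eps k = 4^-1 by rewrite /eps invfM mulrCA divff ?mulr1.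
have [k [c [s [theta [c0 ss1 ss0 th Herr]]]]] :=
  weierstrass_normalize s00 r0 HF ts Ft0 s10 eps0.
have /andP[s_gt0 _] := ss1; have /andP[th0 th1] := th.
have r'0 v : 0 <= theta * rho v by rewrite mulr_ge0// ltW.
have e4 : eps k <= 4^-1.
  rewrite -(epsk k) ler_peMl ?(ltW (eps0 k))//; by rewrite ler1n.
have He : 0 <= eps k <= 2^-1 by rewrite ltW//=; lra.
have [Q [r [HQ Q1 Hr E]]] := weierstrass_normalized s_gt0 r'0 He Herr.
exists k, c, s, theta, Q, r; split=> //; split=> //.
- by move=> x /Q1; lra.
- by move=> j; exists (2 * eps k * s ^+ k / s ^+ j).
- move=> y Hy; apply: (@le_trans _ _ (\sum_(j < k) 2 * eps k * s ^+ k)).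
    apply: ler_sum => j _; rewrite mulrC -ler_pdivlMr ?exprn_gt0//.
    exact: An_bound (Hr j) Hy.
  rewrite sumr_const card_ord -[X in X <= _]mulr_natl (mulrA k%:R) [s ^+ k / 2]mulrC ler_wpM2r//.
    by rewrite exprn_ge0// ltW.
  by have := epsk k; rewrite -natr1; have := eps0 k; lra.
- move=> t y t_s Hy; rewrite -(E t y t_s Hy) /=.
  by rewrite mulrCA; congr (_ * _); field.
Qed.

End Weierstrass.

(** * Differences of roots *)

Section Selfres.

(** The companion matrix with its size given separately, so that the matrix type does not depend on
    [p], which varies with [y] and is mapped through ring morphisms. *)
Definition cmx {A : comNzRingType} (k : nat) (p : {poly A}) : 'M[A]_k :=
  \matrix_(i < k, j < k) if (i == k.-1 :> nat) then - p`_j else (i.+1 == j :> nat)%:R.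

(* If [p] is monic of degree [k.+1] with roots [z_i], this is
   [\prod_(i, j) ('X + (z_j - z_i))], the resultant of [p] and [p ('X + _)]. *)
Definition selfres {A : comNzRingType} (k : nat) (p : {poly A}) : {poly A} :=
  \det (\sum_(i < k.+2) (p`_i)%:P *: (map_mx polyC (cmx k.+1 p) + 'X%:M) ^+ i).

Lemma char_poly_cmx (A : comNzRingType) (k : nat) (p : {poly A}) :
  p \is monic -> size p = k.+1 -> char_poly (cmx k p) = p.
Proof. by move=> pm sp; have := companionmxK pm; rewrite /companionmx sp. Qed.

Lemma map_selfres (A B : comNzRingType) (f : {rmorphism A -> B}) k (p : {poly A}) :
  map_poly f (selfres k p) = selfres k (map_poly f p).
Proof.
rewrite /selfres -det_map_mx; congr (\det _); rewrite raddf_sum /=.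
apply: eq_bigr => i _; rewrite map_mxZ /= map_polyC /= coef_map; congr (_ *: _).
rewrite rmorphXn /= map_mxD map_scalar_mx /= map_polyX; congr ((_ + _) ^+ _).
apply/matrixP => a b; rewrite !mxE map_polyC /=; congr (_%:P).
by case: ifP; rewrite ?rmorphN ?rmorph_nat ?coef_map.
Qed.

(** With [N] the companion matrix plus ['X], the matrix [p(N)] is the product of the [N - z]. Up to
    sign, [\det (N - z)] is the characteristic polynomial [p] composed with [z - 'X]. *)
Lemma selfres_prod (K : comNzRingType) k (rs : seq K) : size rs = k.+1 ->
  selfres k (\prod_(z <- rs) ('X - z%:P)) =
  \prod_(z <- rs) \prod_(w <- rs) ('X + (w - z)%:P).
Proof.
move=> sr; set p := \prod_(z <- rs) _.
have pm : p \is monic by apply: monic_prod_XsubC.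
have sp : size p = k.+2 by rewrite size_prod_XsubC sr.
rewrite /selfres; set N := _ + 'X%:M.
have -> : \sum_(i < k.+2) (p`_i)%:P *: N ^+ i = horner_mx N (map_poly polyC p).
  rewrite (_ : map_poly polyC p = \sum_(i < k.+2) (p`_i)%:P *: 'X^i); last first.
    rewrite -[in LHS](coefK p) sp poly_def raddf_sum; apply: eq_bigr => i _.
    by rewrite /= map_polyZ /= map_polyXn.
  rewrite raddf_sum /=; apply: eq_bigr => i _.
  by rewrite linearZ /= rmorphXn /= horner_mx_X.
rewrite /p rmorph_prod /= rmorph_prod /= (big_morph _ (@det_mulmx _ _) (@det1 _ _)).
rewrite -/p; apply: eq_bigr => z _.
rewrite rmorphB /= map_polyX map_polyC /= rmorphB /= horner_mx_X horner_mx_C.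
pose f := comp_poly (z%:P - 'X).
have := congr1 f (char_poly_cmx pm sp).
rewrite {1}/f /char_poly -det_map_mx.
have -> : map_mx (comp_poly (z%:P - 'X)) (char_poly_mx (cmx k.+1 p)) = - (N - z%:P%:M).
  rewrite /char_poly_mx map_mxB map_scalar_mx /= comp_polyX /N opprB.
  rewrite raddfB /= opprD [- _ - 'X%:M]addrC addrA; congr (_ - _).
  by apply/matrixP => a b; rewrite !mxE comp_polyC.
rewrite -scaleN1r detZ /f rmorph_prod /= => E.
have : (-1) ^+ k.+1 * \det (N - z%:P%:M) =
    (-1) ^+ k.+1 * \prod_(w <- rs) ('X + (w - z)%:P).
  rewrite E -sr.
  have -> : (-1) ^+ size rs = \prod_(w <- rs) (-1 : {poly K}).
    by rewrite big_const_seq count_predT iter_mulr_1.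
  rewrite -big_split /=; apply: eq_bigr => w _.
  by rewrite comp_polyB comp_polyX comp_polyC polyCB; ring.
by move=> /(congr1 (fun x => (-1) ^+ k.+1 * x)); rewrite !mulrA -expr2 sqrr_sign !mul1r.
Qed.

End Selfres.

Section Roots.
Context {R : realType}.
Local Notation C := R[i].
Local Notation toC := (real_complex R).

Lemma normc_prod (I : Type) (s : seq I) (P : pred I) (F : I -> C) :
  normc (\prod_(i <- s | P i) F i) = \prod_(i <- s | P i) normc (F i).
Proof. by apply: big_morph; [exact: normcM | exact: normc1]. Qed.

Lemma normc_ge0 (z : C) : 0 <= normc z.
Proof. by case: z => a b; rewrite /normc sqrtr_ge0. Qed.

Lemma normc_toC (x : R) : normc x%:C%C = `|x|.
Proof. by rewrite /normc /= expr0n /= addr0 sqrtr_sqr. Qed.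

Lemma normc_ge_abs (a b : R) : `|a| <= normc (a +i* b)%C /\ `|b| <= normc (a +i* b)%C.
Proof. by rewrite /normc /= -!sqrtr_sqr !ler_wsqrtr ?lerDl ?lerDr ?sqr_ge0. Qed.

Lemma real_poly_roots (p : {poly R}) k : p \is monic -> size p = k.+1 ->
  exists2 rs : seq C, size rs = k & map_poly toC p = \prod_(z <- rs) ('X - z%:P).
Proof.
move=> pm sp; have [rs E] := closed_field_poly_normal (map_poly toC p).
have lc : lead_coef (map_poly toC p) = 1 by rewrite lead_coef_map (monicP pm) rmorph1.
rewrite lc scale1r in E; exists rs => //.
by have := congr1 (fun q : {poly C} => size q) E;
  rewrite size_map_poly sp size_prod_XsubC => -[].
Qed.

Lemma norm_horner_roots (p : {poly R}) rs t :
  map_poly toC p = \prod_(z <- rs) ('X - z%:P) ->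
  `|p.[t]| = \prod_(z <- rs) normc (t%:C%C - z).
Proof.
move=> E; rewrite -normc_toC -(horner_map toC) /= E horner_prod normc_prod.
by apply: eq_bigr => z _; rewrite hornerXsubC.
Qed.

Lemma norm_deriv_roots (p : {poly R}) (rs : seq C) t :
  map_poly toC p = \prod_(z <- rs) ('X - z%:P) -> p.[t] != 0 ->
  `|p^`().[t]| <= `|p.[t]| * \sum_(z <- rs) (normc (t%:C%C - z))^-1.
Proof.
move=> E pt; have H := norm_horner_roots t E.
have : \prod_(z <- rs) normc (t%:C%C - z) != 0 by rewrite -H normr_eq0.
rewrite H -[`|p^`().[t]|]normc_toC -(horner_map toC) /= -deriv_map E.
elim: rs {E H pt} => [|z rs IH]; first by rewrite !big_nil derivC horner0 /normc /= expr0n addr0 sqrtr0 mulr0.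
rewrite !big_cons mulf_eq0 => /norP[z0 rs0].
rewrite derivM derivXsubC mul1r hornerD hornerM hornerXsubC.
apply: le_trans (le_normcD _ _) _.
have {}IH := IH rs0; rewrite normcM.
have -> : normc (\prod_(j <- rs) ('X - j%:P)).[t%:C%C] = \prod_(j <- rs) normc (t%:C%C - j).
  by rewrite horner_prod normc_prod; apply: eq_bigr => w _; rewrite hornerXsubC.
set P := \prod_(j <- rs) normc _ in IH *; set S := \sum_(j <- rs) _ in IH *.
set D := normc _^`().[_] in IH *; set n := normc _ in z0 *.
rewrite (_ : n * P * (n^-1 + S) = P + n * (P * S)); last by field.
by rewrite lerD2l ler_wpM2l// normc_ge0.
Qed.

(** If [0] occurs [z] times in [L], the lowest nonzero coefficient has index [z] and is the product
    of the nonzero members. So either [e < z] and the coefficient vanishes, or [e = z] and, all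
    members being at most [1], the single factor [d] bounds the product. *)
Lemma coef_prod_small (L : seq C) (e : nat) d :
  (forall x, x \in L -> normc x <= 1) ->
  (forall j, (j < e)%N -> (\prod_(x <- L) ('X + x%:P))`_j = 0) ->
  d \in L -> d != 0 -> normc (\prod_(x <- L) ('X + x%:P))`_e <= normc d.
Proof.
move=> L1 Le dL d0; set q := \prod_(x <- L) _ in Le *.
pose z := count (pred1 0) L.
pose q' := \prod_(x <- L | x != 0) ('X + x%:P).
have qE : q = 'X^z * q'.
  rewrite /q (bigID (fun x => x == 0)) /=; congr (_ * _).
  rewrite (eq_bigr (fun=> 'X)) => [|x /eqP->]; last by rewrite polyC0 addr0.
  by rewrite big_const_seq iter_mulr_1.
have q'0 : q'`_0 = \prod_(x <- L | x != 0) x.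
  rewrite -horner_coef0 horner_prod; apply: eq_bigr => x _.
  by rewrite hornerD hornerX hornerC add0r.
rewrite qE coefXnM; case: ltnP => ez; first by rewrite /normc /= expr0n addr0 sqrtr0 normc_ge0.
have [zE|ze] : e = z \/ (z < e)%N by move: ez; rewrite leq_eqVlt => /orP[/eqP|]; [left|right].
  rewrite zE subnn q'0 (perm_big _ (perm_to_rem dL)) big_cons d0 normcM.
  rewrite ler_piMr ?normc_ge0// normc_prod big_seq_cond.
  apply: prodr_ile1 => x /andP[/mem_rem xL _].
  by rewrite normc_ge0 L1.
have := Le z ze; rewrite qE coefXnM ltnn subnn q'0 => /eqP.
rewrite prodf_seq_eq0 => /hasP[x _ /andP[x0 x0']]; by rewrite x0' in x0.
Qed.

(** The conjugate of [z] is again a root because [p] is real, and it differs from [z] by [2 |Im z|].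
    Roots of modulus at most [1/2] keep all differences within [1], as [coef_prod_small]
    requires. *)
Lemma selfres_Im_bound (p : {poly R}) k (rs : seq C) e z :
  map_poly toC p = \prod_(w <- rs) ('X - w%:P) -> size rs = k.+1 ->
  (forall w, w \in rs -> normc w <= 2^-1) ->
  (forall j, (j < e)%N -> (selfres k p)`_j = 0) ->
  z \in rs -> complex.Im z != 0 -> `|(selfres k p)`_e| <= 2 * `|complex.Im z|.
Proof.
move=> E sr r1 se zr z0.
have S : map_poly toC (selfres k p) =
    \prod_(x <- [seq w - v | v <- rs, w <- rs]) ('X + x%:P).
  by rewrite map_selfres E selfres_prod// big_allpairs_dep.
have zr' : (z^*)%C \in rs.
  rewrite -root_prod_XsubC -E -complex_root_conj.
  have -> : map_poly conjc (map_poly toC p) = map_poly toC p.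
    by rewrite -map_poly_comp; apply: eq_map_poly => x; exact: conjc_real.
  by rewrite E root_prod_XsubC.
have -> : 2 * `|complex.Im z| = normc ((z^*)%C - z).
  case: (z) => a b; rewrite /normc /= subrr expr0n /= add0r sqrtr_sqr.
  by rewrite -opprD normrN -mulr2n normrMn mulr_natl.
rewrite -normc_toC -coef_map /= S; apply: coef_prod_small.
- move=> x /allpairsP[[v w] /= [vr wr ->]]; apply: le_trans (le_normcD _ _) _.
  rewrite normcN; have := r1 _ vr; have := r1 _ wr; lra.
- by move=> j je; rewrite -S coef_map se.
- by apply/allpairsP; exists (z, (z^*)%C).
- case: z z0 {zr zr'} => a b /= b0; rewrite eq_complex /= subrr eqxx /=.
  by rewrite -opprD oppr_eq0 -mulr2n mulrn_eq0.
Qed.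

(** If [|z| >= s], then [|z|^j <= s^j (|z| / s)^k] for [j < k], and the root equation would give
    [|z|^k <= |z|^k / 2]. *)
Lemma root_norm_lt (s : R) k (r : nat -> R) (z : C) : 0 < s ->
  \sum_(j < k) s ^+ j * `|r j| <= s ^+ k / 2 ->
  root (map_poly toC ('X^k + \sum_(j < k) (r j)%:P * 'X^j)) z -> normc z < s.
Proof.
move=> s0 H /rootP; rewrite rmorphD /= map_polyXn raddf_sum /= hornerD hornerXn.
rewrite horner_sum => /eqP; rewrite addr_eq0 => /eqP E.
rewrite ltNge; apply/negP => sz.
have a0 : 0 < normc z by apply: lt_le_trans sz.
have nX n : normc (z ^+ n) = normc z ^+ n.
  by elim: n => [|n IH]; rewrite ?normc1// !exprS normcM IH.
have : normc z ^+ k <= normc z ^+ k / 2.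
  rewrite -{1}nX E normcN.
  apply: (@le_trans _ _ (\sum_(j < k) `|r j| * normc z ^+ j)).
    apply: le_trans (_ : _ <= \sum_(j < k) normc (map_poly toC ((r j)%:P * 'X^j)).[z]) _.
      by elim/big_ind2 : _ => [|x1 x2 y1 y2 h1 h2|i _]; rewrite ?/normc/= ?expr0n/= ?addr0 ?sqrtr0//;
       apply: le_trans (le_normcD _ _) _; apply: lerD.
    apply: ler_sum => j _.
    by rewrite rmorphM /= map_polyC map_polyXn /= hornerM hornerC hornerXn normcM nX normc_toC.
  apply: (@le_trans _ _ ((normc z / s) ^+ k * (s ^+ k / 2))); last first.
    by rewrite expr_div_n mulrA divfK// expf_neq0// gt_eqF.
  apply: le_trans (_ : (normc z / s) ^+ k * \sum_(j < k) s ^+ j * `|r j| <= _); last first.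
    by rewrite ler_wpM2l// exprn_ge0// divr_ge0// ltW.
  rewrite mulr_sumr; apply: ler_sum => j _.
  rewrite [leRHS]mulrA [leLHS]mulrC ler_wpM2r// -ler_pdivrMr ?exprn_gt0//.
  by rewrite -expr_div_n ler_weXn2l ?ler_pdivlMr ?mul1r// ltnW.
have : 0 < normc z ^+ k by rewrite exprn_gt0.
lra.
Qed.

End Roots.

(** * Polynomials with analytic coefficients *)

Section Anpoly.
Context {R : realType} {V : Type}.
Implicit Types (rho : V -> R).

Definition Anp rho (p : (V -> R) -> {poly R}) :=
  forall i, exists N, An rho (fun y => (p y)`_i) N.

Lemma An_big_ex (I : finType) rho (F : I -> (V -> R) -> R) :
  (forall i, exists N, An rho (F i) N) -> exists N, An rho (fun y => \sum_i F i y) N.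
Proof. by move=> /choice[N HN]; exists (\sum_i N i); exact: An_big. Qed.

Lemma Anp_eq rho p q : (forall y, p y = q y) -> Anp rho p -> Anp rho q.
Proof. by move=> /funext->. Qed.

Lemma Anp_const rho c : Anp rho (fun=> c).
Proof. by move=> i; exists `|c`_i|; exact: An_const. Qed.

Lemma Anp_polyC rho F N : An rho F N -> Anp rho (fun y => (F y)%:P).
Proof.
move=> HF i; case: i => [|i].
  by exists N; apply: An_eq HF => y _; rewrite coefC.
by exists `|0 : R|; apply: An_eq (An_const rho 0) => y _; rewrite coefC.
Qed.

Lemma Anp_add rho p q : Anp rho p -> Anp rho q -> Anp rho (fun y => p y + q y).
Proof.
move=> hp hq i; have [N HN] := hp i; have [N' HN'] := hq i.
by exists (N + N'); apply: An_eq (An_add HN HN') => y _; rewrite coefD.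
Qed.

Lemma Anp_mul rho p q : Anp rho p -> Anp rho q -> Anp rho (fun y => p y * q y).
Proof.
move=> hp hq i.
have [j|N HN] := @An_big_ex 'I_i.+1 rho (fun j y => (p y)`_j * (q y)`_(i - j)).
  have [N HN] := hp j; have [N' HN'] := hq (i - j)%N.
  by exists (N * N'); exact: An_mul.
by exists N; apply: An_eq HN => y _; rewrite coefM.
Qed.

Lemma Anp_sum (I : Type) (s : seq I) rho (p : I -> (V -> R) -> {poly R}) :
  (forall i, Anp rho (p i)) -> Anp rho (fun y => \sum_(i <- s) p i y).
Proof.
move=> hp; elim: s => [|i s IH].
  by apply: Anp_eq (Anp_const rho 0) => y; rewrite big_nil.
by apply: Anp_eq (Anp_add (hp i) IH) => y; rewrite big_cons.
Qed.

Lemma Anp_prod (I : Type) (s : seq I) rho (p : I -> (V -> R) -> {poly R}) :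
  (forall i, Anp rho (p i)) -> Anp rho (fun y => \prod_(i <- s) p i y).
Proof.
move=> hp; elim: s => [|i s IH].
  by apply: Anp_eq (Anp_const rho 1) => y; rewrite big_nil.
by apply: Anp_eq (Anp_mul (hp i) IH) => y; rewrite big_cons.
Qed.

Lemma Anp_det k rho (M : (V -> R) -> 'M[{poly R}]_k) :
  (forall i j, Anp rho (fun y => M y i j)) -> Anp rho (fun y => \det (M y)).
Proof.
move=> hM; apply: Anp_sum => s; apply: Anp_mul; first exact: Anp_const.
by apply: Anp_prod => i; exact: hM.
Qed.

(** This is the purpose of the matrix form of [selfres]: it uses only sums and products of the
    coefficients of [p], and no choice of roots. *)
Lemma Anp_selfres k rho (p : (V -> R) -> {poly R}) :
  Anp rho p -> Anp rho (fun y => selfres k (p y)).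
Proof.
move=> hp; apply: Anp_det => a b.
pose N y := map_mx polyC (cmx k.+1 (p y)) + 'X%:M : 'M[{poly R}]_k.+1.
have hN i j : Anp rho (fun y => N y i j).
  rewrite /N; have [ik|ik] := eqVneq (i : nat) k.
    have [M HM] := hp j.
    apply: Anp_eq (Anp_add (Anp_polyC (An_opp HM)) (Anp_const rho ('X%:M i j))) => y.
    by rewrite !mxE /= ik eqxx polyCN.
  apply: Anp_eq (Anp_const rho (((i.+1 == j :> nat)%:R)%:P + 'X%:M i j)) => y.
  by rewrite !mxE /= (negbTE ik).
have hNe n i j : Anp rho (fun y => (N y ^+ n) i j).
  elim: n i j => [|n IH] i j; first exact: Anp_const.
  have h : Anp rho (fun y => \sum_l N y i l * (N y ^+ n) l j).
    by apply: Anp_sum => l; apply: Anp_mul => //; exact: hN.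
  by apply: Anp_eq h => y; rewrite exprS !mxE.
have h : Anp rho (fun y => \sum_(i < k.+2) ((p y)`_i)%:P * (N y ^+ i) a b).
  apply: Anp_sum => i; apply: Anp_mul => //; have [M HM] := hp i.
  exact: Anp_polyC HM.
by apply: Anp_eq h => y; rewrite summxE; apply: eq_bigr => i _; rewrite [RHS]mxE.
Qed.

Lemma Anp_derivn rho m (p : (V -> R) -> {poly R}) :
  Anp rho p -> Anp rho (fun y => (p y)^`(m)).
Proof.
move=> hp i; have [N HN] := hp (m + i)%N.
exists (`|((m + i) ^_ m)%:R| * N); apply: An_eq (An_scale _ HN) => y _.
by rewrite coef_derivn mulr_natl.
Qed.

Lemma Anp_horner rho (p : (V -> R) -> {poly R}) d s : 0 <= s -> (forall v, 0 <= rho v) ->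
  (forall y, (size (p y) <= d)%N) -> Anp rho p ->
  exists N, An (ocons s rho) (fun x => (p (x \o Some)).[x None]) N.
Proof.
move=> s0 r0 sp hp.
have h : forall j, exists N, An (ocons s rho) (fun x => (p (x \o Some))`_j * x None ^+ j) N.
  move=> j; have [N HN] := hp j; exists (N * `|s| ^+ j).
  apply: An_mul; last exact: (An_exp j (An_var (ocons s rho) None)).
  apply: (An_subst (L := fun v x => x (Some v)) HN) => v.
  by have := An_var (ocons s rho) (Some v); rewrite /= ger0_norm.
have [N HN] : exists N, An (ocons s rho) (fun x => \sum_(j < d) (p (x \o Some))`_j * x None ^+ j) N.
  elim: d {sp} => [|d [N IH]].
    by exists `|0 : R|; apply: An_eq (An_const _ 0) => x _; rewrite big_ord0.
  have [N' HN'] := h d; exists (N + N').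
  by apply: An_eq (An_add IH HN') => x _; rewrite big_ord_recr.
by exists N; apply: An_eq HN => x _; rewrite (horner_coef_wide _ (sp _)).
Qed.

End Anpoly.

Section Wpoly.
Context {R : realType}.

Definition wpoly (k : nat) (r : nat -> R) : {poly R} := 'X^k + \sum_(j < k) (r j)%:P * 'X^j.

Lemma wpolyE k (r : nat -> R) : wpoly k r = 'X^k + \poly_(j < k) r j.
Proof.
rewrite /wpoly poly_def; congr (_ + _); apply: eq_bigr => j _; exact: mul_polyC.
Qed.

Lemma size_wpoly k (r : nat -> R) : size (wpoly k r) = k.+1.
Proof. by rewrite wpolyE size_polyDl size_polyXn// ltnS size_poly. Qed.

Lemma wpoly_monic k (r : nat -> R) : wpoly k r \is monic.
Proof.
rewrite monicE wpolyE lead_coefDl ?lead_coefXn//.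
by rewrite size_polyXn ltnS size_poly.
Qed.

Lemma horner_wpoly k (r : nat -> R) t : (wpoly k r).[t] = t ^+ k + \sum_(j < k) t ^+ j * r j.
Proof.
rewrite /wpoly hornerD hornerXn horner_sum; congr (_ + _).
by apply: eq_bigr => j _; rewrite hornerM hornerC hornerXn mulrC.
Qed.

Lemma Anp_wpoly (V : Type) (rho : V -> R) k (r : nat -> (V -> R) -> R) :
  (forall j, exists N, An rho (r j) N) -> Anp rho (fun y => wpoly k (r^~ y)).
Proof.
move=> hr; apply: Anp_add; first exact: Anp_const.
apply: Anp_sum => j; apply: Anp_mul; last exact: Anp_const.
by have [N HN] := hr j; exact: Anp_polyC HN.
Qed.

End Wpoly.

(** The margin [d] is the same for all variables, so a whole polydisc around [y] stays inside the
    given one. *)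
Definition inner {R : realType} {V : Type} (rho y : V -> R) :=
  exists2 d : R, 0 < d & forall v, `|y v| + d <= rho v.

Lemma inner_polyd (R : realType) (V : Type) (rho y : V -> R) : inner rho y -> polyd rho y.
Proof. by move=> [d d0 H] v; apply: le_trans (H v); rewrite lerDl ltW. Qed.

Lemma dist_between (R : realType) (t x c x' d : R) : `|t - x| <= d -> `|t - x'| <= d ->
  x < c < x' -> `|t - c| <= d.
Proof.
rewrite !ler_norml => /andP[? ?] /andP[? ?] /andP[? ?]; apply/andP; split; lra.
Qed.

(** * Real roots of minimal multiplicity *)

Section RealRoot.
Context {R : realType} {V : Type}.
Variables (rho : V -> R) (s : R) (k : nat) (P : (V -> R) -> {poly R}) (E : (V -> R) -> R).
Hypotheses (s0 : 0 < s) (r0 : forall v, 0 <= rho v).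
Hypotheses (Pm : forall y, P y \is monic) (Ps : forall y, size (P y) = k.+1).
Hypotheses (PA : Anp rho P) (EA : exists N, An rho E N).
Hypothesis Im_bound : forall y z, inner rho y -> root (map_poly (real_complex R) (P y)) z ->
  complex.Im z != 0 -> `|E y| <= 2 * `|complex.Im z|.

Lemma derivn_top y t : (P y)^`(k).[t] != 0.
Proof.
have -> : (P y)^`(k) = (k`!%:R)%:P.
  apply/polyP => i; rewrite coef_derivn coefC; case: i => [|i] /=.
    have /monicP := Pm y; rewrite lead_coefE Ps addn0 ffactnn /= => -> //.
  by rewrite nth_default ?mul0rn// Ps addnS ltnS leq_addr.
by rewrite hornerC pnatr_eq0 -lt0n fact_gt0.
Qed.

Definition zero_order m := exists y t, [/\ inner rho y, E y != 0, `|t| < s, (0 < m)%N &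
  (P y)^`(m).[t] != 0 /\ forall j, (j < m)%N -> (P y)^`(j).[t] = 0].

(** [m'] is the multiplicity of the root [t]; a derivative that does not vanish bounds it from
    above. *)
Lemma zero_order_exists y t : inner rho y -> E y != 0 -> `|t| < s -> (P y).[t] = 0 ->
  forall m, (P y)^`(m).[t] != 0 -> exists2 m', zero_order m' & (m' <= m)%N /\
    forall j, (j < m')%N -> (P y)^`(j).[t] = 0.
Proof.
move=> iy Ey ts Pt m Pmt.
have ex : exists j, (P y)^`(j).[t] != 0 by exists m.
case: (ex_minnP ex) => m' Pm' m'min.
have lt j : (j < m')%N -> (P y)^`(j).[t] = 0.
  by move=> jm; apply: contrapT => /eqP /m'min; rewrite leqNgt jm.
exists m'; last by split => //; exact: m'min.
exists y, t; split => //; rewrite lt0n; apply/eqP => m0.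
by rewrite m0 derivn0 Pt eqxx in Pm'.
Qed.

(* Choose a real root of minimal multiplicity [m.+1]: the bound on [Im z] keeps the [m.+1]
   roots of [P y] near it real, and by minimality they stay equal. *)
Lemma smooth_real_root y0 t0 : inner rho y0 -> E y0 != 0 -> `|t0| < s -> (P y0).[t0] = 0 ->
  exists y1 t1 m d, [/\ inner rho y1, `|t1| < s, (P y1).[t1] = 0 & 0 < d] /\
   forall y t, (forall v, `|y1 v - y v| <= d) -> `|t1 - t| <= d ->
     (P y)^`(m.+1).[t] != 0 /\ ((P y).[t] = 0 <-> (P y)^`(m).[t] = 0).
Proof.
move=> iy0 Ey0 ts0 Pt0.
have ex : exists m, zero_order m.
  by have [m] := zero_order_exists iy0 Ey0 ts0 Pt0 (derivn_top y0 t0); exists m.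
have {ex} [m zm mmin] : exists2 m, zero_order m & forall m', zero_order m' -> (m <= m')%N.
  have ex' : exists m, `[< zero_order m >] by case: ex => m h; exists m; apply/asboolP.
  case: (ex_minnP ex') => m /asboolP h1 h2; exists m => // m' h.
  by apply: h2; apply/asboolP.
case: zm => y1 [t1 [iy1 Ey1 ts1 m0 [Pm1 Pj1]]].
case: m m0 mmin Pm1 Pj1 => // m _ mmin Pm1 Pj1.
have Pt1 : (P y1).[t1] = 0 by rewrite -(derivn0 (P y1)); exact: Pj1.
have [d0 d00 Hd0] := iy1.
have [N HN] := EA.
have py1 : polyd rho y1 by move=> v; apply: le_trans (Hd0 v); rewrite lerDl ltW.
have dsm j : forall y, (size (P y)^`(j) <= k.+1)%N.
  move=> y; apply/leq_sizeP => i ki.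
  by rewrite coef_derivn nth_default ?mul0rn// Ps (leq_trans ki)// leq_addl.
have [N1 HN1] := Anp_horner (ltW s0) r0 (dsm m.+1) (Anp_derivn m.+1 PA).
have Pm1' : 0 < `|(P y1)^`(m.+1).[t1]| / 2 by rewrite divr_gt0// normr_gt0.
have [d1 d10 Hd1] := An_cont HN1 (polyd_ocons (ltW ts1) py1) Pm1'.
have E2 : 0 < `|E y1| / 2 by rewrite divr_gt0// normr_gt0.
have [d2 d20 Hd2] := An_cont HN py1 E2.
have d30 : 0 < s - `|t1| by rewrite subr_gt0.
(* Within [d4] one stays in the domain, [E] keeps half of its size and the derivative of order
   [m.+1] does not vanish. The comparison with [|E y1|] excludes nonreal roots within [d4] of
   [t1]. *)
pose d4 := Num.min (Num.min (Num.min d0 d1) (Num.min d2 (s - `|t1|))) (`|E y1|) / 8.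
have d40 : 0 < d4 by rewrite divr_gt0// !lt_min d00 d10 d20 d30 normr_gt0.
have [h0 h1 h2 h3 hE] : [/\ d4 <= d0 / 8, d4 <= d1 / 8, d4 <= d2 / 8, d4 <= (s - `|t1|) / 8
    & d4 <= `|E y1| / 8].
  by rewrite /d4; split; rewrite ler_pM2r ?invr_gt0// !ge_min lexx ?orbT.
have near_in y t : (forall v, `|y1 v - y v| <= d4) -> `|t1 - t| <= d4 ->
   [/\ inner rho y, polyd rho y, `|t| < s, E y != 0 & (P y)^`(m.+1).[t] != 0].
  move=> yy tt.
  have iy : inner rho y.
    exists d4 => // v; apply: le_trans (Hd0 v).
    have := ler_normB (y1 v) (y1 v - y v); rewrite opprB addrCA subrr addr0.
    by move: (yy v) h0 d00; lra.
  have py : polyd rho y.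
    by have [d' d'0 h] := iy; move=> v; apply: le_trans (h v); rewrite lerDl ltW.
  have ts : `|t| < s.
    have := ler_normB t1 (t1 - t); rewrite opprB addrCA subrr addr0.
    by move: tt h3 d30; lra.
  split => //.
    have : `|E y1 - E y| <= `|E y1| / 2.
      by apply: Hd2 => // v; apply: le_trans (yy v) _; move: h2 d20; lra.
    apply: contraTneq => ->; rewrite subr0 -ltNge.
    by move: E2; lra.
  have : `|(P y1)^`(m.+1).[t1] - (P y)^`(m.+1).[t]| <= `|(P y1)^`(m.+1).[t1]| / 2.
    have := Hd1 (ocons t y); apply; first exact: (polyd_ocons (ltW ts) py).
    by move=> [v|] /=; [apply: le_trans (yy v) _|apply: le_trans tt _]; move: h1 d10; lra.
  apply: contraTneq => ->; rewrite subr0 -ltNge.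
  by move: Pm1'; lra.
(* By minimality every zero near [(y1, t1)] has multiplicity at least [m.+1], so the derivative of
   order [m] vanishes there too. *)
have zero_in y t : (forall v, `|y1 v - y v| <= d4) -> `|t1 - t| <= d4 ->
    (P y).[t] = 0 -> (P y)^`(m).[t] = 0.
  move=> yy tt Pt; have [iy py ts Ey Pmy] := near_in y t yy tt.
  have [m' zm' [m'm Pj]] := zero_order_exists iy Ey ts Pt Pmy.
  by apply: Pj; exact: mmin.
have dsm0 : forall y, (size (P y) <= k.+1)%N by move=> y; rewrite Ps.
have [N0 HN0] := Anp_horner (ltW s0) r0 dsm0 PA.
have t40 : 0 < d4 ^+ k by rewrite exprn_gt0.
have [d5 d50 Hd5] := An_cont HN0 (polyd_ocons (ltW ts1) py1) t40.
pose d := Num.min d4 d5.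
have dd4 : d <= d4 by rewrite ge_min lexx.
exists y1, t1, m, d; split; first by rewrite lt_min d40.
move=> y t yy tt.
have yy4 v : `|y1 v - y v| <= d4 by apply: le_trans (yy v) _.
have tt4 : `|t1 - t| <= d4 by apply: le_trans tt _.
have [iy py ts Ey Pmy] := near_in y t yy4 tt4.
split => //; split; first exact: zero_in.
(* Conversely, let the derivative of order [m] vanish at [t]. A root [a] of [P y] exists near [t1]
   and is real, the derivative of order [m] vanishes at [a] as well, and Rolle's theorem forces
   [a = t]. *)
move=> Pmt.
have [rs srs Ers] := real_poly_roots (Pm y) (Ps y).
have Pyt1 : `|(P y).[t1]| <= d4 ^+ k.
  have := Hd5 (ocons t1 y); rewrite /comp /= Pt1 sub0r normrN; apply.
    exact: (polyd_ocons (ltW ts1) py).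
  move=> [v|] /=; last by rewrite subrr normr0 ltW.
  by apply: le_trans (yy v) _; rewrite ge_min lexx orbT.
(* The modulus of [P y] at [t1] is the product of the [k] distances to the roots; were all of them
   above [d4], it would exceed [d4 ^+ k]. *)
have [z zr zt] : exists2 z, z \in rs & normc (t1%:C%C - z) <= d4.
  apply: contrapT => nz.
  have gt z : z \in rs -> d4 < normc (t1%:C%C - z).
    by move=> zr; rewrite ltNge; apply/negP => h; apply: nz; exists z.
  have k0 : (0 < size rs)%N.
    rewrite lt0n; apply/negP => /eqP/size0nil rs0.
    move: Pt1 (Ps y1); rewrite -srs rs0 /= => Pt1 /eqP/size_poly1P[c c0 Pc].
    by move: Pt1; rewrite Pc hornerC => /eqP; rewrite (negbTE c0).
  move: Pyt1; rewrite (norm_horner_roots t1 Ers) leNgt => /negP; apply.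
  rewrite -srs; elim: (rs) gt k0 => //= z [|z' l] IH gt _.
    by rewrite big_seq1 expr1; apply: gt; rewrite inE eqxx.
  rewrite big_cons exprS; apply: ltr_pM; rewrite ?exprn_ge0 ?(ltW d40)//.
    by apply: gt; rewrite inE eqxx.
  by apply: IH => // w wl; apply: gt; rewrite inE wl orbT.
have zroot : root (map_poly (real_complex R) (P y)) z by rewrite Ers root_prod_XsubC.
have E_half : `|E y1| / 2 <= `|E y|.
  have : `|E y1 - E y| <= `|E y1| / 2.
    by apply: Hd2 => // v; apply: le_trans (yy4 v) _; move: h2 d20; lra.
  by have := ler_normB (E y1) (E y1 - E y); rewrite opprB addrCA subrr addr0;
   have := ler_normD (E y) (E y1 - E y); rewrite addrCA subrr addr0; lra.
case: z zr zt zroot => a b zr zt zroot.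
have b0 : b = 0.
  apply: contrapT => /eqP b0; have := Im_bound iy zroot b0 => /= Eb.
  have [_ hb] := normc_ge_abs (t1 - a) (0 - b).
  have : `|b| <= d4.
    by apply: le_trans zt; rewrite -(normrN b) -(sub0r b); exact: hb.
  by move: Eb E_half hE d40; lra.
rewrite b0 in zt zroot.
have ta : `|t1 - a| <= d4.
  apply: le_trans zt; rewrite -normc_toC.
  by have -> : (t1%:C - (a +i* 0))%C = (t1 - a)%:C%C by simpc.
have Pa : (P y).[a] = 0.
  move: zroot; rewrite -[(a +i* 0)%C]/(a%:C)%C => /rootP.
  by rewrite horner_map => /complexI.
have Pma := zero_in y a yy4 ta Pa.
suff <- : a = t by [].
(* Between two zeros of the derivative of order [m] the one of order [m.+1] would vanish, against
   [near_in]. *)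
have notlt x x' : x < x' -> `|t1 - x| <= d4 -> `|t1 - x'| <= d4 ->
    (P y)^`(m).[x] = 0 -> (P y)^`(m).[x'] = 0 -> False.
  move=> xx' tx tx' Px Px'.
  have [c cx] : exists2 c, x < c < x' & ((P y)^`(m))^`().[c] = 0.
    have [c cx Hc] := poly_rolle xx' (etrans Px (esym Px')).
    by exists c => //; move: cx; rewrite in_itv.
  rewrite -derivnS => /eqP.
  have tc : `|t1 - c| <= d4.
    exact: dist_between tx tx' cx.
  by have [_ _ _ _ /negbTE ->] := near_in y c yy4 tc.
have [] := ltgtP a t => // h; exfalso; first exact: (notlt a t).
exact: (notlt t a).
Qed.

End RealRoot.

(** * Lebesgue measure in sheared coordinates *)

Section SigmaFiniteAlias.
Context d (T : measurableType d) (R : realType).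
Variables (m : {measure set T -> \bar R}) (sf : sigma_finite setT m).

(** A fresh name to which the sigma-finite structure can be attached when sigma-finiteness is known
    as a proposition. *)
Definition sf_alias : set T -> \bar R := m.
HB.instance Definition _ := Measure.on sf_alias.
HB.instance Definition _ := Measure_isSigmaFinite.Build _ _ _ sf_alias sf.
Definition sigma_finite_pack : {sigma_finite_measure set T -> \bar R} := sf_alias.

End SigmaFiniteAlias.

Section Lebn.
Context {R : realType}.
Local Notation mu := (@lebesgue_measure R).
Local Notation TR := (measurableTypeR R).
Local Open Scope ereal_scope.

Lemma lebesgue_measure_translation (b : R) (A : set R) : measurable A ->
  pushforward mu ((fun t => t + b)%R : _ -> measurableTypeR R) A = mu A.
Proof.
move=> mA; apply/esym/lebesgue_measure_unique => //=.
  exact: measurable_funD.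
move=> mf _ [[x y]] _ <-.
rewrite /pushforward (_ : _ @^-1` _ = `](x - b)%R, (y - b)%R]%classic); last first.
  by apply/seteqP; split => t /=; rewrite !in_itv /= ltrBlDr lerBrDr.
rewrite !lebesgue_measure_itv/= !lte_fin ltrD2r.
by case: ifP => // _; rewrite -!EFinD; congr EFin; ring.
Qed.

Definition tuncons {n} (t : n.+1.-tuple R) : TR * n.-tuple R := (thead t, [tuple of behead t]).

Lemma tconsK n : cancel (@tcons R n) (@tuncons n).
Proof. by move=> [x t]; rewrite /tuncons /tcons theadE; congr pair; apply: val_inj. Qed.

Lemma measurable_fstR d (T : measurableType d) :
  measurable_fun setT (fst : TR * T -> R).
Proof. exact: measurable_fst. Qed.

Lemma measurable_tcons n :
  measurable_fun setT (@tcons R n : TR * n.-tuple R -> n.+1.-tuple R).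
Proof.
exact: (@measurable_cons _ _ (TR * n.-tuple R)%type R fst n snd).
Qed.

Lemma tnth_behead' n (t : n.+1.-tuple R) i : tnth [tuple of behead t] i = tnth t (lift ord0 i).
Proof. by case/tupleP: t => x t; rewrite tnthS; congr tnth; apply: val_inj. Qed.

Lemma measurable_tuncons n : measurable_fun setT (@tuncons n).
Proof.
apply: measurable_fun_pair; first exact: measurable_tnth.
apply/measurable_fun_tnthP => i.
rewrite (_ : _ \o _ = @tnth n.+1 R ^~ (lift ord0 i)); last first.
  by apply/funext => t /=; rewrite tnth_behead'.
exact: measurable_tnth.
Qed.

(** [lebn] is a bare set function defined by recursion. The measure structure and sigma-finiteness
    are obtained in one induction, because the next product needs both. *)
Lemma lebn_measure n : exists m : {sigma_finite_measure set (n.-tuple R) -> \bar R},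
  @lebn R n = m :> (set (n.-tuple R) -> \bar R).
Proof.
elim: n => [|n [m Em]]; first by exists (\d_ ([tuple] : 0.-tuple R)).
have mt := @measurable_tcons n.
pose p' : {measure set (n.+1.-tuple R) -> \bar R} :=
  measure_function_pushforward__canonical__measure_function_Measure (mu \x m) mt.
have sf : sigma_finite setT p'.
  have [F TF HF] : sigma_finite setT (mu \x m).
    have /sigma_finiteP[F [TF ndF Foo]] := sigma_finiteT mu.
    have /sigma_finiteP[G [TG ndG Goo]] := sigma_finiteT m.
    exists (fun n => F n `*` G n).
     rewrite -setXTT TF TG predeqE => -[x y]; split.
        move=> [/= [i _ Fnx] [k _ Gky]]; exists (maxn i k) => //; split.
        - by move: x Fnx; exact/subsetPset/ndF/leq_maxl.
        - by move: y Gky; exact/subsetPset/ndG/leq_maxr.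
      by move=> [i _ []/= ? ?]; split; exists i.
    move=> k; have [? ?] := Foo k; have [? ?] := Goo k.
    split; first exact: measurableX.
    by rewrite product_measure1E// lte_mul_pinfty// ge0_fin_numE.
  exists (fun k => @tuncons n @^-1` (F k)).
    by rewrite -preimage_bigcup -TF preimage_setT.
  move=> k; have [mF Foo] := HF k; split.
    by rewrite -[X in measurable X]setTI; exact: measurable_tuncons.
  rewrite /p' /= /pushforward -comp_preimage (_ : _ \o _ = id)//.
  by apply/funext => x; exact: tconsK.
by exists (sigma_finite_pack sf); rewrite /= Em.
Qed.

Definition lebM n := projT1 (cid (lebn_measure n)).

Lemma lebME n : @lebn R n = lebM n :> (set (n.-tuple R) -> \bar R).
Proof. by rewrite /lebM; case: cid. Qed.

Lemma lebMS n A : lebM n.+1 A = \int[mu]_t lebM n [set y | A (tcons (t, y))].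
Proof.
rewrite -lebME /= /pushforward /product_measure1; apply: eq_integral => t _ /=.
by rewrite lebME; congr (lebM n _); apply/seteqP; split => y; rewrite /xsection /= inE.
Qed.

Definition ttrans n (b : 'I_n -> R) (t : n.-tuple R) : n.-tuple R :=
  [tuple (tnth t i + b i)%R | i < n].

Lemma measurable_tcons_section n (A : set (n.+1.-tuple R)) : measurable A ->
  measurable (@tcons R n @^-1` A : set (TR * n.-tuple R)).
Proof. by move=> mA; rewrite -[X in measurable X]setTI; exact: measurable_tcons. Qed.

Lemma measurable_tcons_slice n (A : set (n.+1.-tuple R)) (t : R) : measurable A ->
  measurable [set y | A (tcons (t, y))].
Proof.
move=> /measurable_tcons_section mA.
rewrite (_ : [set y | _] = xsection (@tcons R n @^-1` A : set (TR * n.-tuple R)) t).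
  exact: measurable_xsection.
by apply/seteqP; split => y; rewrite /xsection /= inE.
Qed.

Lemma measurable_lebM_section n (A : set (n.+1.-tuple R)) : measurable A ->
  measurable_fun (setT : set TR) (fun t => lebM n [set y | A (tcons (t, y))]).
Proof.
move=> mA.
have := measurable_fun_xsection (lebM n) (measurable_tcons_section mA).
rewrite (_ : lebM n \o _ = (fun t => lebM n [set y | A (tcons (t, y))]))//.
by apply/funext => t /=; congr (lebM n _); apply/seteqP; split => y; rewrite /xsection /= inE.
Qed.

Lemma ge0_integral_translation (b : R) (f : TR -> \bar R) : measurable_fun (setT : set TR) f ->
  (forall t, 0 <= f t) -> \int[mu]_t f (t + b)%R = \int[mu]_t f t.
Proof.
move=> mf f0.
have ma : measurable_fun setT ((fun t => t + b)%R : TR -> TR).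
  exact: measurable_funD.
have := @ge0_integral_pushforward _ _ _ _ R _ ma mu setT f measurableT mf (fun t _ => f0 t).
rewrite preimage_setT => <-.
by apply: eq_measure_integral => //= A mA _; exact: lebesgue_measure_translation.
Qed.

Lemma lebM_translation n (b : 'I_n -> R) A : measurable A ->
  lebM n (ttrans b @^-1` A) = lebM n A.
Proof.
elim: n b A => [|n IH] b A mA.
  by congr (lebM 0 _); apply/seteqP; split => t /=; rewrite [ttrans b t]tuple0 [t]tuple0.
rewrite !lebMS.
rewrite -[RHS](@ge0_integral_translation (b ord0)); last 2 first.
- exact: measurable_lebM_section.
- by move=> t; exact: measure_ge0.
apply: eq_integral => t _; rewrite -[RHS](IH (fun i => b (lift ord0 i))); last first.
  exact: measurable_tcons_slice.
congr (lebM n _); apply/seteqP; split => y /=;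
  rewrite (_ : ttrans b (tcons (t, y)) =
     tcons ((t + b ord0)%R, ttrans (fun i => b (lift ord0 i)) y))//;
  apply: eq_from_tnth => i; rewrite tnth_mktuple;
  case: (unliftP ord0 i) => [j|] ->; rewrite ?tnthS ?tnth_mktuple ?tnth0//.
Qed.

Definition shear n (a : 'I_n -> R) (p : TR * n.-tuple R) : n.+1.-tuple R :=
  tcons (p.1, ttrans (fun i => a i * p.1)%R p.2).

Lemma measurable_shear n (a : 'I_n -> R) : measurable_fun setT (shear a).
Proof.
apply: (@measurable_cons _ _ (TR * n.-tuple R)%type R fst n (fun p => ttrans (fun i => a i * p.1)%R p.2)) => //.
apply/measurable_fun_tnthP => i.
rewrite (_ : _ \o _ = (fun p : TR * n.-tuple R => (tnth p.2 i + a i * p.1)%R)); last first.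
  by apply/funext => t /=; rewrite tnth_mktuple.
apply: measurable_funD.
  by apply: (@measurableT_comp _ _ _ _ _ _ (@tnth n R ^~ i)) => //; exact: measurable_tnth.
by apply: measurable_funM => //; exact: measurable_fstR.
Qed.

(** For fixed [t] the shear translates [y] by [a t], so each slice keeps its measure. *)
Lemma lebM_shear n (a : 'I_n -> R) A : measurable A ->
  lebM n.+1 A = pushforward (mu \x lebM n) (shear a) A.
Proof.
move=> mA; rewrite lebMS /pushforward /product_measure1.
apply: eq_integral => t _ /=; rewrite -(lebM_translation (fun i => a i * t)%R); last first.
  exact: measurable_tcons_slice.
by congr (lebM n _); apply/seteqP; split => y; rewrite /xsection /= inE.
Qed.

Definition shear_measure n (a : 'I_n -> R) : {measure set (n.+1.-tuple R) -> \bar R} :=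
  measure_function_pushforward__canonical__measure_function_Measure
    (mu \x lebM n) (measurable_shear a).

Lemma ge0_integral_shear n (a : 'I_n -> R) (h : n.+1.-tuple R -> \bar R) :
  measurable_fun setT h -> (forall t, 0 <= h t) ->
  \int[lebM n.+1]_u h u = \int[lebM n]_y \int[mu]_t h (shear a (t, y)).
Proof.
move=> mh h0.
transitivity (\int[shear_measure a]_u h u).
  by apply: eq_measure_integral => A mA _; exact: lebM_shear.
rewrite /shear_measure.
rewrite (@ge0_integral_pushforward _ _ _ _ R _ (measurable_shear a) (mu \x lebM n) setT h)//.
rewrite preimage_setT (fubini_tonelli2 (h \o shear a))//.
  by apply: measurableT_comp => //; exact: measurable_shear.
by move=> x; exact: h0.
Qed.

Lemma integrable_shear n (a : 'I_n -> R) (h : n.+1.-tuple R -> \bar R) :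
  (lebM n.+1).-integrable setT h -> (mu \x lebM n).-integrable setT (h \o shear a).
Proof.
move=> /integrableP[mh hoo]; apply/integrableP; split.
  by apply: measurableT_comp => //; exact: measurable_shear.
move: hoo; rewrite (@ge0_integral_shear _ a)//; last exact: measurableT_comp.
rewrite (fubini_tonelli2 (fun u => `|(h \o shear a) u|))//.
by apply: measurableT_comp => //; apply: measurableT_comp => //; exact: measurable_shear.
Qed.

Lemma integral_shear n (a : 'I_n -> R) (h : n.+1.-tuple R -> \bar R) :
  (lebM n.+1).-integrable setT h ->
  \int[lebM n.+1]_u h u = \int[lebM n]_y \int[mu]_t h (shear a (t, y)).
Proof.
move=> ih.
transitivity (\int[shear_measure a]_u h u).
  by apply: eq_measure_integral => A mA _; exact: lebM_shear.
have ih' := integrable_shear a ih; move: ih => /integrableP[mh _].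
rewrite /shear_measure.
rewrite (@integral_pushforward _ _ _ _ R _ (measurable_shear a) (mu \x lebM n) setT h)//.
by rewrite preimage_setT -(integral21_prod_meas1 ih').
Qed.

Lemma integral_shear_eq0 n (a : 'I_n -> R) (h : n.+1.-tuple R -> \bar R) (N : set (n.-tuple R)) :
  (lebM n.+1).-integrable setT h -> (lebM n).-negligible N ->
  (forall y, ~ N y -> \int[mu]_t h (shear a (t, y)) = 0) -> \int[lebM n.+1]_u h u = 0.
Proof.
move=> ih nN h0; rewrite (integral_shear a ih).
rewrite (@ae_eq_integral _ _ _ (lebM n) setT (cst 0))//; first by rewrite integral0.
  exact: (measurable_fubini_G (integrable_shear a ih)).
apply: negligibleS nN => y /= ny; apply: contrapT => Ny; apply: ny => _; exact: h0.
Qed.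

End Lebn.

Section Opens.
Context {R : realType}.

Lemma tnth_row n (t : n.-tuple R) i : row_of_tuple t ord0 i = tnth t i.
Proof. by rewrite mxE. Qed.

Lemma norm_rowP n (x : 'rV[R]_n) (e : R) : 0 < e ->
  `|x| < e <-> forall i, `|x ord0 i| < e.
Proof.
move=> e0; split=> [xe i|H].
  by apply: le_lt_trans xe; rewrite [leRHS]/Num.norm /= mx_normrE; apply/bigmax_geP; right => /=; exists (ord0, i).
rewrite [ltLHS]/Num.norm /= mx_normrE; apply/bigmax_ltP; split => // -[a i] _ /=.
by rewrite (ord1 a).
Qed.

(** Links the topology of row vectors to the product sigma-algebra of tuples: [U] is the union of
    the rational cubes that it contains, enumerated through [unpickle]. *)
Lemma measurable_open_row n (U : set 'rV[R]_n) : open U ->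
  measurable (@row_of_tuple R n @^-1` U).
Proof.
move=> oU.
pose box (q : n.-tuple rat) (k : nat) : set 'rV[R]_n :=
  [set x | forall i, `|x ord0 i - ratr (tnth q i)| < k.+1%:R^-1].
pose B (j : nat) : set 'rV[R]_n := if unpickle j is Some (q, k) then
  (if `[< box q k `<=` U >] then box q k else set0) else set0.
have -> : U = \bigcup_j B j.
  apply/seteqP; split=> [x Ux|x [j _]]; last first.
    rewrite /B; case: unpickle => // -[q k]; case: asboolP => // h; exact: h.
  have /nbhs_ballP[e /= e0 He] := open_nbhs_nbhs (conj oU Ux).
  have [k Hk] : exists k : nat, 2 * k.+1%:R^-1 < e.
    have [k _ /(_ k (leqnn k)) /= h] := near_infty_natSinv_lt (PosNum (divr_gt0 e0 (ltr0n _ 2))).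
    by exists k; move: h => /=; rewrite ltr_pdivlMr// mulrC.
  have k0 : (0 : R) < k.+1%:R^-1 by rewrite invr_gt0.
  have q_ i : exists q : rat, `|x ord0 i - ratr q| < k.+1%:R^-1.
    have [q] := rat_in_itvoo (ltr_pwDr k0 (lexx (x ord0 i))).
    rewrite in_itv /= => /andP[h1 h2]; exists q.
    move: (k.+1%:R^-1 : R) k0 h1 h2 => d *.
    by rewrite ltr_norml; apply/andP; split; lra.
  have [q Hq] := choice q_.
  exists (pickle ([tuple q i | i < n], k)) => //; rewrite /B pickleK.
  have sub : box [tuple q i | i < n] k `<=` U.
    move=> y Hy; apply: He; rewrite -ball_normE /=.
    apply/norm_rowP => // i; rewrite !mxE.
    have := Hq i; have := Hy i; rewrite tnth_mktuple !ltr_norml.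
    move: (k.+1%:R^-1 : R) Hk k0 => d ? ?.
    by move=> /andP[? ?] /andP[? ?]; apply/andP; split; lra.
  by rewrite (asboolT sub) => i; rewrite tnth_mktuple.
rewrite preimage_bigcup; apply: bigcup_measurable => j _; rewrite /B.
case: unpickle => [[q k]|]; last by rewrite preimage_set0.
case: ifP => _; last by rewrite preimage_set0.
rewrite (_ : _ @^-1` _ = \bigcap_(i in [set: 'I_n])
   ((fun t : n.-tuple R => tnth t i) @^-1` (ball (ratr (tnth q i) : R) k.+1%:R^-1))); last first.
  apply/seteqP; split=> [t /= Ht i _|t /= Ht i].
    by rewrite -ball_normE /= distrC -tnth_row; exact: Ht.
  by have := Ht i I; rewrite -ball_normE /= distrC tnth_row.
apply: fin_bigcap_measurable => // i _.
rewrite -[X in measurable X]setTI; apply: measurable_tnth => //.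
exact: measurable_ball.
Qed.

Lemma measurable_continuous_row n (U : set 'rV[R]_n) (g : 'rV[R]_n -> R) : open U ->
  (forall x, U x -> {for x, continuous g}) ->
  measurable_fun (@row_of_tuple R n @^-1` U) (g \o @row_of_tuple R n).
Proof.
move=> oU cg; apply: (measurability _ (RGenOInfty.measurableE R)) => //.
move=> _ [_ [a ->] <-].
rewrite (_ : _ `&` _ = @row_of_tuple R n @^-1` (U `&` g @^-1` `]a, +oo[)).
  apply: measurable_open_row; rewrite openE => x [Ux gx].
  apply: filterI; first exact: open_nbhs_nbhs.
  apply: (cg x Ux); apply: open_nbhs_nbhs; split => //; exact: interval_open.
by [].
Qed.

End Opens.

(** * Integrability of negative powers *)

Section PowInt.
Context {R : realType}.
Local Notation mu := (@lebesgue_measure R).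

Lemma integral_pow_away0 (b d : R) : 0 < b < 1 -> 0 < d -> d < 1 ->
  (\int[mu]_(u in `[d, 1%R]) (u `^ (- b))%:E <= ((1 - b)^-1)%:E)%E.
Proof.
move=> /andP[b0 b1] d0 d1.
have b1' : 1 - b != 0 by rewrite subr_eq0 gt_eqF.
pose F u : R := u `^ (1 - b) / (1 - b).
have dF (x : R) : 0 < x -> is_derive x 1 F (x `^ (- b)).
  move=> x0; rewrite /F.
  have := @is_derive1_powR R (1 - b) x x0.
  rewrite (_ : 1 - b - 1 = - b); last by ring.
  move=> h; have := is_deriveZ (1 - b)^-1 h.
  rewrite (_ : (1 - b)^-1 *: _ = x `^ (- b)); last by rewrite /GRing.scale /= mulKf.
  rewrite (_ : _ \*: _ = F)//; apply/funext => u; by rewrite /F /= /GRing.scale /= mulrC.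
rewrite (@continuous_FTC2 _ _ F)//.
- rewrite -EFinB lee_fin /F powR1 mul1r gerBl.
  by rewrite divr_ge0 ?powR_ge0// subr_ge0 ltW.
- apply: continuous_in_subspaceT => x; rewrite inE /= in_itv /= => /andP[dx _].
  have x0 : 0 < x by apply: lt_le_trans dx.
  have := @is_derive1_powR R (- b) x x0.
  by move=> [h _]; apply: differentiable_continuous; apply/derivable1_diffP.
- split.
  + by move=> x; rewrite in_itv /= => /andP[dx _]; have [] := dF x (lt_trans d0 dx).
  + apply: cvg_at_right_filter; have [h _] := dF d d0.
    by apply: differentiable_continuous; apply/derivable1_diffP.
  + apply: cvg_at_left_filter; have [h _] := dF 1 ltr01.
    by apply: differentiable_continuous; apply/derivable1_diffP.
- move=> x; rewrite in_itv /= => /andP[dx _].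
  by rewrite derive1E; have [_ ->] := dF x (lt_trans d0 dx).
Qed.

Lemma integral_pow (b : R) : 0 < b < 1 ->
  (\int[mu]_(u in `]0%R, 1%R]) (u `^ (- b))%:E <= ((1 - b)^-1)%:E)%E.
Proof.
move=> hb.
pose f (u : R) := ((u `^ (- b))%:E : \bar R).
(* With [n.+2] the left end is always smaller than [1], as [integral_pow_away0] requires. *)
pose A n : set R := `[n.+2%:R^-1, 1]%classic.
pose g n := f \_ (A n).
have mf : measurable_fun (setT : set R) f by apply/measurable_EFinP; exact: measurable_powR.
have mg n : measurable_fun setT (g n).
  by apply/(measurable_restrictT f); [exact: measurable_itv | exact: measurable_funTS].
have g0 n x : setT x -> (0 <= g n x)%E.
  by move=> _; rewrite /g patchE; case: ifP => // _; rewrite lee_fin powR_ge0.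
have ndg x : setT x -> nondecreasing_seq (g^~ x).
  move=> _ m n mn; rewrite /g !patchE; case: ifPn => [|_]; last first.
    by case: ifP => // _; rewrite lee_fin powR_ge0.
  rewrite inE /A /= in_itv /= => /andP[h1 h2]; rewrite mem_set//=.
  by rewrite in_itv /= h2 andbT; apply: le_trans h1; rewrite lef_pV2 ?posrE// ler_nat.
have := @cvg_monotone_convergence _ _ _ mu setT measurableT g mg g0 ndg.
have -> : (fun x => limn (g^~ x)) = f \_ `]0, 1]%classic.
  apply/funext => x; apply/cvg_lim => //.
  rewrite patchE; case: ifPn => [|]; last first.
    rewrite notin_setE /= in_itv /= => /negP/nandP h.
    apply: cvg_near_cst; apply: nearW => n; rewrite /g patchE.
    case: ifPn => //; rewrite inE /A /= in_itv /= => /andP[h1 h2].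
    by case: h => /negP; [case; apply: lt_le_trans h1; rewrite invr_gt0|case].
  rewrite inE /= in_itv /= => /andP[x0 x1].
  apply: cvg_near_cst.
  have [k _ Hk] := near_infty_natSinv_lt (PosNum x0).
  exists k => // n /= kn.
  have Anx : A n x.
    rewrite /A /= in_itv /= x1 andbT.
    by have := Hk n.+1 (leq_trans kn (leqnSn _)) => /= /ltW.
  by rewrite /g patchE mem_set.
rewrite -integral_mkcond => /cvg_lim <-//.
apply: lime_le.
  apply: ereal_nondecreasing_is_cvgn => m n mn; apply: ge0_le_integral => //.
  - by move=> x _; exact: g0.
  - exact: mg.
  - exact: mg.
  - by move=> x _; exact: ndg.
apply: nearW => n; rewrite /g -integral_mkcond; apply: integral_pow_away0 => //.
by rewrite invf_lt1// ltr1n.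
Qed.

End PowInt.

Section Sg.
Context {R : realType}.
Local Notation mu := (@lebesgue_measure R).
Local Notation TR := (measurableTypeR R).

(** The real power takes the value [0] at [0] when [b != 0]. The value [+oo] restores monotonicity
    in [|u|] and makes zeros negligible as soon as the integral is finite. *)
Definition sg (b u : R) : \bar R := if u == 0 then +oo%E else (`|u| `^ (- b))%:E.

Lemma sg_ge0 b u : (0 <= sg b u)%E.
Proof. by rewrite /sg; case: ifP => // _; rewrite lee_fin powR_ge0. Qed.

Lemma measurable_sg b : measurable_fun (setT : set R) (sg b).
Proof.
apply: measurable_fun_if => //.
- by apply: measurable_fun_eqr => //; exact: measurable_id.
- apply: measurable_funTS; apply/measurable_EFinP.
  by apply: (measurableT_comp (measurable_powR _)).
Qed.

Lemma sg_fin b u : u != 0 -> sg b u = (`|u| `^ (- b))%:E.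
Proof. by rewrite /sg => /negbTE ->. Qed.

Lemma sg_le b u v : 0 <= b -> `|u| <= `|v| -> (sg b v <= sg b u)%E.
Proof.
move=> b0 uv; rewrite /sg; case: eqP => [v0|/eqP v0]; case: eqP => [u0|/eqP u0] //.
- by move: uv; rewrite v0 normr0 normr_le0 (negbTE u0).
- by rewrite leey.
- rewrite lee_fin !powRN lef_pV2 ?posrE ?powR_gt0 ?normr_gt0//.
  by apply: ge0_ler_powR => //; rewrite nnegrE.
Qed.

Lemma sgM b c u : c != 0 -> sg b (c * u) = ((`|c| `^ (- b))%:E * sg b u)%E.
Proof.
move=> c0; rewrite /sg mulf_eq0 (negbTE c0) /=; case: eqP => _.
  by rewrite gt0_muley// lte_fin powR_gt0// normr_gt0.
by rewrite normrM powRM.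
Qed.

Lemma sgX (b b' u : R) k : 0 <= b -> k%:R * b <= b' -> `|u| <= 1 -> u != 0 ->
  (sg b (u ^+ k) <= sg b' u)%E.
Proof.
move=> b0 kb u1 u0; rewrite !sg_fin ?expf_neq0// lee_fin normrX.
rewrite -powR_mulrn// -powRrM; apply: ger_powR; first by rewrite normr_gt0 u0.
by rewrite mulrN lerN2.
Qed.

(** The product is at least the smallest factor to the power [size s], so one term of the sum is
    enough; the [1] serves the empty list. *)
Lemma sg_prod (b : R) (s : seq R) : 0 <= b -> (size s)%:R * b <= 2^-1 ->
  (forall x, x \in s -> 0 <= x <= 1) ->
  (sg b (\prod_(x <- s) x) <= 1 + \sum_(x <- s) sg 2^-1 x)%E.
Proof.
move=> b0 sb s01.
have [->|sn0] := eqVneq s [::].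
  by rewrite !big_nil adde0 sg_fin ?oner_eq0// normr1 powR1.
have [m ms mmin] : exists2 m, m \in s & forall x, x \in s -> m <= x.
  elim: s sn0 {sb s01} => // x [|x' s] IH _.
    by exists x; rewrite ?mem_head// => y; rewrite inE => /eqP ->.
  have [m ms mmin] := IH isT.
  exists (Num.min x m); first by rewrite minEle; case: ifP; rewrite inE ?eqxx// ms orbT.
  move=> y; rewrite inE => /predU1P[->|ys]; first by rewrite ge_min lexx.
  by rewrite ge_min mmin ?orbT.
have /andP[m0 m1] := s01 m ms.
have ge0 (l : seq R) : (0 <= \sum_(x <- l) sg 2^-1 x)%E.
  by apply: sume_ge0 => x _; exact: sg_ge0.
have mle : (sg 2^-1 m <= 1 + \sum_(x <- s) sg 2^-1 x)%E.
  rewrite (perm_big _ (perm_to_rem ms)) big_cons /= addeCA leeDl//.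
  by rewrite adde_ge0.
apply: le_trans mle.
have [->|mn0] := eqVneq m 0; first by rewrite /sg eqxx leey.
apply: le_trans (sgX _ sb _ mn0) => //; last by rewrite ger0_norm.
apply: sg_le => //; rewrite normrX normr_prod ger0_norm//.
elim: s s01 mmin {sb sn0 ms} => [|y s IH] H H'; first by rewrite big_nil.
rewrite big_cons /= exprS; apply: ler_pM => //; rewrite ?exprn_ge0//.
  by rewrite ger0_norm ?H' ?mem_head//; have /andP[] := H y (mem_head _ _).
by apply: IH => z zs; [apply: H|apply: H']; rewrite inE zs orbT.
Qed.

(** The bound must not depend on the position [a] of the root: translating by [a] moves the window
    into [[-1, 1]], over which the integral is at most [2 / (1 - b)]. *)
Lemma integral_sg (b : R) : 0 < b < 1 -> exists C : R, forall a, `|a| <= 2^-1 ->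
  (\int[mu]_(t in `[(- 2^-1)%R, 2^-1%R]) sg b (t - a)%R <= C%:E)%E.
Proof.
move=> hb; have /andP[b0 b1] := hb; exists ((1 - b)^-1 + (1 - b)^-1) => a ha.
pose G := sg b \_ `[-1, 1]%classic.
have mG : measurable_fun (setT : set TR) G.
  by apply/(measurable_restrictT (sg b)) => //; exact: measurable_funTS (measurable_sg b).
have G0 t : (0 <= G t)%E by rewrite /G patchE; case: ifP => // _; exact: sg_ge0.
apply: (@le_trans _ _ (\int[mu]_t G (t + - a)%R)%E).
  rewrite integral_mkcond; apply: ge0_le_integral => //.
  - by move=> t _; rewrite patchE; case: ifP => // _; exact: sg_ge0.
  - apply: (measurable_restrictT (fun t : TR => sg b (t - a)%R) (measurable_itv _)).1.
    apply: measurable_funTS.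
    by apply: (measurableT_comp (measurable_sg b)); exact: measurable_funB.
  - by apply: (measurableT_comp mG); exact: measurable_funD.
  - move=> t _; rewrite patchE; case: ifPn => [|_]; last exact: G0.
    rewrite inE /= in_itv /= => /andP[t1 t2]; rewrite /G patchE mem_set//=.
    move: ha; rewrite ler_norml in_itv /= => /andP[? ?].
    by apply/andP; split; lra.
rewrite ge0_integral_translation// /G -integral_mkcond.
have -> : `[-1, 1]%classic = (`[(-1 : R), 0[ `|` `]0, 1]) `|` [set 0] :> set R.
  apply/seteqP; split=> x /=; rewrite !in_itv /=.
    move=> /andP[h1 h2]; have [x0|x0|->] := ltgtP x 0; [left; left|left; right|right] => //.
    by rewrite h1.
  by move=> [[]|->]; [move=> /andP[? ?]|move=> /andP[? ?]|]; apply/andP; split; lra.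
have ms := measurable_sg b.
rewrite ge0_integral_setU//=; last 4 first.
- exact: measurableU.
- exact: measurable_funTS.
- by move=> x _; exact: sg_ge0.
- rewrite disj_set2E; apply/eqP/seteqP; split => // x [] /= H x0.
  by move: H; rewrite x0 !in_itv /= ltxx andbF => -[].
rewrite integral_set1 adde0.
rewrite ge0_integral_setU//=; last 3 first.
- exact: measurable_funTS.
- by move=> x _; exact: sg_ge0.
- rewrite disj_set2E; apply/eqP/seteqP; split => // x [] /=; rewrite !in_itv /=.
  by move=> /andP[_ x0] /andP[x0' _]; move: (lt_trans x0 x0'); rewrite ltxx.
have E2 : (\int[mu]_(x in `]0%R, 1%R]) sg b x = \int[mu]_(u in `]0%R, 1%R]) (u `^ (- b))%:E)%E.
  apply: eq_integral => x; rewrite inE /= in_itv /= => /andP[x0 _].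
  by rewrite sg_fin ?gt_eqF// gtr0_norm.
have E1 : (\int[mu]_(x in `[(-1)%R, 0%R[) sg b x = \int[mu]_(x in `]0%R, 1%R]) sg b x)%E.
  have ma : measurable_fun setT (-%R : TR -> TR) by exact: measurable_funN.
  have := @ge0_integral_pushforward _ _ TR TR R _ ma mu `]0%R, 1%R]%classic (sg b)
    (measurable_itv _) (measurable_funTS ms) (fun t _ => sg_ge0 b t).
  rewrite opp_preimage_itvbndbnd oppr0 => E.
  transitivity (\int[mu]_(x in `[(-1)%R, 0%R[) (sg b \o -%R) x)%E.
    by apply: eq_integral => x _ /=; rewrite /sg oppr_eq0 normrN.
  rewrite -E; apply: eq_measure_integral => A mA _; exact: lebesgue_measureN.
rewrite E1 E2 EFinD; apply: leeD; exact: integral_pow.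
Qed.

End Sg.

Section Boxes.
Context {R : realType}.
Local Notation mu := (@lebesgue_measure R).
Local Notation TR := (measurableTypeR R).

Definition tbox n (r : R) : set (n.-tuple R) := [set y | forall i, `|tnth y i| <= r].

Lemma measurable_tbox n (r : R) : measurable (@tbox n r).
Proof.
rewrite (_ : tbox r = \bigcap_(i in [set: 'I_n])
   ((fun t : n.-tuple R => tnth t i) @^-1` `[- r, r]%classic)); last first.
  apply/seteqP; split=> [t /= Ht i _|t /= Ht i].
    by rewrite /= in_itv /= -ler_norml; exact: Ht.
  by have := Ht i I; rewrite /= in_itv /= -ler_norml.
apply: fin_bigcap_measurable => // i _.
by rewrite -[X in measurable X]setTI; apply: measurable_tnth.
Qed.

Lemma tbox_tcons n (r t : R) (y : n.-tuple R) :
  tbox r (tcons (t, y)) <-> `|t| <= r /\ tbox r y.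
Proof.
split=> [H|[Ht Hy] i].
  split; first by have := H ord0; rewrite tnth0.
  by move=> i; have := H (lift ord0 i); rewrite tnthS.
by case: (unliftP ord0 i) => [j|] ->; rewrite ?tnthS ?tnth0.
Qed.

Lemma lebM_tbox n (r : R) : (lebM n (tbox r) < +oo)%E.
Proof.
elim: n => [|n IH].
  rewrite -lebME /= diracE; by case: (_ \in _); rewrite ltry.
rewrite lebMS.
apply: (@le_lt_trans _ _ (\int[mu]_(t in `[(- r)%R, r]) (cst (lebM n (tbox r))) t)%E).
  rewrite [leRHS]integral_mkcond; apply: ge0_le_integral => //.
  - by apply: measurable_lebM_section; exact: measurable_tbox.
  - by apply: (measurable_restrictT (cst _ : TR -> \bar R) (measurable_itv _)).1; exact: measurable_cst.
  - move=> t _; rewrite patchE; case: ifPn => [_|].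
      apply: le_measure; rewrite ?inE; [|exact: measurable_tbox|].
        by apply: measurable_tcons_slice; exact: measurable_tbox.
      by move=> y /= /tbox_tcons[].
    rewrite notin_setE /= in_itv /= -ler_norml => tr.
    rewrite (_ : [set y | _] = set0) ?measure0//; apply/seteqP; split => // y /= /tbox_tcons[].
    by move=> /tr.
rewrite integral_cst//= lebesgue_measure_itv /=; case: ifP => _; last by rewrite mule0.
by rewrite lte_mul_pinfty// ?ge0_fin_numE// -EFinD ltry.
Qed.

End Boxes.

Section ShearCoord.
Context {R : realType}.
Local Notation mu := (@lebesgue_measure R).
Local Notation TR := (measurableTypeR R).

(** The map [shear] on functions instead of tuples, the form in which points enter power series. *)
Definition shr n (a : 'I_n -> R) (t : R) (y : 'I_n -> R) (i : 'I_n.+1) : R :=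
  if unlift ord0 i is Some j then y j + a j * t else t.

Lemma shr0 n (a : 'I_n -> R) t y : shr a t y ord0 = t.
Proof. by rewrite /shr unlift_none. Qed.

Lemma shrS n (a : 'I_n -> R) t y j : shr a t y (lift ord0 j) = y j + a j * t.
Proof. by rewrite /shr liftK. Qed.

Lemma tnth_shear n (a : 'I_n -> R) t (y : n.-tuple R) :
  tnth (shear a (t, y)) = shr a t (tnth y).
Proof.
apply/funext => i; rewrite /shear; case: (unliftP ord0 i) => [j|] ->.
  by rewrite tnthS tnth_mktuple shrS.
by rewrite tnth0 shr0.
Qed.

Lemma An_shr n (rho s0 r0 : R) F M (a : 'I_n -> R) : 0 <= s0 -> 0 <= r0 -> s0 <= rho ->
  (forall j, r0 + `|a j| * s0 <= rho) -> An (fun=> rho) F M ->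
  An (ocons s0 (fun=> r0)) (fun x => F (shr a (x None) (x \o Some))) M.
Proof.
move=> s00 r00 sr ar HF.
have p : polyd (V := option 'I_n) (ocons s0 (fun=> r0)) (ocons s0 (fun=> r0)) by move=> [j|] /=; rewrite ger0_norm.
apply: (An_subst (L := fun i x => shr a (x None) (x \o Some) i) HF) => i.
case: (unliftP ord0 i) => [j|] ->.
  apply: (An_le p (ar j)); rewrite -[X in X + _](ger0_norm r00) -[X in _ * X](ger0_norm s00).
  have h := An_add (An_var (ocons s0 (fun=> r0)) (Some j))
    (An_scale (a j) (An_var (ocons s0 (fun=> r0)) None)).
  by apply: An_eq h => x _; rewrite shrS.
apply: (An_le p sr); rewrite -[X in An _ _ X](ger0_norm s00).
by apply: An_eq (An_var (ocons s0 (fun=> r0)) None) => x _; rewrite shr0.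
Qed.

Lemma norm_unshear (y a t d : R) : `|t| <= d -> `|y + a * t| <= d -> `|y| <= d + `|a| * d.
Proof.
move=> td h; have : `|a * t| <= `|a| * d by rewrite normrM ler_wpM2l.
by have := ler_normB (y + a * t) (a * t); rewrite addrK; lra.
Qed.

(** Tonelli along sheared lines. The condition relating [d] and [r] ensures that a line meeting the
    small box has its [y] in [tbox r]. *)
Lemma shear_bound n (a : 'I_n -> R) (d s r : R) (g : n.+1.-tuple R -> \bar R)
    (B : n.-tuple R -> \bar R) : d <= s -> (forall j, d + `|a j| * d <= r) ->
  (forall u, 0 <= g u)%E -> measurable_fun (tbox d) g ->
  (forall y, 0 <= B y)%E -> measurable_fun (tbox r) B ->
  (forall y, tbox r y -> exists b : R -> \bar R, [/\
     (forall t, 0 <= b t)%E, measurable_fun (`[- s, s]%classic : set R) b,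
     (forall t, `|t| <= s -> tbox d (shear a (t, y)) -> (g (shear a (t, y)) <= b t)%E) &
     (\int[mu]_(t in `[(- s)%R, s]) b t <= B y)%E]) ->
  (\int[lebM n.+1]_(u in tbox d) g u <= \int[lebM n]_(y in tbox r) B y)%E.
Proof.
move=> ds ar g0 mg B0 mB H.
pose h := g \_ (tbox d).
have mh : measurable_fun setT h by apply/(measurable_restrictT g); [exact: measurable_tbox|].
have h0 u : (0 <= h u)%E by rewrite /h patchE; case: ifP.
rewrite integral_mkcond (ge0_integral_shear a mh h0) [leRHS]integral_mkcond.
apply: ge0_le_integral => //.
- by move=> y _; apply: integral_ge0.
- apply: (measurable_fun_fubini_tonelli_G (h \o shear a)) => //.
    by apply: measurableT_comp => //; exact: measurable_shear.
  by move=> x; exact: h0.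
- by apply/(measurable_restrictT B); [exact: measurable_tbox|].
move=> y _; have hz t : `|t| <= d \/ h (shear a (t, y)) = 0%E.
  rewrite /h patchE; case: ifPn => [|_]; last by right.
  by rewrite inE => Hu; left; have := Hu ord0; rewrite tnth_shear shr0.
rewrite patchE; case: ifPn => [|]; last first.
  rewrite notin_setE => ny; rewrite integral0_eq// => t _.
  rewrite /h patchE; case: ifPn => //; rewrite inE => Hu; exfalso; apply: ny => j.
  have h1 := Hu ord0; have h2 := Hu (lift ord0 j).
  rewrite tnth_shear shr0 in h1; rewrite tnth_shear shrS in h2.
  exact: le_trans (norm_unshear h1 h2) (ar j).
rewrite inE => Hy; have [b [b0 mb gb ib]] := H y Hy.
apply: le_trans ib; rewrite [leRHS]integral_mkcond; apply: ge0_le_integral => //.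
- apply: measurableT_comp => //.
  apply: (@measurableT_comp _ _ _ _ _ _ (shear a)); first exact: measurable_shear.
  exact: pair2_measurable.
- exact: (measurable_restrictT b (measurable_itv _)).1.
move=> t _; rewrite patchE; case: ifPn => [|nt].
  rewrite inE /= in_itv /= -ler_norml => ts.
  rewrite /h patchE; case: ifPn => [|//]; rewrite inE; exact: gb.
have [td|->//] := hz t; exfalso; move: nt; rewrite notin_setE /= in_itv /= -ler_norml.
by case; apply: le_trans td ds.
Qed.

End ShearCoord.

Section Wdata.
Context {R : realType}.
Local Notation mu := (@lebesgue_measure R).
Local Notation TR := (measurableTypeR R).

(** The data of [weierstrass] along the direction [(1, a)]. The bound [s <= 2^-1] makes all
    differences of roots at most [1] in modulus. *)
Definition wdata n (F : ('I_n.+1 -> R) -> R) (a : 'I_n -> R) (k : nat) (c s r1 : R)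
    (Q : (option 'I_n -> R) -> R) (r : nat -> ('I_n -> R) -> R) :=
  [/\ c != 0, 0 < s, s <= 2^-1 & 0 < r1] /\
  [/\ An (ocons s (fun=> r1)) Q 2,
     (forall x, polyd (ocons s (fun=> r1)) x -> `|Q x - 1| <= 2^-1),
     (forall j, exists N, An (fun=> r1) (r j) N),
     (forall y, polyd (fun=> r1) y -> \sum_(j < k) s ^+ j * `|r j y| <= s ^+ k / 2) &
     forall t y, `|t| <= s -> polyd (fun=> r1) y ->
        Q (ocons t y) * F (shr a t y) = c * (wpoly k (r^~ y)).[t]].

Lemma wdata_exists n (rho s0 r0 : R) F M (a : 'I_n -> R) t0 (s1 r2 : R) :
  0 < r0 -> s0 <= rho -> (forall j, r0 + `|a j| * s0 <= rho) -> An (fun=> rho) F M ->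
  `|t0| < s0 -> F (shr a t0 (fun=> 0)) != 0 -> 0 < s1 -> 0 < r2 ->
  exists k c s r1 Q r, [/\ wdata F a k c s r1 Q r, s <= s1 & r1 <= r2].
Proof.
move=> r00 sr ar HF ts Ft s10 r20.
have s00 : 0 < s0 by apply: le_lt_trans ts.
have HF' := An_shr (ltW s00) (ltW r00) sr ar HF.
pose r0' := Num.min r0 r2.
have r0'0 : 0 < r0' by rewrite lt_min r00.
have HF2 : An (ocons s0 (fun=> r0')) (fun x => F (shr a (x None) (x \o Some))) M.
  apply: An_le HF' => // -[j|] /=; rewrite gtr0_norm//.
  by rewrite ge_min lexx.
have s1' : 0 < Num.min s1 2^-1 by rewrite lt_min s10 invr_gt0 ltr0n.
have := weierstrass s00 (fun=> ltW r0'0) HF2 ts Ft s1'.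
move=> [k [c [s [th [Q [r [[c0 /andP[s_gt0 ss1] ss0 /andP[th0 th1]] [HQ Q1 Hr Hs E]]]]]]]].
exists k, c, s, (th * r0'), Q, r; split; last 2 first.
- by apply: le_trans ss1 _; rewrite ge_min lexx.
- apply: (@le_trans _ _ (1 * r0')); first by rewrite ler_wpM2r// ltW.
  by rewrite mul1r ge_min lexx orbT.
split; split => //.
- by apply: le_trans ss1 _; rewrite ge_min lexx orbT.
- exact: mulr_gt0.
- by move=> t y ht hy; rewrite horner_wpoly -E.
Qed.

Lemma integral_sum_sg (b C s : R) (rs : seq R) : (forall a, `|a| <= 2^-1 ->
    (\int[mu]_(t in `[(- 2^-1)%R, 2^-1%R]) sg b (t - a)%R <= C%:E)%E) ->
  s <= 2^-1 -> (forall x, x \in rs -> `|x| <= 2^-1) ->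
  (\int[mu]_(t in `[(- s)%R, s]) \sum_(x <- rs) sg b (t - x)%R <= ((size rs)%:R * C)%:E)%E.
Proof.
move=> HC s1 rs1.
have msg x : measurable_fun (setT : set TR) (fun t => sg b (t - x)).
  by apply: (measurableT_comp (measurable_sg _)); exact: measurable_funB.
rewrite ge0_integral_sum//; last 2 first.
- by move=> x; apply: measurable_funTS; exact: msg.
- by move=> x t _; exact: sg_ge0.
elim: rs rs1 => [|x rs IH] rs1; first by rewrite big_nil lee_fin mul0r.
rewrite big_cons (_ : (size (x :: rs))%:R * C = C + (size rs)%:R * C); last first.
  by rewrite /= -natr1 mulrDl mul1r addrC.
rewrite EFinD; apply: leeD; last first.
  by apply: IH => w wr; apply: rs1; rewrite inE wr orbT.
apply: le_trans (HC x _); last by apply: rs1; rewrite mem_head.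
apply: ge0_subset_integral => //.
- by apply: measurable_funTS; exact: msg.
- by move=> t _; exact: sg_ge0.
- by move=> t /=; rewrite !in_itv /= => /andP[? ?]; apply/andP; split; move: s1; lra.
Qed.

Section Lines.
Variables (n : nat) (F : ('I_n.+1 -> R) -> R) (a : 'I_n -> R) (k : nat) (c s r1 : R).
Variables (Q : (option 'I_n -> R) -> R) (r : nat -> ('I_n -> R) -> R).
Hypothesis W : wdata F a k c s r1 Q r.

Lemma wdata_Q t y : `|t| <= s -> polyd (fun=> r1) y -> 2^-1 <= Q (ocons t y) <= 3 / 2.
Proof.
move=> ht hy; case: W => _ [_ Q1 _ _ _].
have := Q1 _ (polyd_ocons ht hy); rewrite ler_norml => /andP[? ?].
by apply/andP; split; lra.
Qed.

Lemma wdata_root y z : polyd (fun=> r1) y ->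
  root (map_poly (real_complex R) (wpoly k (r^~ y))) z -> normc z < s.
Proof. by move=> hy; case: W => -[_ s0 _ _] [_ _ _ Hs _]; apply: root_norm_lt => //; exact: Hs. Qed.

Lemma wdata_lower t y : `|t| <= s -> polyd (fun=> r1) y ->
  `|c / 2 * (wpoly k (r^~ y)).[t]| <= `|F (shr a t y)|.
Proof.
move=> ht hy; case: W => -[c0 _ _ _] [_ _ _ _ E].
have /andP[q1 q2] := wdata_Q ht hy.
have -> : c / 2 * (wpoly k (r^~ y)).[t] = (Q (ocons t y) / 2) * F (shr a t y).
  by rewrite mulrAC -(E t y)//; ring.
rewrite normrM ler_piMl// ger0_norm; lra.
Qed.

(** The exponent is chosen so that [k] factors cost at most the power [1/2] of the nearest one,
    which is integrable uniformly in the roots; [k.+1] avoids a zero denominator. *)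
Lemma line_sg_bound : exists K : R, 0 <= K /\ forall y, polyd (fun=> r1) y ->
  exists b : R -> \bar R, [/\
     (forall t, 0 <= b t)%E, measurable_fun (`[- s, s]%classic : set R) b,
     (forall t, `|t| <= s -> (sg (2 * k.+1%:R)^-1 (F (shr a t y)) <= b t)%E) &
     (\int[mu]_(t in `[(- s)%R, s]) b t <= K%:E)%E].
Proof.
have hb : 0 < (2^-1 : R) < 1 by rewrite invr_gt0 ltr0n invf_lt1// ltr1n.
have [C HC] := integral_sg hb.
have C0 : 0 <= C.
  rewrite -lee_fin; apply: le_trans (HC 0 _); last by rewrite normr0 invr_ge0.
  by apply: integral_ge0 => t _; exact: sg_ge0.
set e := (2 * k.+1%:R)^-1.
have e0 : 0 < e by rewrite invr_gt0 mulr_gt0.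
case: W => -[c0 s0 s1 _] _.
pose kap := `|c / 2| `^ (- e).
have kap0 : 0 <= kap by exact: powR_ge0.
exists (kap * (1 + k%:R * C)); split.
  by rewrite mulr_ge0// addr_ge0// mulr_ge0.
move=> y hy.
have [rs srs Ers] := real_poly_roots (wpoly_monic k (r^~ y)) (size_wpoly k (r^~ y)).
have rsz z : z \in rs -> normc z < s.
  by move=> zr; apply: (wdata_root hy); rewrite Ers root_prod_XsubC.
pose b t := (kap%:E * (1 + \sum_(z <- rs) sg 2^-1 (t - complex.Re z)))%E.
have msum : measurable_fun (setT : set TR) (fun t => \sum_(z <- rs) sg 2^-1 (t - complex.Re z))%E.
  apply: emeasurable_sum => z; apply: (measurableT_comp (measurable_sg _)).
  exact: measurable_funB.
have sum0 t : (0 <= \sum_(z <- rs) sg 2^-1 (t - complex.Re z))%E.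
  by apply: sume_ge0 => z _; exact: sg_ge0.
exists b; split.
- by move=> t; rewrite mule_ge0 ?lee_fin// adde_ge0.
- apply: measurable_funTS; apply: measurable_funeM; apply: emeasurable_funD => //.
- move=> t ts.
  apply: (@le_trans _ _ (sg e (c / 2 * (wpoly k (r^~ y)).[t]))).
    by apply: sg_le; [exact: ltW|exact: wdata_lower].
  rewrite sgM ?mulf_neq0 ?invr_eq0//; apply: lee_wpmul2l; first by rewrite lee_fin.
  have : (sg e (wpoly k (r^~ y)).[t] <= sg e (\prod_(x <- [seq normc (t%:C%C - z)%R | z <- rs]) x))%E.
    apply: sg_le; first exact: ltW.
    by rewrite (norm_horner_roots t Ers) big_map ger0_norm ?prodr_ge0// => z _; exact: normc_ge0.
  move=> /le_trans; apply.
  apply: le_trans (sg_prod (ltW e0) _ _) _.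
  + rewrite size_map srs /e invfM mulrCA ler_piMr ?invr_ge0//.
    by rewrite ler_pdivrMr// mul1r ler_nat.
  + move=> x /mapP[z zr ->]; rewrite normc_ge0 /=.
    apply: le_trans (le_normcD _ _) _; rewrite normcN normc_toC.
    by have := rsz z zr; move: ts s1; lra.
  + rewrite big_map leeD2l//; apply: lee_sum => z _; apply: sg_le; first by rewrite invr_ge0.
    case: z => x1 x2 /=; have [h _] := normc_ge_abs (t - x1) (0 - x2).
    by rewrite [leRHS]ger0_norm ?normc_ge0.
- rewrite /b ge0_integralZl//; last 2 first.
  + by apply: measurable_funTS; apply: emeasurable_funD.
  + by move=> t _; rewrite adde_ge0.
  rewrite EFinM; apply: lee_wpmul2l; first by rewrite lee_fin.
  rewrite ge0_integralD//; last exact: measurable_funTS.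
  rewrite EFinD; apply: leeD.
    rewrite integral_cst//= mul1e lebesgue_measure_itv /=; case: ifP => _; last by rewrite lee_fin.
    by rewrite -EFinD lee_fin; move: s1; lra.
  under eq_integral => t _ do rewrite -(big_map (@complex.Re R) xpredT (fun x => sg 2^-1 (t - x))).
  rewrite -srs -(size_map (@complex.Re R)); apply: integral_sum_sg => // x /mapP[z zr ->]; have := rsz z zr; case: z {zr} => x1 x2 h; rewrite [complex.Re _]/=.
  by have [h1 _] := normc_ge_abs x1 x2; apply: le_trans h1 _; move: s1 h; lra.
Qed.

End Lines.
End Wdata.

Section SgIntegrable.
Context {R : realType}.
Local Notation mu := (@lebesgue_measure R).
Local Notation TR := (measurableTypeR R).

Lemma An_continuous_row n (rho : R) F M (x : 'rV[R]_n) : An (fun=> rho) F M -> `|x| < rho ->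
  {for x, continuous (fun x : 'rV[R]_n => F (fun i => x ord0 i))}.
Proof.
move=> HF xr.
have r0 : 0 < rho by apply: le_lt_trans xr.
have in_poly (y : 'rV[R]_n) : `|y| < rho -> polyd (fun=> rho) (fun i => y ord0 i).
  by move=> /(norm_rowP _ r0) yr i; apply/ltW.
rewrite /prop_for /continuous_at.
apply/(@cvgrPdist_le _ _ _ (nbhs x) (nbhs_filter x)) => e e0.
have [d d0 Hd] := An_cont HF (in_poly _ xr) e0.
have m0 : 0 < Num.min d (rho - `|x|) by rewrite lt_min d0 subr_gt0.
near=> y.
have /= xy : `|x - y| < Num.min d (rho - `|x|) by near: y; apply/nbhs_ballP; exists (Num.min d (rho - `|x|)) => //= y; rewrite -ball_normE.
move: xy; rewrite lt_min => /andP[xy1 xy2].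
apply: Hd.
  apply: in_poly; have := ler_normB x (x - y); rewrite opprB addrCA subrr addr0; lra.
move=> i; have /(norm_rowP _ d0)/(_ i) := xy1; rewrite !mxE; exact: ltW.
Unshelve. all: by end_near. Qed.

Lemma open_norm_lt n (rho : R) : open [set x : 'rV[R]_n | `|x| < rho].
Proof.
rewrite (_ : [set x | _] = ball (0 : 'rV[R]_n) rho); last first.
  by apply/seteqP; split => x /=; rewrite -ball_normE /= sub0r normrN.
have [r0|r0] := ltP 0 rho; first exact: ball_open.
rewrite (_ : ball _ _ = set0); first exact: open0.
apply/seteqP; split => // x; rewrite -ball_normE /= => h.
by have := le_lt_trans (normr_ge0 _) h; rewrite ltNge r0.
Qed.

Lemma measurable_An_tuple n (rho d : R) F M : 0 < rho -> An (fun=> rho) F M -> d < rho ->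
  measurable_fun (@tbox R n d) (fun u : n.-tuple R => F (tnth u)).
Proof.
move=> r0 HF dr.
have h := measurable_continuous_row (@open_norm_lt n rho) (fun x => @An_continuous_row n rho F M x HF).
have -> : (fun u : n.-tuple R => F (tnth u)) =
   (fun x : 'rV[R]_n => F (fun i => x ord0 i)) \o @row_of_tuple R n.
  by apply/funext => u /=; congr F; apply/funext => i; rewrite tnth_row.
apply: measurable_funS h.
  by apply: measurable_open_row; exact: open_norm_lt.
move=> u Hu /=; apply/norm_rowP => // i; rewrite tnth_row; exact: le_lt_trans (Hu i) dr.
Qed.

(* The line through [0] with direction [(1, a)] is not contained in the zero set of [F]. *)
Definition good_dir n (F : ('I_n.+1 -> R) -> R) (rho : R) (a : 'I_n -> R) (s0 r0 t0 : R) :=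
  [/\ `|t0| < s0, s0 <= rho, 0 < r0, (forall j, r0 + `|a j| * s0 <= rho) &
      F (shr a t0 (fun=> 0)) != 0].

(** The line from [0] to [x] works once its first coordinate is nonzero, since that coordinate is
    the parameter [t]; if it vanishes, a small perturbation by continuity repairs it. *)
Lemma good_dir_exists n (rho : R) F M (x : 'I_n.+1 -> R) : 0 < rho -> An (fun=> rho) F M ->
  inner (fun=> rho) x -> F x != 0 ->
  exists a s0 r0 t0, good_dir F rho a s0 r0 t0.
Proof.
move=> rho0 HF ix Fx.
have {x ix Fx} [x [d d0 Hd] [x0 Fx]] : exists2 x, inner (fun=> rho) x & x ord0 != 0 /\ F x != 0.
  have [x0|] := eqVneq (x ord0) 0; last by exists x.
  have [d d0 Hd] := ix.
  have F2 : 0 < `|F x| / 2 by rewrite divr_gt0// normr_gt0.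
  have [e e0 He] := An_cont HF (inner_polyd ix) F2.
  pose m := Num.min e (d / 2).
  have m0 : 0 < m by rewrite lt_min e0 divr_gt0.
  have md : m <= d / 2 by rewrite ge_min lexx orbT.
  pose x' i := if i == ord0 then m else x i.
  have ix' : inner (fun=> rho) x'.
    exists (d / 2); first by rewrite divr_gt0.
    move=> i; rewrite /x'; case: eqP => [_|_]; last by have := Hd i; lra.
    by rewrite gtr0_norm//; have := Hd ord0; have := normr_ge0 (x ord0); lra.
  exists x' => //; split; first by rewrite /x' eqxx gt_eqF.
  have : `|F x - F x'| <= `|F x| / 2.
    apply: He; first exact: inner_polyd.
    move=> i; rewrite /x'; case: eqP => [->|_]; last by rewrite subrr normr0 ltW.
    by rewrite x0 sub0r normrN gtr0_norm// ge_min lexx.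
  apply: contraTneq => ->; rewrite subr0 -ltNge; move: F2; lra.
set t0 := x ord0 in x0.
(* The interval of [t] must reach strictly beyond [t0]. Lengthening by the factor [1 + tau] uses
   half of the margin [d]; the other half is the radius left for [y]. *)
pose tau := d / (2 * rho).
have tau0 : 0 < tau by rewrite divr_gt0// mulr_gt0.
have bnd i : `|x i| * (1 + tau) <= rho - d / 2.
  apply: (@le_trans _ _ ((rho - d) * (1 + tau))).
    by rewrite ler_wpM2r//; have := Hd i; lra.
  rewrite mulrDr mulr1 mulrBl (_ : rho * tau = d / 2); last by rewrite /tau; field; rewrite gt_eqF.
  have : 0 < d * tau by rewrite mulr_gt0.
  lra.
exists (fun j => x (lift ord0 j) / t0), (`|t0| * (1 + tau)), (d / 2), t0; split.
- by rewrite ltr_pMr ?normr_gt0// ltrDl.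
- by have := bnd ord0; rewrite -/t0; lra.
- by rewrite divr_gt0.
- move=> j; rewrite normrM normfV mulrA mulfVK ?normr_eq0//.
  by have := bnd (lift ord0 j); lra.
- rewrite (_ : shr _ _ _ = x)//; apply/funext => i; case: (unliftP ord0 i) => [j|] ->.
    by rewrite shrS add0r mulfVK.
  by rewrite shr0.
Qed.

(** Good directions form an open set, which is how enough of them are found to span the space. *)
Lemma good_dir_near n (rho : R) F M (a : 'I_n -> R) s0 r0 t0 : An (fun=> rho) F M ->
  good_dir F rho a s0 r0 t0 -> exists2 eta, 0 < eta & forall a',
    (forall j, `|a j - a' j| <= eta) -> good_dir F rho a' s0 (r0 / 2) t0.
Proof.
move=> HF [ts sr r00 ar Ft].
have s00 : 0 < s0 by apply: le_lt_trans ts.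
have pa (a' : 'I_n -> R) : (forall j, `|a' j| * s0 <= rho) -> polyd (fun=> rho) (shr a' t0 (fun=> 0)).
  move=> h i; case: (unliftP ord0 i) => [j|] ->; last by rewrite shr0; lra.
  rewrite shrS add0r normrM; apply: le_trans (h j); rewrite ler_wpM2l// ltW//.
have F2 : 0 < `|F (shr a t0 (fun=> 0))| / 2 by rewrite divr_gt0// normr_gt0.
have pa0 : polyd (fun=> rho) (shr a t0 (fun=> 0)).
  by apply: pa => j; have := ar j; lra.
have [d d0 Hd] := An_cont HF pa0 F2.
pose eta := Num.min (r0 / 2) d / s0.
have eta0 : 0 < eta by rewrite divr_gt0// lt_min d0 divr_gt0.
exists eta => // a' aa'.
have es j : `|a j - a' j| * s0 <= Num.min (r0 / 2) d by rewrite -ler_pdivlMr.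
have ar' j : r0 / 2 + `|a' j| * s0 <= rho.
  have h1 : `|a' j| <= `|a j| + `|a j - a' j|.
    by have := ler_normB (a j) (a j - a' j); rewrite opprB addrCA subrr addr0.
  have h2 : `|a' j| * s0 <= `|a j| * s0 + `|a j - a' j| * s0.
    by rewrite -mulrDl ler_wpM2r// ltW.
  have h3 : `|a j - a' j| * s0 <= r0 / 2 by apply: le_trans (es j) _; rewrite ge_min lexx.
  by have := ar j; lra.
split => //; first by rewrite divr_gt0.
have : `|F (shr a t0 (fun=> 0)) - F (shr a' t0 (fun=> 0))| <= `|F (shr a t0 (fun=> 0))| / 2.
  apply: Hd; first by apply: pa => j; have := ar' j; lra.
  move=> i; case: (unliftP ord0 i) => [j|] ->; last by rewrite !shr0 subrr normr0 ltW.
  rewrite !shrS !add0r -mulrBl normrM.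
  apply: (@le_trans _ _ (`|a j - a' j| * s0)); first by rewrite ler_wpM2l// ltW.
  by apply: le_trans (es j) _; rewrite ge_min lexx orbT.
apply: contraTneq => ->; rewrite subr0 -ltNge; move: F2; lra.
Qed.

Lemma small_radius n (a : 'I_n -> R) (r : R) : 0 < r ->
  exists2 d, 0 < d & forall d', d' <= d -> forall j, 0 <= d' -> d' + `|a j| * d' <= r.
Proof.
move=> r0; pose A := 1 + \sum_j `|a j|.
have A0 : 0 < A by rewrite ltr_pwDl// sumr_ge0.
exists (r / A); first by rewrite divr_gt0.
move=> d' dd j d0.
have : `|a j| <= \sum_j `|a j| by rewrite (bigD1 j)//= lerDl sumr_ge0.
move=> aj; rewrite -{1}(mul1r d') -mulrDl.
apply: (@le_trans _ _ (A * d')); first by rewrite ler_wpM2r// /A lerD2l.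
by rewrite mulrC -ler_pdivlMr.
Qed.

(** The integral on each line is bounded by a constant independent of [y], so Tonelli on a box of
    finite measure concludes. It is applied to [f] and again to [E]. *)
Lemma sg_integrable n (rho : R) F M (x : 'I_n.+1 -> R) : 0 < rho -> An (fun=> rho) F M ->
  inner (fun=> rho) x -> F x != 0 ->
  exists d e, [/\ 0 < d, d < rho, 0 < e < 1 &
    (\int[lebM n.+1]_(u in tbox d) sg e (F (tnth u)) < +oo)%E].
Proof.
move=> rho0 HF ix Fx.
have [a [s0 [r0 [t0 [ts sr r00 ar Ft]]]]] := good_dir_exists rho0 HF ix Fx.
have [k [c [s [r1 [Q [r [W ss1 _]]]]]]] := wdata_exists r00 sr ar HF ts Ft (ltr01 : 0 < (1 : R)) ltr01.
have [K [K0 HK]] := line_sg_bound W.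
case: (W) => -[_ s_gt0 s12 r10] _.
have [d0 d00 Hd0] := small_radius a r10.
pose d := Num.min (Num.min d0 s) (rho / 2).
have dd0 : d <= d0 by rewrite !ge_min lexx.
have ds : d <= s by rewrite !ge_min lexx orbT.
have dr : d <= rho / 2 by rewrite ge_min lexx orbT.
have d_gt0 : 0 < d by rewrite !lt_min d00 s_gt0 divr_gt0.
have e0 : 0 < (2 * k.+1%:R : R)^-1 by rewrite invr_gt0 mulr_gt0.
exists d, (2 * k.+1%:R)^-1; split => //.
- lra.
- rewrite e0 /= invf_lt1 ?mulr_gt0//.
  by rewrite (lt_le_trans (ltr1n _ 2 : 1 < 2))// ler_peMr// ler1n.
apply: (@le_lt_trans _ _ (\int[lebM n]_(y in tbox r1) (cst K%:E) y)%E).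
  apply: (@shear_bound _ n a d s r1) => //.
  - by move=> j; apply: Hd0 => //; exact: ltW.
  - by move=> u; exact: sg_ge0.
  - apply: measurableT_comp; first exact: measurable_sg.
    by apply: (measurable_An_tuple rho0 HF); lra.
  move=> y Hy; have [b [b0 mb hb ib]] := HK (tnth y) Hy.
  by exists b; split => // t ts' _; rewrite tnth_shear; exact: hb.
rewrite integral_cst//; last exact: measurable_tbox.
by rewrite lte_mul_pinfty// ?lee_fin//; exact: lebM_tbox.
Qed.

End SgIntegrable.

(** * Gradient bounds on lines *)

Section Derive1.
Context {R : realType}.

Lemma is_derive_quadratic (V : normedModType R) (f : V -> R) (x v : V) (g K eta : R) : 0 < eta ->
  (forall h, `|h| <= eta -> `|f (x + h *: v) - f x - h * g| <= K * h ^+ 2) ->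
  is_derive x v f g.
Proof.
move=> e0 H.
have cv : (fun h => h^-1 *: ((f \o shift x) (h *: v) - f x)) @ 0^' --> (g : R^o).
  apply/cvgrPdist_le => e e_gt0.
  have K1 : 0 < `|K| + 1 by rewrite ltr_wpDl.
  near=> h.
  have h0 : h != 0 by near: h; exact: nbhs_dnbhs_neq.
  have he : `|h| < Num.min eta (e / (`|K| + 1)).
    near: h; apply: dnbhs0_lt; by rewrite lt_min e0 divr_gt0.
  move: he; rewrite lt_min => /andP[he1 he2].
  rewrite /= [h *: v + x]addrC.
  have {}H := H h (ltW he1).
  have -> : g - h^-1 *: (f (x + h *: v) - f x) = - (h^-1 * (f (x + h *: v) - f x - h * g)).
    by rewrite /GRing.scale /=; field.
  rewrite normrN normrM normfV ler_pdivrMl ?normr_gt0//.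
  apply: le_trans H _; rewrite -[h ^+ 2]ger0_norm ?sqr_ge0// normrX expr2 mulrCA ler_wpM2l//.
  apply: (@le_trans _ _ ((`|K| + 1) * `|h|)).
    by rewrite ler_wpM2r//; have := ler_norm K; lra.
  by rewrite mulrC -ler_pdivlMr// ltW.
apply: DeriveDef; first by apply/cvg_ex; exists g.
exact: cvg_lim cv.
Unshelve. all: by end_near. Qed.

End Derive1.

Section Discriminant.
Context {R : realType}.
Local Notation mu := (@lebesgue_measure R).
Local Notation TR := (measurableTypeR R).
Variables (n : nat) (F : ('I_n.+1 -> R) -> R) (a : 'I_n -> R) (k : nat) (c s r1 : R).
Variables (Q : (option 'I_n -> R) -> R) (r : nat -> ('I_n -> R) -> R).
Hypothesis W : wdata F a k c s r1 Q r.
Local Notation P y := (wpoly k (r^~ y)).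
Local Notation toC := (real_complex R).

(* [E] is the lowest coefficient of [selfres] that does not vanish identically. *)
Lemma discriminant_exists : exists E N, [/\ An (fun=> r1) E N,
  (exists2 y, inner (fun=> r1) y & E y != 0) &
  forall y z, inner (fun=> r1) y -> root (map_poly toC (P y)) z ->
    complex.Im z != 0 -> `|E y| <= 2 * `|complex.Im z|].
Proof.
case: (W) => -[c0 s0 s1 r10] [_ _ Hr _ _].
have in0 : inner (V := 'I_n) (fun=> r1) (fun=> 0).
  by exists r1 => // v; rewrite normr0 add0r.
(* For [k = 0] the polynomial is [1] and has no root, so the constant [1] serves as [E]. *)
case: (posnP k) => [k0|].
  exists (fun=> 1), `|1|; split; first exact: An_const.
    by exists (fun=> 0).
  move=> y z _; rewrite k0 /wpoly big_ord0 addr0 expr0 rmorph1 => /rootP.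
  by rewrite hornerC => /eqP; rewrite oner_eq0.
move=> kpos; case: k kpos W => // k' _ W'.
pose p y := wpoly k'.+1 (r^~ y).
have pA : Anp (fun=> r1) (fun y => selfres k' (p y)).
  by apply: Anp_selfres; exact: Anp_wpoly.
have roots y : polyd (fun=> r1) y -> exists rs : seq R[i], [/\ size rs = k'.+1,
   map_poly toC (p y) = \prod_(z <- rs) ('X - z%:P) & forall w, w \in rs -> normc w <= 2^-1].
  move=> hy; have [rs srs Ers] := real_poly_roots (wpoly_monic k'.+1 (r^~ y)) (size_wpoly k'.+1 (r^~ y)).
  exists rs; split => // w wr; apply: (@le_trans _ _ s) => //; apply: ltW.
  by apply: (wdata_root W' hy); rewrite Ers root_prod_XsubC.
pose nz e := exists2 y, inner (fun=> r1) y & (selfres k' (p y))`_e != 0.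
have ex : exists e, `[< nz e >].
  have [rs [srs Ers _]] := roots _ (inner_polyd in0).
  have S : map_poly toC (selfres k' (p (fun=> 0))) =
      \prod_(x <- [seq w - v | v <- rs, w <- rs]) ('X + x%:P).
    by rewrite map_selfres Ers selfres_prod// big_allpairs_dep.
  (* The polynomial of differences is monic, so its leading coefficient is a coefficient that does
     not vanish identically. *)
  exists (size [seq w - v | v <- rs, w <- rs]); apply/asboolP; exists (fun=> 0) => //.
  have : (map_poly toC (selfres k' (p (fun=> 0))))`_(size [seq w - v | v <- rs, w <- rs]) = 1.
    rewrite S (eq_bigr (fun x => 'X - (- x)%:P)) => [|x _]; last by rewrite polyCN opprK.
    rewrite -(big_map (fun x : R[i] => - x) xpredT (fun x => 'X - x%:P)).
    set l := map _ _; have := monicP (monic_prod_XsubC l xpredT id).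
    by rewrite lead_coefE size_prod_XsubC /= size_map.
  by rewrite coef_map /=; apply: contra_eq_neq => ->; rewrite rmorph0 eq_sym oner_eq0.
case: (ex_minnP ex) => e /asboolP nze emin.
have [N HN] := pA e.
exists (fun y => (selfres k' (p y))`_e), N; split => //.
move=> y z iy zr z0.
have [rs [srs Ers rs1]] := roots _ (inner_polyd iy).
apply: (selfres_Im_bound Ers srs rs1) => //; last first.
  by rewrite -root_prod_XsubC -Ers.
move=> j je; apply: contrapT => /eqP nzj.
have /emin : `[< nz j >] by apply/asboolP; exists y.
by rewrite leqNgt je.
Qed.

Variable (E : ('I_n -> R) -> R).
Hypothesis Im_bound : forall y z, inner (fun=> r1) y -> root (map_poly toC (P y)) z ->
    complex.Im z != 0 -> `|E y| <= 2 * `|complex.Im z|.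
Hypothesis no_root : forall y t, inner (fun=> r1) y -> E y != 0 -> `|t| < s -> (P y).[t] != 0.

Lemma wdata_F_neq0 y t : inner (fun=> r1) y -> E y != 0 -> `|t| < s -> F (shr a t y) != 0.
Proof.
move=> iy Ey ts; have hP := no_root iy Ey ts.
case: W => -[c0 _ _ _] [_ _ _ _ /(_ t y (ltW ts) (inner_polyd iy)) e].
by apply: contra_eq_neq e => ->; rewrite mulr0 eq_sym mulf_neq0.
Qed.

(** Differentiating [Q F = c P] in [t] gives [F' / F = P' / P - Q' / Q]; the last term is bounded
    and the first is controlled by the distances to the roots. *)
Lemma line_grad_bound (e : R) : 0 < e < 1 ->
  exists A B : R, [/\ 0 <= A, 0 < B & forall y, inner (fun=> r1) y ->
  exists b : R -> \bar R, [/\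
     (forall t, 0 <= b t)%E, measurable_fun (`[- (s / 2), s / 2]%classic : set R) b,
     (forall t D, `|t| <= s / 2 -> is_derive t (1 : R) (fun t => F (shr a t y)) D ->
        (`|D / F (shr a t y)|%:E <= b t)%E) &
     (\int[mu]_(t in `[(- (s / 2))%R, (s / 2)%R]) b t <= A%:E + B%:E * sg e (E y))%E]].
Proof.
move=> he; have /andP[e0 e1] := he.
have he' : 0 < 1 - e < 1 by apply/andP; split; lra.
have [C HC] := integral_sg he'.
have C0 : 0 <= C.
  rewrite -lee_fin; apply: le_trans (HC 0 _); last by rewrite normr0 invr_ge0.
  by apply: integral_ge0 => t _; exact: sg_ge0.
case: (W) => -[c0 s0 s1 r10] [HQ _ _ _ WE].
have s20 : 0 < s / 2 by rewrite divr_gt0.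
have r'0 (v : option 'I_n) : 0 <= ocons (s / 2) (fun=> r1) v by case: v => [j|] /=; apply: ltW.
have [|G [HG [K HK]]] := @An_deriv R _ (ocons s (fun=> r1)) (ocons (s / 2) (fun=> r1))
   (ocons 1 (fun=> 0)) (s / 2) Q 2 s20 r'0 _ HQ.
  by case=> [j|] /=; rewrite ?normr0 ?normr1; lra.
(* [|Q'|] is at most [2 / (s / 2)] and [Q >= 1/2], so [Q' / Q] is at most [8 / s] on an interval of
   length [s]. The added [1] keeps the factor of [sg e (E y)] positive, so that the bound is [+oo]
   where [E y = 0]. *)
exists 8, (k%:R * C * (2^-1 `^ (- e)) + 1); split => //.
  by rewrite ltr_wpDl// !mulr_ge0// powR_ge0.
move=> y iy; have hy := inner_polyd iy.
have [Ey0|Ey] := eqVneq (E y) 0.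
  exists (cst +oo%E); split => //; do ?by move=> *; rewrite leey.
  rewrite Ey0 /sg eqxx gt0_muley ?addey// ?leey//.
  by rewrite lte_fin ltr_wpDl// !mulr_ge0// powR_ge0.
have [rs srs Ers] := real_poly_roots (wpoly_monic k (r^~ y)) (size_wpoly k (r^~ y)).
have rsz z : z \in rs -> normc z < s.
  by move=> zr; apply: (wdata_root W hy); rewrite Ers root_prod_XsubC.
(* A real root would lie in the open interval of radius [s], where [no_root] forbids it. *)
have rsI z : z \in rs -> complex.Im z != 0.
  move=> zr; case: z zr => x1 x2 zr /=; apply/eqP => x20; rewrite x20 in zr.
  have zn := rsz _ zr; have [h1 _] := normc_ge_abs x1 0.
  have := no_root iy Ey (le_lt_trans h1 zn); rewrite -normr_gt0 (norm_horner_roots x1 Ers).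
  rewrite (perm_big _ (perm_to_rem zr)) big_cons.
  set q := normc _; have -> : q = 0 by rewrite /q -[(x1 +i* 0)%C]/(x1%:C)%C subrr normc0.
  by rewrite [X in _ < X](mul0r _) ltxx.
have rsE z : z \in rs -> `|E y| / 2 <= `|complex.Im z|.
  move=> zr; have := Im_bound iy _ (rsI z zr); rewrite Ers root_prod_XsubC => /(_ zr); lra.
have E2 : 0 < `|E y| / 2 by rewrite divr_gt0// normr_gt0.
pose kap := (`|E y| / 2) `^ (- e).
have kap0 : 0 < kap by apply: powR_gt0.
pose b t := ((8 / s)%:E + kap%:E * \sum_(z <- rs) sg (1 - e) (t - complex.Re z))%E.
have msg z : measurable_fun (setT : set TR) (fun t => sg (1 - e) (t - complex.Re z)).
  by apply: (measurableT_comp (measurable_sg _)); exact: measurable_funB.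
have msum : measurable_fun (setT : set TR) (fun t => \sum_(z <- rs) sg (1 - e) (t - complex.Re z))%E.
  by apply: emeasurable_sum => z; exact: msg.
have sum0 t : (0 <= \sum_(z <- rs) sg (1 - e) (t - complex.Re z))%E.
  by apply: sume_ge0 => z _; exact: sg_ge0.
have s80 : 0 <= 8 / s by rewrite divr_ge0// ltW.
exists b; split.
- by move=> t; rewrite adde_ge0 ?lee_fin// mule_ge0 ?lee_fin// ltW.
- apply: measurable_funTS; apply: emeasurable_funD => //; exact: measurable_funeM.
- move=> t D ts dF.
  have ts' : `|t| < s by move: ts s0; lra.
  have F0 := wdata_F_neq0 iy Ey ts'; have P0 := no_root iy Ey ts'.
  have /andP[q1 q2] := wdata_Q W (ltW ts') hy.
  have dQ : is_derive t (1 : R) (fun t => Q (ocons t y)) (G (ocons t y)).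
    apply: (@is_derive_quadratic _ _ _ t 1 _ K (s / 2)) => // h hs.
    have := HK (ocons t y) h; rewrite (_ : (fun v => _) = ocons (t + h *: 1) y); last first.
      by apply/funext => -[j|] /=; rewrite ?mulr0 ?addr0// /GRing.scale.
    by apply => //; apply: polyd_ocons.
  have dprod := is_deriveM dQ dF.
  have dP : is_derive t (1 : R) ((fun t => Q (ocons t y)) * (fun t => F (shr a t y)))
      (c * (P y)^`().[t]).
    have : is_derive t (1 : R) (c *: horner (P y)) (c *: (P y)^`().[t]).
      have dh : is_derive t (1 : R) (horner (P y)) (P y)^`().[t].
        by apply: DeriveDef; [exact: derivable_horner|rewrite -derive1E derivE].
      exact: is_deriveZ.
    apply: near_eq_is_derive.
    near=> u; apply/esym; apply: WE => //; apply/ltW.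
    near: u; apply/nbhs_ballP; exists (s - `|t|); first by rewrite /= subr_gt0.
    by move=> u; rewrite /ball /= => tu; have := ler_normB t (t - u); rewrite subKr; lra.
  have EQ : Q (ocons t y) * D + F (shr a t y) * G (ocons t y) = c * (P y)^`().[t].
    by rewrite -(@derive_val _ _ _ _ _ _ _ dP) (@derive_val _ _ _ _ _ _ _ dprod).
  have WEt := WE t y (ltW ts') hy.
  have -> : D / F (shr a t y) = (P y)^`().[t] / (P y).[t] - G (ocons t y) / Q (ocons t y).
    have Q0 : Q (ocons t y) != 0 by rewrite gt_eqF//; lra.
    have -> : (P y)^`().[t] / (P y).[t] = c * (P y)^`().[t] / (Q (ocons t y) * F (shr a t y)).
      by rewrite WEt; field; rewrite c0 P0.
    by rewrite -EQ; field; rewrite Q0 F0.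
  apply: (@le_trans _ _ (`|(P y)^`().[t] / (P y).[t]| + `|G (ocons t y) / Q (ocons t y)|)%:E).
    by rewrite lee_fin ler_normB.
  rewrite EFinD addeC; apply: leeD.
    rewrite lee_fin normrM normfV ler_pdivrMr; last by rewrite gtr0_norm; lra.
    have : `|G (ocons t y)| <= 2 / (s / 2) by apply: An_bound HG _; apply: polyd_ocons.
    rewrite [`|Q _|]gtr0_norm; last lra.
    move=> /le_trans; apply; rewrite (_ : 2 / (s / 2) = 8 / s * 2^-1); last by field; rewrite gt_eqF.
    by rewrite ler_wpM2l.
  apply: (@le_trans _ _ (\sum_(z <- rs) ((normc (t%:C%C - z)%R)^-1)%:E)%E).
    rewrite sumEFin lee_fin normrM normfV ler_pdivrMr ?normr_gt0// mulrC.
    exact: norm_deriv_roots.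
  rewrite ge0_sume_distrr; last by move=> z _; exact: sg_ge0.
  rewrite big_seq [leRHS]big_seq; apply: lee_sum => z zr.
  have [->|tz] := eqVneq (t - complex.Re z) 0.
    by rewrite /sg eqxx gt0_muley ?lte_fin// leey.
  rewrite sg_fin// -EFinM lee_fin.
  have [h1 h2] : `|t - complex.Re z| <= normc (t%:C%C - z)%R /\ `|complex.Im z| <= normc (t%:C%C - z)%R.
    case: z {zr tz} => x1 x2; have [h1 h2] := normc_ge_abs (t - x1) (0 - x2).
    by split=> //=; apply: le_trans h2; rewrite sub0r normrN.
  have m0 : 0 < normc (t%:C%C - z)%R by apply: lt_le_trans h1; rewrite normr_gt0.
  (* The power [-e] of [|t - z|] is estimated through [|Im z| >= |E y| / 2], the power [-(1 - e)]
     through [|t - Re z|]. *)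
  rewrite -[X in X^-1]powRr1 ?(ltW m0)// -powRN (_ : -1 = - e + - (1 - e)); last by ring.
  rewrite powRD; last by rewrite (gt_eqF m0) implybT.
  apply: ler_pM; rewrite ?powR_ge0//.
    rewrite /kap !powRN lef_pV2 ?posrE ?powR_gt0//; apply: ge0_ler_powR; rewrite ?nnegrE ?(ltW e0) ?(ltW E2) ?(ltW m0)//.
    by apply: le_trans h2; exact: rsE.
  rewrite !powRN lef_pV2 ?posrE ?powR_gt0 ?normr_gt0//; apply: ge0_ler_powR; rewrite ?nnegrE ?(ltW m0)//.
  by rewrite subr_ge0 ltW.
- rewrite /b ge0_integralD//; last 2 first.
  + by move=> t _; rewrite mule_ge0 ?lee_fin// ltW.
  + by apply: measurable_funTS; exact: measurable_funeM.
  apply: leeD.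
    rewrite integral_cst//= lebesgue_measure_itv /=; case: ifP => _; last by rewrite mule0 lee_fin.
    by rewrite -EFinD -EFinM lee_fin; rewrite (_ : _ * _ = 8)//; field; rewrite gt_eqF.
  rewrite ge0_integralZl//; last 2 first.
  + exact: measurable_funTS.
  + by rewrite lee_fin ltW.
  have -> : (kap%:E = (2^-1 `^ (- e))%:E * sg e (E y))%E.
    by rewrite sg_fin// -EFinM; congr EFin; rewrite /kap mulrC powRM.
  have -> : ((k%:R * C * 2^-1 `^ (- e) + 1)%:E * sg e (E y) =
      ((2^-1 `^ (- e))%:E * sg e (E y)) * (k%:R * C)%:E + sg e (E y))%E.
    by rewrite sg_fin// -!EFinM -EFinD; congr EFin; ring.
  apply: le_trans (leeDl _ (sg_ge0 _ _)); apply: lee_wpmul2l.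
    by rewrite mule_ge0 ?sg_ge0// lee_fin powR_ge0.
  under eq_integral => t _ do rewrite -(big_map (@complex.Re R) xpredT (fun x => sg (1 - e) (t - x))).
  rewrite -srs -(size_map (@complex.Re R)); apply: integral_sum_sg => //; first by move: s1 s0; lra.
  move=> x /mapP[z zr ->]; have := rsz z zr; case: z {zr} => x1 x2 h; rewrite [complex.Re _]/=.
  by have [h1 _] := normc_ge_abs x1 x2; apply: le_trans h1 _; move: s1 h; lra.
Unshelve. all: by end_near. Qed.

End Discriminant.

(** * Analytic functions and directional derivatives *)

Section AnalyticAn.
Context {R : realType}.

Lemma sumle_series (u : nat -> R) : (forall k, 0 <= u k) -> cvgn (series u) ->
  sumle u (limn (series u)).
Proof.
move=> u0 cu J uJ.
have nd : {homo series u : n m / (n <= m)%N >-> n <= m}.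
  by apply/nondecreasing_seqP => k; rewrite /series /= big_nat_recr//= lerDl.
apply: le_trans (nondecreasing_cvgn_le nd cu (\max_(i <- J) i).+1).
rewrite /series /= /index_iota subn0 (@sum_subset _ _ u J); last 3 first.
- by [].
- exact: iota_uniq.
- by move=> x xJ; rewrite mem_iota /= add0n ltnS leq_bigmax_seq.
rewrite (eq_bigr u) => [|i _]; last by rewrite ger0_norm.
by rewrite lerDl sumr_ge0.
Qed.

Definition word n (al : 'I_n -> nat) : seq 'I_n := flatten [seq nseq (al i) i | i <- enum 'I_n].

Lemma mono_word n (al : 'I_n -> nat) (x : 'I_n -> R) : mono x (word al) = \prod_i x i ^+ al i.
Proof.
rewrite /mono /word big_flatten big_map big_enum /=; apply: eq_bigr => i _.
by rewrite big_nseq iter_mulr_1.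
Qed.

(** Absolute convergence at the corner of the polydisc of radius [r / 2] bounds the series on all of
    it; half of [r] is taken because convergence is given for [|x - a| < r] only. *)
Lemma analytic_An n (f : 'rV[R]_n -> R) (a : 'rV[R]_n) : analytic_at f a ->
  exists rho M, 0 < rho /\ An (fun=> rho) (fun z : 'I_n -> R => f (a + \row_i z i)) M.
Proof.
move=> [c [r [r0 H]]]; have r20 : 0 < r / 2 by rewrite divr_gt0.
pose K k : choiceType := {ffun 'I_n -> 'I_k.+1}.
(* A multi-index occurs in [K k] for every large [k]; only the copy with [k] equal to its degree
   gets a coefficient. *)
pose C (j : {k & K k}) : R := if (\sum_(i < n) (tagged j i : nat))%N == tag j
  then c (fun i => tagged j i : nat) else 0.
pose w (j : {k & K k}) := word (fun i => tagged j i : nat).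
have nx (x : 'I_n -> R) : polyd (fun=> r / 2) x -> `|(a + \row_i x i) - a| < r.
  move=> hx; rewrite addrC addKr; apply/norm_rowP => // i; rewrite mxE.
  by apply: le_lt_trans (hx i) _; rewrite ltr_pdivrMr// ltr_pMr// ltr1n.
have monoE (x : 'I_n -> R) (j : {k & K k}) :
    mono x (w j) = monomial a (a + \row_i x i) (fun i => tagged j i : nat).
  rewrite mono_word /monomial; apply: eq_bigr => i _; congr (_ ^+ _).
  by rewrite !mxE (addrC (a _ _)) addrK.
have hp (x : 'I_n -> R) k : homog_part c a (a + \row_i x i) k =
    \sum_(al : K k) C (Tagged K al) * mono x (w (Tagged K al)).
  rewrite /homog_part big_mkcond; apply: eq_bigr => al _.
  by rewrite monoE /C /=; case: ifP => // _; rewrite mul0r.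
have hpa (x : 'I_n -> R) k : homog_part_abs c a (a + \row_i x i) k =
    \sum_(al : K k) `|C (Tagged K al) * mono x (w (Tagged K al))|.
  rewrite /homog_part_abs big_mkcond; apply: eq_bigr => al _.
  by rewrite monoE /C /=; case: ifP => // _; rewrite mul0r normr0.
have p0 : polyd (V := 'I_n) (fun=> r / 2) (fun=> r / 2) by move=> i; rewrite ger0_norm// ltW.
pose x0 : 'I_n -> R := fun=> r / 2.
have sM : sumle (fun j => C j * mono x0 (w j))
    (limn (series (homog_part_abs c a (a + \row_i x0 i)))).
  apply: (@sumle_sigma _ _ _ _ (homog_part_abs c a (a + \row_i x0 i))).
    by move=> k; rewrite hpa; exact: sumle_fin.
  apply: sumle_series; last by have [] := H _ (nx _ p0).
  by move=> k; rewrite /homog_part_abs sumr_ge0.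
exists (r / 2), (limn (series (homog_part_abs c a (a + \row_i x0 i)))).
split => //; exists {k & K k}, C, w; split => // x hx.
have [T hT] : exists T, hassum (fun j => C j * mono x (w j)) T.
  by apply: sumle_hassum (sumle_le _ (lexx _) sM) => j; exact: term_le.
have hk : hassum (homog_part c a (a + \row_i x i)) T.
  by apply: (hassum_sigma hT) => k; rewrite hp; exact: hassum_fin.
have [_ h2] := H _ (nx _ hx).
by rewrite -(cvg_unique _ (hassum_series hk) h2).
Qed.

Lemma hassum_supp (I : choiceType) (u : I -> R) (J : seq I) : uniq J ->
  (forall i, i \notin J -> u i = 0) -> hassum u (\sum_(i <- J) u i).
Proof.
move=> uJ u0 e e0; exists J => J' uJ' sJ.
rewrite (@sum_subset _ _ u J J')// [X in _ + X - _]big1; last by move=> i; exact: u0.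
by rewrite addr0 subrr normr0 ltW.
Qed.

(* Multiplying by the signs of finitely many fibre sums reduces the bound on
   the sum of absolute values to the bound on a single total sum. *)
Lemma sumle_fibers (I : choiceType) (K : I -> choiceType) (u : {i : I & K i} -> R) S M :
  sumle u M -> (forall i, hassum (fun k : K i => u (Tagged K k)) (S i)) -> sumle S M.
Proof.
move=> uM uS J uJ.
pose eps i : R := if i \in J then Num.sg (S i) else 0.
pose v (x : {i : I & K i}) := eps (tag x) * u x.
have eps1 i : `|eps i| <= 1.
  by rewrite /eps; case: ifP => _; rewrite ?normr0// normr_sg; case: (_ != _).
have vM : sumle v M.
  by apply: sumle_le uM => // x; rewrite /v normrM ler_piMl.
have [T hT] := sumle_hassum vM.
have h1 : hassum (fun i => eps i * S i) T.
  by apply: (hassum_sigma hT) => i; rewrite /v /=; apply: hassumZ; exact: uS.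
have h2 : hassum (fun i => eps i * S i) (\sum_(i <- J) eps i * S i).
  by apply: hassum_supp => // i iJ; rewrite /eps (negbTE iJ) mul0r.
rewrite (_ : \sum_(i <- J) `|S i| = \sum_(i <- J) eps i * S i); last first.
  by rewrite big_seq [RHS]big_seq; apply: eq_bigr => i iJ; rewrite /eps iJ -normrEsg.
rewrite (hassum_unique h2 h1); apply: le_trans (ler_norm _) (hassum_norm_le vM hT).
Qed.

Lemma hassum_sumle (I : choiceType) (u : I -> R) S : (forall i, 0 <= u i) ->
  hassum u S -> sumle u S.
Proof.
move=> u0 uS J uJ; apply/ler_addgt0Pr => e e0; have [J0 H] := uS e e0.
have {}H := H (undup (J ++ J0)) (undup_uniq _).
have /ler_normlW : `|\sum_(i <- undup (J ++ J0)) u i - S| <= e.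
  by apply: H => i iJ; rewrite mem_undup mem_cat iJ orbT.
rewrite (@sum_subset _ _ u J)//; last 2 first.
- exact: undup_uniq.
- by move=> i iJ; rewrite mem_undup mem_cat iJ.
have : 0 <= \sum_(i <- undup (J ++ J0) | i \notin J) u i by apply: sumr_ge0.
rewrite [X in _ -> _ -> X <= _](eq_bigr u) => [|i _]; last by rewrite ger0_norm.
lra.
Qed.

Lemma mono_count n (w : seq 'I_n) (x : 'I_n -> R) :
  mono x w = \prod_v x v ^+ count_mem v w.
Proof.
rewrite /mono; elim: w => [|v w IH]; first by rewrite big_nil big1.
rewrite big_cons IH; under [RHS]eq_bigr do rewrite /= exprD.
rewrite big_split /=; congr (_ * _); rewrite (bigD1 v)//= eqxx expr1 big1 ?mulr1// => i.
by rewrite eq_sym => /negbTE ->.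
Qed.

(** Words with the same letter counts are collected into one Taylor coefficient; [sumle_fibers]
    keeps absolute convergence. It supplies analytic equations for submanifolds. *)
Lemma An_analytic n (rho : R) F M (a : 'rV[R]_n) : 0 < rho -> An (fun=> rho) F M ->
  analytic_at (fun z : 'rV[R]_n => F (fun i => z ord0 i - a ord0 i)) a.
Proof.
move=> r0 [I [c [w [sM H]]]].
pose mt (al : 'I_n -> nat) i := [forall v, count_mem v (w i) == al v].
pose C (al : 'I_n -> nat) : R := tsum (fun i => if mt al i then c i else 0).
have hC al : hassum (fun i => if mt al i then c i else 0) (C al).
  pose p := \prod_(v < n) rho ^+ al v.
  have p_gt0 : 0 < p by apply: prodr_gt0 => v _; exact: exprn_gt0.
  apply: (@hassum_tsum _ _ _ (`|p^-1| * M)).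
  apply: sumle_le (sumleZ p^-1 sM) => // i.
  case: ifP => [/forallP h|_]; last by rewrite normr0.
  rewrite mono_count (eq_bigr (fun v => rho ^+ al v)) => [|v _]; last by rewrite (eqP (h v)).
  by rewrite mulrCA mulVf ?gt_eqF// mulr1.
pose K k : choiceType := {ffun 'I_n -> 'I_k.+1}.
pose ind (j : {k & K k}) i := ((\sum_(v < n) (tagged j v : nat))%N == tag j)
  && mt (fun v => tagged j v : nat) i.
exists C, rho; split => // z za.
pose x i := z ord0 i - a ord0 i.
have hx : polyd (fun=> rho) x.
  by move=> i; have /(norm_rowP _ r0)/(_ i) := za; rewrite !mxE => /ltW.
pose U (q : {j : {k & K k} & I}) : R :=
  if ind (tag q) (tagged q) then c (tagged q) * mono x (w (tagged q)) else 0.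
pose S (j : {k & K k}) : R := if (\sum_(v < n) (tagged j v : nat))%N == tag j then
  C (fun v => tagged j v : nat) * monomial a z (fun v => tagged j v : nat) else 0.
have US j : hassum (fun i => U (@Tagged {k & K k} j (fun=> I) i)) (S j).
  rewrite /U /S /ind /=; case: ifP => _ /=; last first.
    by have := @hassum_supp I (fun=> 0) [::] isT (fun _ _ => erefl); rewrite big_nil.
  rewrite mulrC; apply: eq_hassum (hassumZ (monomial a z (fun v => tagged j v : nat)) (hC _)) => i /=.
  case: ifP => [/forallP h|_]; last by rewrite mulr0.
  rewrite mulrC; congr (_ * _); rewrite mono_count; apply: eq_bigr => v _.
  by rewrite (eqP (h v)).
(* The degree of the word [w i]. The map [h] puts each word at its only place in the double family
   [U], whose other entries are zero. *)
pose N i : nat := (\sum_(v < n) count_mem v (w i))%N.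
have cN i v : (count_mem v (w i) < (N i).+1)%N by rewrite ltnS /N (bigD1 v)//= leq_addr.
pose h i := @Tagged {k & K k} (@Tagged nat (N i) K [ffun v => Ordinal (cN i v)]) (fun=> I) i.
have hI : injective h by move=> i i' /(congr1 (fun q : {_ : {k & K k} & I} => tagged q)).
have U0 q : (forall i, q <> h i) -> U q = 0.
  case: q => [[k al] i] ne; rewrite /U; case: ifPn => // /andP[/eqP /= e /forallP hm].
  have Nk : N i = k by rewrite -e; apply: eq_bigr => v _; rewrite (eqP (hm v)).
  exfalso; case: k / Nk al e hm ne => al e hm ne; apply: (ne i); rewrite /h.
  suff -> : al = [ffun v => Ordinal (cN i v)] by [].
  by apply/ffunP => v; apply/val_inj; rewrite ffunE /= (eqP (hm v)).
have Uh i : U (h i) = c i * mono x (w i).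
  rewrite /U ifT// /ind /=; apply/andP; split.
    by apply/eqP; apply: eq_bigr => v _; rewrite ffunE.
  by apply/forallP => v; rewrite ffunE.
have hU : hassum U (F x).
  by apply: (hassum_inj hI U0); apply: eq_hassum (H x hx) => i; rewrite Uh.
have [T sU] : exists T, sumle U T.
  have [T hT] : exists T, hassum (fun i => `|c i * mono x (w i)|) T.
    apply: (@sumle_hassum _ _ _ M); apply: sumle_le sM => // i; rewrite normr_id; exact: term_le.
  exists T; have /hassum_sumle : hassum (fun q => `|U q|) T.
    apply: (hassum_inj hI) => [q /U0 ->|]; first by rewrite normr0.
    by apply: eq_hassum hT => i; rewrite Uh.
  by move=> /(_ (fun=> normr_ge0 _)); apply: sumle_le => // q; rewrite normr_id.
have hS : hassum S (F x) := hassum_sigma hU US.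
have sS : sumle S T := sumle_fibers sU US.
split; last first.
  apply: hassum_series; apply: (hassum_sigma hS) => k.
  by rewrite /homog_part big_mkcond; exact: (hassum_fin (fun al : K k => S (Tagged K al))).
have [T2 hT2] : exists T2, hassum (fun j => `|S j|) T2.
  by apply: (@sumle_hassum _ _ _ T); apply: sumle_le sS => // j; rewrite normr_id.
apply/cvg_ex; exists T2; apply: hassum_series; apply: (hassum_sigma hT2) => k.
rewrite (_ : homog_part_abs C a z k = \sum_(al : K k) `|S (Tagged K al)|); first exact: hassum_fin.
by rewrite /homog_part_abs big_mkcond; apply: eq_bigr => al _; rewrite /S /=; case: ifP; rewrite ?normr0.
Qed.

End AnalyticAn.

Section Dirs.
Context {R : realType}.

Lemma is_derive_line (V : normedModType R) (f : V -> R) (x v : V) (t D : R) :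
  is_derive (x + t *: v) v f D <-> is_derive t (1 : R) (fun t => f (x + t *: v)) D.
Proof.
have e : (fun h : R => h^-1 *: ((f \o shift (x + t *: v)) (h *: v) - f (x + t *: v))) =
   (fun h : R => h^-1 *: (((fun t => f (x + t *: v)) \o shift t) (h *: (1 : R)) - f (x + t *: v))).
  apply/funext => h /=; congr (_ *: (f _ - _)).
  by rewrite addrCA -scalerDl /GRing.scale /= mulr1.
by split=> -[d1 d2]; apply: DeriveDef; move: d1 d2; rewrite /derivable /derive /= e.
Qed.

Lemma is_derive_scale (V : normedModType R) (f : V -> R) (x v : V) (c D : R) :
  is_derive x v f D -> is_derive x (c *: v) f (c * D).
Proof.
rewrite -[x in is_derive x _ _ _]addr0 -(scale0r v) => /is_derive_line d.
rewrite -[x in is_derive x _ _ _]addr0 -(scale0r (c *: v)); apply/is_derive_line.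
have dc : is_derive (0 : R) (1 : R) (fun t : R => t * c) c.
  have := is_deriveZ c (is_derive_id (0 : R) (1 : R)).
  rewrite /GRing.scale /= mulr1; apply: near_eq_is_derive; near=> t; by rewrite mulrC.
have := @is_derive1_comp _ (fun t => f (x + t *: v)) (fun t : R => t * c) 0 D c.
rewrite mul0r mulrC => /(_ d dc); apply: near_eq_is_derive; near=> t.
by rewrite /= scalerA.
Unshelve. all: by end_near. Qed.

(** Formulated with directional derivatives because these occur in the definition of test functions;
    it is just what makes the derivative linear in the direction. *)
Definition C1 (V : normedModType R) (f : V -> R) (x : V) :=
  forall w, (\forall y \near x, derivable f y w) /\ {for x, continuous ('D_w f)}.

Lemma C1_derivable (V : normedModType R) (f : V -> R) (x : V) : C1 f x -> forall w, derivable f x w.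
Proof. by move=> H w; have [/nbhs_singleton] := H w. Qed.

(** The increment along [h (v + w)] is split at [x + h v]. The first part is the derivative at [x];
    on the second, the mean value theorem gives ['D_w f] at a nearby point, and continuity
    concludes. *)
Lemma is_derive_add (V : normedModType R) (f : V -> R) (x v w : V) : C1 f x ->
  is_derive x (v + w) f ('D_v f x + 'D_w f x).
Proof.
move=> fC; have [dw cw] := fC w; have dv := @C1_derivable _ _ _ fC v.
have cv : (fun h => h^-1 *: ((f \o shift x) (h *: (v + w)) - f x)) @ 0^' -->
    ('D_v f x + 'D_w f x : R^o).
  apply/cvgrPdist_le => e e0; have e2 : 0 < e / 2 by rewrite divr_gt0.
  have /nbhs_ballP[d /= d0 Hd] : \forall y \near x, derivable f y w /\ `|'D_w f x - 'D_w f y| <= e / 2.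
    near=> y; split; first by near: y.
    by near: y; move/(@cvgrPdist_le _ _ _ (nbhs x) (nbhs_filter x)): cw; apply.
  have n0 : 0 < d / (`|v| + `|w| + 1) by rewrite divr_gt0// ltr_wpDl// addr_ge0.
  near=> h.
  have h0 : h != 0 by near: h; exact: nbhs_dnbhs_neq.
  have hd : `|h| < d / (`|v| + `|w| + 1) by near: h; apply: dnbhs0_lt.
  have hv : `|'D_v f x - h^-1 *: ((f \o shift x) (h *: v) - f x)| <= e / 2.
    near: h; have /cvgrPdist_le := dv; apply; exact: e2.
  have inb u : 0 <= u <= 1 -> ball x d (x + h *: v + u *: (h *: w)).
    move=> /andP[u0 u1]; rewrite -ball_normE /= -addrA opprD addNKr normrN.
    rewrite ltr_pdivlMr in hd; last by rewrite ltr_wpDl// addr_ge0.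
    apply: le_lt_trans hd; apply: le_trans (ler_normD _ _) _.
    rewrite !normrZ (ger0_norm u0) -addrA !mulrDr lerD2l mulr1.
    have : u * (`|h| * `|w|) <= 1 * (`|h| * `|w|) by rewrite ler_wpM2r// mulr_ge0.
    by have := normr_ge0 h; lra.
  have dg (u : R) : 0 <= u <= 1 -> is_derive u (1 : R) (fun u => f (x + h *: v + u *: (h *: w)))
      (h * 'D_w f (x + h *: v + u *: (h *: w))).
    move=> /inb/Hd[d1 _].
    exact: (is_derive_line f (x + h *: v) (h *: w) u _).1 (is_derive_scale h (derivableP d1)).
  have [|||u] := @MVT R (fun u => f (x + h *: v + u *: (h *: w)))
     (fun u => h * 'D_w f (x + h *: v + u *: (h *: w))) 0 1.
  - exact: ltr01.
  - by move=> u; rewrite in_itv /= => /andP[u0 u1]; apply: dg; rewrite !ltW.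
  - apply: derivable_within_continuous => u; rewrite in_itv /= => hu.
    by have [] := dg u hu.
  rewrite in_itv /= subr0 mulr1 scale0r addr0 scale1r => /andP[u0 u1] E.
  rewrite /= in hv *.
  rewrite (_ : h *: (v + w) + x = x + h *: v + h *: w); last by rewrite scalerDr addrC addrA.
  rewrite (addrC _ x) in hv.
  have -> : 'D_v f x + 'D_w f x - h^-1 *: (f (x + h *: v + h *: w) - f x) =
    ('D_v f x - h^-1 *: (f (x + h *: v) - f x)) +
    ('D_w f x - 'D_w f (x + h *: v + u *: (h *: w))).
    rewrite -[f (x + h *: v + h *: w)](subrK (f (x + h *: v))) E /GRing.scale /=; field; exact: h0.
  have hw : `|'D_w f x - 'D_w f (x + h *: v + u *: (h *: w))| <= e / 2.
    by have [_] := Hd _ (inb u (introT andP (conj (ltW u0) (ltW u1)))).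
  by apply: le_trans (ler_normD _ _) _; rewrite [leRHS](splitr e) lerD.
apply: DeriveDef; first by apply/cvg_ex; exists ('D_v f x + 'D_w f x).
exact: cvg_lim cv.
Unshelve. all: by end_near. Qed.

Lemma derive_lin (V : normedModType R) (f : V -> R) (x v w : V) (c : R) : C1 f x ->
  'D_(c *: v + w) f x = c * 'D_v f x + 'D_w f x.
Proof.
move=> fC; rewrite (@derive_val _ _ _ _ _ _ _ (is_derive_add (c *: v) w fC)).
congr (_ + _); have := is_derive_scale c (derivableP (@C1_derivable _ _ _ fC v)).
exact: (@derive_val _ _ _ _ _ _ _).
Qed.

Lemma derive_sum_partial n (f : 'rV[R]_n -> R) (x v : 'rV[R]_n) : C1 f x ->
  'D_v f x = \sum_i v ord0 i * partialD i f x.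
Proof.
move=> fC; rewrite {1}[v]row_sum_delta.
have d0 : 'D_0 f x = 0.
  have := is_derive_scale 0 (derivableP (@C1_derivable _ _ _ fC v)); rewrite scale0r mul0r.
  exact: (@derive_val _ _ _ _ _ _ _).
elim/big_rec2: _ => [//|i y1 y2 _ IH].
by rewrite derive_lin// IH.
Qed.

Lemma An_derive n (rho : R) F M (w : 'I_n -> R) : 0 < rho -> An (fun=> rho) F M ->
  forall rho', 0 <= rho' < rho -> exists G N, An (fun=> rho') G N /\
   forall x : 'rV[R]_n, `|x| < rho' -> is_derive x (\row_i w i)
     (fun x : 'rV[R]_n => F (fun i => x ord0 i)) (G (fun i => x ord0 i)).
Proof.
move=> r0 HF rho' /andP[r'0 r'r].
have [eta eta0 He] : exists2 eta, 0 < eta & forall v, rho' + eta * `|w v| <= rho.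
  have s0 : 0 < 1 + \sum_v `|w v| by rewrite ltr_wpDr// sumr_ge0.
  exists ((rho - rho') / (1 + \sum_v `|w v|)); first by rewrite divr_gt0// subr_gt0.
  move=> v; rewrite -lerBrDl mulrAC ler_pdivrMr// ler_wpM2l ?subr_ge0 ?(ltW r'r)//.
  by rewrite (bigD1 v)//= ler_wpDl// lerDl sumr_ge0.
have [G [HG [K HK]]] := An_deriv eta0 (fun=> r'0) He HF.
exists G, (M / eta); split => // x xr.
have hx : polyd (fun=> rho') (fun i => x ord0 i).
  have r'1 : 0 < rho' by apply: le_lt_trans xr.
  by move=> i; apply: ltW; exact: (norm_rowP _ r'1).1.
apply: (is_derive_quadratic eta0) => h hh; have := HK _ _ hx hh.
rewrite (_ : (fun v => x ord0 v + h * w v) = (x + h *: \row_i w i) ord0); first exact.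
by apply/funext => i; rewrite !mxE.
Qed.

Lemma An_C1 n (rho : R) F M (x : 'rV[R]_n) : An (fun=> rho) F M -> `|x| < rho ->
  C1 (fun x : 'rV[R]_n => F (fun i => x ord0 i)) x.
Proof.
move=> HF xr w; have r0 : 0 < rho by apply: le_lt_trans xr.
have hr : 0 <= (rho + `|x|) / 2 < rho.
  by apply/andP; split; [rewrite divr_ge0// addr_ge0// ltW|move: xr; lra].
have [G [N [HG HD]]] := An_derive (fun i => w ord0 i) r0 HF hr.
have xr' : `|x| < (rho + `|x|) / 2 by move: xr; lra.
have ew : \row_i w ord0 i = w by apply/rowP => i; rewrite mxE.
rewrite ew in HD.
have nb : \forall y \near x, `|y| < (rho + `|x|) / 2.
  by have := @open_norm_lt _ n ((rho + `|x|) / 2); rewrite openE => /(_ x xr').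
split; first by apply: filterS nb => y /HD[].
have := An_continuous_row HG xr'; rewrite /prop_for /continuous_at.
rewrite (@derive_val _ _ _ _ _ _ _ (HD x xr')) => h; apply: cvg_trans h.
apply: (@near_eq_cvg _ _ (nbhs x) (nbhs_filter x)).
move: nb; apply: (@filterS _ (nbhs x) (nbhs_filter x)) => y /HD h.
exact/esym/(@derive_val _ _ _ _ _ _ _ h).
Qed.

Lemma near_shift (V : normedModType R) (P : V -> Prop) (x p : V) :
  (\forall y \near x - p, P y) -> \forall y \near x, P (y - p).
Proof.
have cp : (fun y : V => y - p) @ x --> x - p by apply: cvgB; [exact: cvg_id|exact: cvg_cst].
by move=> h; exact: (cp P h).
Qed.

Lemma C1_shift (V : normedModType R) (f : V -> R) (x p : V) : C1 f (x - p) ->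
  C1 (fun z => f (z - p)) x.
Proof.
move=> fC w; have [dw cw] := fC w.
have e (y : V) : (fun h : R => h^-1 *: (((fun z => f (z - p)) \o shift y) (h *: w) - f (y - p))) =
   (fun h : R => h^-1 *: ((f \o shift (y - p)) (h *: w) - f (y - p))).
  by apply/funext => h /=; rewrite addrA.
have eD : 'D_w (fun z => f (z - p)) = (fun y => 'D_w f (y - p)).
  by apply/funext => y; rewrite /derive e.
have ed y : derivable (fun z => f (z - p)) y w = derivable f (y - p) w.
  by rewrite /derivable e.
have cp : (fun y : V => y - p) @ x --> x - p by apply: cvgB; [exact: cvg_id|exact: cvg_cst].
split.
  by have := near_shift dw; apply: filterS => y; rewrite ed.
rewrite eD; exact: (cvg_comp _ _ cp cw).
Qed.

End Dirs.

(** * Zero sets of codimension two *)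

Section Codim.
Context {R : realType}.

Lemma codim_avoid n (X : set 'rV[R]_n) k d : codim_ge X 0 k -> (n - d < k)%N ->
  exists2 e, 0 < e & forall x, `|x| < e -> ~ smooth_point X d x.
Proof.
move=> cX dk; have nc : ~ closure (smooth_point X d) 0.
  by move=> /cX; rewrite leqNgt dk.
apply: contrapT => ne; apply: nc => B /nbhs_ballP[e /= e0 Be].
apply: contrapT => n0; apply: ne; exists e => // x xe sx; apply: n0.
by exists x; split => //; apply: Be; rewrite -ball_normE /= sub0r normrN.
Qed.

(** If [f] vanished near [0], the zero set would be open there, a submanifold of full dimension cut
    out by the empty family of equations. *)
Lemma not_locally_zero n (V : set 'rV[R]_n) (f : 'rV[R]_n -> R) : open V -> V 0 ->
  ~ smooth_point (zero_set V f) n 0 -> forall d, 0 < d -> exists2 x, `|x| < d & f x != 0.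
Proof.
move=> oV V0 ns d d0; apply: contrapT => nf.
have f0 x : `|x| < d -> f x = 0.
  by move=> xd; apply/eqP; apply: contrapT => /negP fx; apply: nf; exists x.
apply: ns; split; first by split => //; apply: f0; rewrite normr0.
pose W := V `&` [set x : 'rV[R]_n | `|x| < d].
have oW : open W by apply: openI => //; exact: open_norm_lt.
exists W; split => //; first by split => //=; rewrite normr0.
split; [exact: leqnn|split; first by move=> x []].
have no (j : 'I_(n - n)) : False by case: j => j; rewrite subnn.
move=> q [Wq Xq]; exists W, (fun _ => fun=> 0); split.
  by split => // j; case: (no j).
split.
  apply/seteqP; split => x /=; first by move=> [_ Wx]; split => // j; case: (no j).
  by move=> [Wx _]; split => //; split => //; case: Wx => Vx xd; split => //; exact: f0.
by move=> x _; apply/eqP; rewrite eqn_leq rank_leq_row /= subnn.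
Qed.

(** The number of equations [n.+1 - n] does not reduce to [1] for a variable [n], hence the
    hypothesis [m = 1]. *)
Lemma rank_jacobian1 m n (g : 'I_m -> 'rV[R]_n -> R) x i : m = 1%N ->
  (forall j, partialD i (g j) x != 0) -> \rank (Defs.jacobian g x) = m.
Proof.
move=> m1; subst m => H; rewrite rank_rV; suff -> : Defs.jacobian g x != 0 by [].
apply/eqP => /matrixP/(_ ord0 i); rewrite !mxE => /eqP.
by rewrite (negbTE (H ord0)).
Qed.

End Codim.

Section RootSmooth.
Context {R : realType}.
Variables (n : nat) (f : 'rV[R]_n.+1 -> R) (a : 'I_n -> R) (k : nat) (c s r1 : R).
Variables (Q : (option 'I_n -> R) -> R) (r : nat -> ('I_n -> R) -> R).
Hypothesis W : wdata (fun z => f (\row_i z i)) a k c s r1 Q r.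
Local Notation P y := (wpoly k (r^~ y)).
Local Notation toC := (real_complex R).

Definition yof (x : 'rV[R]_n.+1) (j : 'I_n) := x ord0 (lift ord0 j) - a j * x ord0 ord0.

Definition dir : 'rV[R]_n.+1 := \row_i shr a 1 (fun=> 0) i.

Lemma row_shr_line y t : \row_i shr a t y i = \row_i shr a 0 y i + t *: dir.
Proof.
apply/rowP => i; rewrite !mxE; case: (unliftP ord0 i) => [j|] ->; rewrite ?shrS ?shr0; ring.
Qed.

Lemma yof_shr y t : yof (\row_i shr a t y i) = y.
Proof. by apply/funext => j; rewrite /yof !mxE shrS shr0 addrK. Qed.

Lemma shr_yof (x : 'rV[R]_n.+1) : \row_i shr a (x ord0 ord0) (yof x) i = x.
Proof.
apply/rowP => i; rewrite mxE; case: (unliftP ord0 i) => [j|] ->; rewrite ?shrS ?shr0//.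
by rewrite /yof subrK.
Qed.

Lemma wdata_rootE y t : `|t| <= s -> polyd (fun=> r1) y ->
  (f (\row_i shr a t y i) = 0 <-> (P y).[t] = 0).
Proof.
move=> ts hy; have /andP[q1 _] := wdata_Q W ts hy.
case: W => -[c0 _ _ _] [_ _ _ _ /(_ t y ts hy) e].
have Q0 : Q (ocons t y) != 0 by rewrite gt_eqF//; lra.
split=> h.
  by move: e; rewrite h mulr0 => /esym/eqP; rewrite mulf_eq0 (negbTE c0) => /eqP.
by move: e; rewrite h mulr0 => /eqP; rewrite mulf_eq0 (negbTE Q0) => /eqP.
Qed.

Section Hypersurface.
Variable m : nat.
Let g (x : 'rV[R]_n.+1) := (P (yof x))^`(m).[x ord0 ord0].

(** Recentring at [p]: the substitution [L] is affine, and its norms fit into the polydisc because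
    of the margins at [p]. *)
Lemma derivn_wpoly_An (p : 'rV[R]_n.+1) : `|p ord0 ord0| < s -> inner (fun=> r1) (yof p) ->
  exists r' F N, [/\ 0 < r', An (fun=> r') F N & forall x, g x = F (fun i => x ord0 i - p ord0 i)].
Proof.
move=> ps [d d0 Hd]; case: W => -[_ s0 _ r10] [_ _ Hr _ _].
have dsm : forall y, (size (P y)^`(m) <= k.+1)%N.
  move=> y; apply/leq_sizeP => i ki.
  by rewrite coef_derivn nth_default ?mul0rn// size_wpoly (leq_trans ki)// leq_addl.
have [N HN] := Anp_horner (ltW s0) (fun=> ltW r10) dsm (Anp_derivn m (Anp_wpoly k Hr)).
have m0 : 0 < Num.min d (s - `|p ord0 ord0|) by rewrite lt_min d0 subr_gt0.
have [r' r'0 Hr'] := small_radius a d0.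
pose r2 := Num.min r' (s - `|p ord0 ord0|).
have r20 : 0 < r2 by rewrite lt_min r'0 subr_gt0.
pose L v (z : 'I_n.+1 -> R) := if v is Some j then yof p j + (z (lift ord0 j) - a j * z ord0)
  else p ord0 ord0 + z ord0.
exists r2, (fun z => (P ((fun v => L v z) \o Some))^`(m).[L None z]), N; split => //.
  apply: (An_subst (L := L) HN) => v.
  have p2 : polyd (V := 'I_n.+1) (fun=> r2) (fun=> r2) by move=> i; rewrite gtr0_norm.
  have hv i : An (V := 'I_n.+1) (fun=> r2) (fun x => x i) r2.
    by have := An_var (V := 'I_n.+1) (fun=> r2) i; rewrite gtr0_norm.
  case: v => [j|] /=.
    apply: (An_le p2 _ (An_add (An_const _ _) (An_sub (hv _) (An_scale (a j) (hv _))))).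
    apply: le_trans (Hd j); rewrite lerD2l; apply: Hr'; last exact: ltW.
    by rewrite ge_min lexx.
  apply: (An_le p2 _ (An_add (An_const _ _) (hv _))).
  by rewrite -lerBrDl ge_min lexx orbT.
move=> x; rewrite /g /L; congr ((wpoly k (fun j => r j _))^`(m).[_]).
  by apply/funext => _; apply/funext => j /=; rewrite /yof; ring.
by rewrite addrC subrK.
Qed.

(** Along [dir] the coordinates [y] are constant, so [g] has derivative [P^(m+1)] there. This is a
    linear combination of the partial derivatives, so they cannot all vanish. *)
Lemma derivn_wpoly_partial (p : 'rV[R]_n.+1) : `|p ord0 ord0| < s -> inner (fun=> r1) (yof p) ->
  (P (yof p))^`(m.+1).[p ord0 ord0] != 0 -> exists i, partialD i g p != 0.
Proof.
move=> ps ip nz; have [r' [F [N [r'0 HF gE]]]] := derivn_wpoly_An ps ip.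
have gC : C1 g p.
  have : C1 (fun x : 'rV[R]_n.+1 => F (fun i => x ord0 i)) (p - p).
    by apply: An_C1 HF _; rewrite subrr normr0.
  move=> /C1_shift; suff -> : (fun z : 'rV[R]_n.+1 => F (fun i => (z - p) ord0 i)) = g by [].
  by apply/funext => x; rewrite gE; congr F; apply/funext => i; rewrite !mxE.
have dg : is_derive p dir g (P (yof p))^`(m.+1).[p ord0 ord0].
  rewrite -{1}(shr_yof p) row_shr_line; apply/is_derive_line.
  rewrite (_ : (fun t => _) = horner (P (yof p))^`(m)); last first.
    by apply/funext => t; rewrite -row_shr_line /g yof_shr mxE shr0.
  by rewrite derivnS; apply: DeriveDef; [exact: derivable_horner|rewrite -derive1E derivE].
apply: contrapT => np; move: nz; rewrite -(@derive_val _ _ _ _ _ _ _ dg).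
rewrite derive_sum_partial// big1 ?eqxx// => i _.
have [->|h] := eqVneq (partialD i g p) 0; first by rewrite mulr0.
by exfalso; apply: np; exists i.
Qed.

End Hypersurface.

Variable V : set 'rV[R]_n.+1.
Hypothesis VO : forall t y, `|t| <= s -> polyd (fun=> r1) y -> V (\row_i shr a t y i).

(** Near the point, the single equation [P^(m) = 0] describes the zero set and has a nonzero
    gradient, although [f] itself may vanish to higher order. *)
Lemma root_smooth_point m y1 t1 d : inner (fun=> r1) y1 -> `|t1| < s -> (P y1).[t1] = 0 -> 0 < d ->
  (forall y t, (forall v, `|y1 v - y v| <= d) -> `|t1 - t| <= d ->
     (P y)^`(m.+1).[t] != 0 /\ ((P y).[t] = 0 <-> (P y)^`(m).[t] = 0)) ->
  smooth_point (zero_set V f) n (\row_i shr a t1 y1 i).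
Proof.
move=> iy1 ts1 P0 d0 Hd; set p := \row_i shr a t1 y1 i.
have [d1 d10 Hd1] := iy1.
split; first by split; [apply: VO; [exact: ltW|exact: inner_polyd]|
  apply/(wdata_rootE (ltW ts1) (inner_polyd iy1))].
pose d2 := Num.min d (d1 / 2).
have d20 : 0 < d2 by rewrite lt_min d0 divr_gt0.
have [d3 d30 Hd3] := small_radius a d20.
pose d4 := Num.min (Num.min d d3) (s - `|t1|).
have d40 : 0 < d4 by rewrite !lt_min d0 d30 subr_gt0.
have d4d : d4 <= d /\ d4 <= d3 /\ d4 <= s - `|t1| by rewrite /d4 !ge_min !lexx ?orbT.
have p0 : p ord0 ord0 = t1 by rewrite mxE shr0.
have inW x : ball p d4 x -> [/\ `|t1 - x ord0 ord0| <= d, `|x ord0 ord0| < s,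
    (forall j, `|y1 j - yof x j| <= d) & inner (fun=> r1) (yof x)].
  rewrite -ball_normE /= => /(norm_rowP _ d40) px.
  have := px ord0; rewrite !mxE shr0 => h0.
  have hj j : `|y1 j - yof x j| <= d2.
    have := px (lift ord0 j); rewrite !mxE shrS => h1.
    apply: le_trans (Hd3 d4 _ j (ltW d40)); last by case: d4d => _ [].
    have -> : y1 j - yof x j = (y1 j + a j * t1 - x ord0 (lift ord0 j)) - a j * (t1 - x ord0 ord0).
      by rewrite /yof; ring.
    apply: le_trans (ler_normB _ _) _; rewrite normrM lerD ?(ltW h1)//.
    by rewrite ler_wpM2l// ltW.
  split.
  - by apply: le_trans (ltW h0) _; case: d4d.
  - have := ler_normB t1 (t1 - x ord0 ord0); rewrite subKr; case: d4d => _ [_]; lra.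
  - by move=> j; apply: le_trans (hj j) _; rewrite /d2 ge_min lexx.
  - exists (d1 / 2); first by rewrite divr_gt0.
    move=> j; have := ler_normB (y1 j) (y1 j - yof x j); rewrite subKr.
    have := hj j; have := Hd1 j; have : d2 <= d1 / 2 by rewrite /d2 ge_min lexx orbT.
    lra.
have fE x : ball p d4 x -> f x = 0 <-> (P (yof x))^`(m).[x ord0 ord0] = 0.
  move=> /inW[h1 h2 h3 h4]; have [_ <-] := Hd _ _ h3 h1.
  by rewrite -{1}(shr_yof x); apply: wdata_rootE; [exact: ltW|exact: inner_polyd].
have VW x : ball p d4 x -> V x.
  by move=> /inW[_ h2 _ h4]; rewrite -(shr_yof x); apply: VO; [exact: ltW|exact: inner_polyd].
exists (ball p d4); split; [exact: ball_open|exact: ballxx|].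
split; [exact: leqnSn|split; first by move=> x []].
have e1 : (n.+1 - n)%N = 1%N by rewrite subSnn.
move=> q [Wq Xq]; exists (ball p d4), (fun _ x => (P (yof x))^`(m).[x ord0 ord0]); split.
  split => //; first exact: ball_open.
  move=> _ x /inW[_ h2 _ h4]; have [r' [F [N [r'0 HF gE]]]] := derivn_wpoly_An m h2 h4.
  by rewrite (funext gE); apply: An_analytic HF.
split.
  apply/seteqP; split => x /=.
    by move=> [[_ [_ fx]] Wx]; split => // _; apply/fE.
  move=> [Wx /(_ (cast_ord (esym e1) ord0)) gx]; split => //; split => //; split; first exact: VW.
  exact/fE.
move=> x [_ Wx]; have [h1 h2 h3 h4] := inW x Wx.
have [nz _] := Hd _ _ h3 h1.
have [i hi] := derivn_wpoly_partial h2 h4 nz.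
exact: (rank_jacobian1 (i := i)).
Qed.

Hypothesis ns : forall t y, `|t| <= s -> polyd (fun=> r1) y ->
  ~ smooth_point (zero_set V f) n (\row_i shr a t y i).

Lemma codim2_no_root E N : An (fun=> r1) E N ->
  (forall y z, inner (fun=> r1) y -> root (map_poly toC (P y)) z ->
    complex.Im z != 0 -> `|E y| <= 2 * `|complex.Im z|) ->
  forall y t, inner (fun=> r1) y -> E y != 0 -> `|t| < s -> (P y).[t] != 0.
Proof.
move=> HE Im y0 t0 iy0 Ey0 ts0; apply/eqP => P0.
case: (W) => -[_ s0 _ r10] [_ _ Hr _ _].
have [y1 [t1 [m [d [[iy1 ts1 P1 d0] H]]]]] := @smooth_real_root _ _ (fun=> r1) s k
  (fun y => P y) E s0 (fun=> ltW r10) (fun y => wpoly_monic k (r^~ y))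
  (fun y => size_wpoly k (r^~ y)) (Anp_wpoly k Hr) (ex_intro _ N HE) Im y0 t0 iy0 Ey0 ts0 P0.
apply: (ns (ltW ts1) (inner_polyd iy1)); exact: (@root_smooth_point m y1 t1 d).
Qed.

End RootSmooth.

(** * Integration by parts on lines *)

Section RealFun.
Context {R : realType}.

Lemma measurable_invr : measurable_fun (setT : set R) (fun x : R => x^-1).
Proof.
rewrite (_ : (fun x => _) = (fun x : R => x * `|x| `^ (- 2))).
  by apply: measurable_funM => //; apply: (measurableT_comp (measurable_powR _)).
apply/funext => x; have [->|x0] := eqVneq x 0; first by rewrite invr0 mul0r.
rewrite powRN powR_mulrn// -normrX ger0_norm ?sqr_ge0// expr2 invfM mulrA mulfV// mul1r//.
Qed.

Lemma ln_le_id (x : R) : ln x <= `|x|.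
Proof.
have [x0|x0] := leP x 0; first by rewrite ln0.
have := @le_ln1Dx R (x - 1); rewrite (_ : 1 + (x - 1) = x); last by ring.
by move=> h; have := ler_norm x; apply: le_trans; apply: le_trans (h _) _; move: x0; lra.
Qed.

(** Both sides come from [ln x <= x]: for [x = |u|], and for [x = |u|^-e], whose logarithm is
    [-e ln |u|]. *)
Lemma ln_abs_le (e M u : R) : 0 < e -> `|u| <= M ->
  (`|ln `|u| |%:E <= M%:E + e^-1%:E * sg e u)%E.
Proof.
move=> e0 uM; have [u0|u0] := eqVneq u 0.
  by rewrite u0 /sg eqxx gt0_muley ?lte_fin ?invr_gt0// addey// leey.
rewrite sg_fin// -EFinM -EFinD lee_fin.
have p0 : 0 <= `|u| `^ (- e) by exact: powR_ge0.
have h1 : ln `|u| <= M by apply: le_trans (ln_le_id _) _; rewrite normr_id.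
have h2 : - ln `|u| <= e^-1 * `|u| `^ (- e).
  rewrite -ler_pdivrMl ?invr_gt0// invrK mulrN -mulNr -ln_powR.
  by apply: le_trans (ln_le_id _) _; rewrite ger0_norm.
have M0 : 0 <= M by apply: le_trans uM.
have ep : 0 <= e^-1 * `|u| `^ (- e) by rewrite mulr_ge0// invr_ge0 ltW.
by rewrite ler_norml; apply/andP; split; lra.
Qed.

Lemma is_derive_ln_abs (g : R -> R) (t D : R) : g t != 0 -> is_derive t (1 : R) g D ->
  is_derive t (1 : R) (fun t => ln `|g t|) (D / g t).
Proof.
move=> g0 dg.
have -> : (fun t => ln `|g t|) = (fun t => 2^-1 * ln (g t * g t)).
  apply/funext => u; have [->|gu] := eqVneq (g u) 0; first by rewrite mulr0 normr0 ln0 ?mulr0.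
  rewrite -expr2 -[g u ^+ 2]ger0_norm ?sqr_ge0// normrX lnXn ?normr_gt0//.
  by rewrite -[ln _ *+ 2]mulr_natr mulrCA mulVf ?mulr1.
have gg : 0 < g t * g t by rewrite -expr2 lt0r sqr_ge0 sqrf_eq0 g0.
have d1 := is_deriveM dg dg.
have d2 := @is_derive1_comp _ (@ln R) (g * g) t _ _ (is_derive1_ln gg) d1.
have := is_deriveZ 2^-1 d2.
rewrite (_ : 2^-1 *: _ = D / g t); first exact.
by rewrite /GRing.scale /=; field.
Qed.

Lemma derivable_continuous1 (g : R -> R) (t : R) : derivable g t 1 -> {for t, continuous g}.
Proof. by move=> /derivable1_diffP; exact: differentiable_continuous. Qed.

Lemma integral_outside0 (g : R -> R) (d : R) : (forall t, d <= `|t| -> g t = 0) ->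
  (\int[@lebesgue_measure R]_t (g t)%:E =
   \int[@lebesgue_measure R]_(t in `[(- d)%R, d]) (g t)%:E)%E.
Proof.
move=> g0; rewrite [RHS]integral_mkcond; apply: eq_integral => t _.
rewrite patchE; case: ifPn => //; rewrite notin_setE /= in_itv /= -ler_norml => /negP.
by rewrite -ltNge => /ltW/g0 ->.
Qed.

Lemma integral_derive_eq0 (G g : R -> R) (d : R) : 0 < d ->
  (forall t, d <= `|t| -> g t = 0 /\ G t = 0) ->
  (forall t, `|t| <= d -> is_derive t (1 : R) G (g t)) ->
  (forall t, `|t| <= d -> {for t, continuous g}) ->
  (\int[@lebesgue_measure R]_t (g t)%:E = 0)%E.
Proof.
move=> d0 g0 dG cg; rewrite (integral_outside0 (d := d)); last by move=> t /g0[].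
have dd : `|d| <= d by rewrite gtr0_norm.
have dd' : `|- d| <= d by rewrite normrN gtr0_norm.
have cG t : `|t| <= d -> G x @[x --> t] --> G t.
  by move=> td; apply: derivable_continuous1; have [] := dG t td.
rewrite (@continuous_FTC2 _ g G (- d) d).
- have hd : d <= `|- d| by rewrite normrN ler_norm.
  by have [_ ->] := g0 d (ler_norm _); have [_ ->] := g0 (- d) hd; rewrite subee.
- by move: d0; lra.
- apply: continuous_in_subspaceT => t; rewrite inE /= in_itv /= -ler_norml; exact: cg.
- split.
  + move=> t; rewrite in_itv /= => /andP[t1 t2].
    by have [] := dG t; rewrite // ler_norml !ltW.
  + by apply: cvg_at_right_filter; exact: cG.
  + by apply: cvg_at_left_filter; exact: cG.
- move=> t; rewrite in_itv /= => /andP[t1 t2]; rewrite derive1E.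
  have h : `|t| <= d by rewrite ler_norml !ltW.
  exact: (@derive_val _ _ _ _ _ _ _ (dG t h)).
Qed.

End RealFun.

Section LineIBP.
Context {R : realType} {W : normedModType R}.

Lemma C1_line (f : W -> R) (x v : W) (t : R) : C1 f (x + t *: v) ->
  is_derive t (1 : R) (fun t => f (x + t *: v)) ('D_v f (x + t *: v)).
Proof.
move=> fC; exact: (is_derive_line f x v t _).1 (derivableP (@C1_derivable _ _ _ _ fC v)).
Qed.

Lemma continuous_line (x v : W) (t : R) : (fun t : R => x + t *: v) u @[u --> t] --> x + t *: v.
Proof.
apply: cvgD; first exact: cvg_cst.
by apply: cvgZ; [exact: cvg_id|exact: cvg_cst].
Qed.

(** The integrand is the derivative of [ln |f| phi] along the line, and this product vanishes from
    [|t| = d] on. *)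
Lemma line_ibp (f phi : W -> R) (x v : W) (d : R) : 0 < d ->
  (forall t, `|t| <= d -> C1 f (x + t *: v) /\ f (x + t *: v) != 0) ->
  (forall y, C1 phi y) ->
  (forall t, d <= `|t| -> phi (x + t *: v) = 0 /\ 'D_v phi (x + t *: v) = 0) ->
  (\int[@lebesgue_measure R]_t (ln `|f (x + t *: v)| * 'D_v phi (x + t *: v) +
     'D_v f (x + t *: v) / f (x + t *: v) * phi (x + t *: v))%:E = 0)%E.
Proof.
move=> d0 fC pC p0.
apply: (@integral_derive_eq0 _ (fun t => ln `|f (x + t *: v)| * phi (x + t *: v))
  (fun t => ln `|f (x + t *: v)| * 'D_v phi (x + t *: v) +
     'D_v f (x + t *: v) / f (x + t *: v) * phi (x + t *: v)) d) => //.
- by move=> t /p0[-> ->]; rewrite !mulr0 addr0.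
- move=> t /fC[fC1 f0].
  have d1 := is_derive_ln_abs f0 (C1_line fC1).
  have d2 := C1_line (pC (x + t *: v)).
  have := is_deriveM d1 d2; rewrite /GRing.scale /= [X in _ + X]mulrC; exact.
- move=> t /fC[fC1 f0].
  have d1 := is_derive_ln_abs f0 (C1_line fC1).
  have d2 := C1_line (pC (x + t *: v)).
  have d3 := C1_line fC1.
  have [D1 _] := d1; have [D2 _] := d2; have [D3 _] := d3.
  have c1 := derivable_continuous1 D1; have c2 := derivable_continuous1 D2.
  have c3 := derivable_continuous1 D3.
  have [_ cf] := fC1 v; have [_ cp] := pC (x + t *: v) v.
  have c4 : ('D_v f (x + u *: v)) @[u --> t] --> 'D_v f (x + t *: v).
    exact: (cvg_comp _ _ (@continuous_line x v t) cf).
  have c5 : ('D_v phi (x + u *: v)) @[u --> t] --> 'D_v phi (x + t *: v).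
    exact: (cvg_comp _ _ (@continuous_line x v t) cp).
  apply: cvgD; first exact: cvgM.
  by apply: cvgM => //; apply: cvgM => //; apply: cvgV.
Qed.

End LineIBP.

(** * Weak directional derivatives on balls *)

Section Balls.
Context {R : realType} {n : nat}.
Implicit Types (f g phi : 'rV[R]_n -> R) (d rho : R).

Definition nball d : set 'rV[R]_n := [set x | `|x| < d].

Lemma row_tbox d (u : n.-tuple R) : 0 < d -> nball d (row_of_tuple u) -> tbox d u.
Proof. by move=> d0 /(norm_rowP _ d0) h i; have := h i; rewrite tnth_row => /ltW. Qed.

Lemma tbox_row d rho (u : n.-tuple R) : d < rho -> 0 < rho -> tbox d u -> `|row_of_tuple u| < rho.
Proof.
by move=> dr r0 h; apply/norm_rowP => // i; rewrite tnth_row; exact: le_lt_trans (h i) dr.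
Qed.

Lemma measurable_nball d : measurable (@row_of_tuple R n @^-1` nball d).
Proof. by apply: measurable_open_row; exact: open_norm_lt. Qed.

Lemma measurable_continuous_tbox g d rho : d < rho -> 0 < rho ->
  (forall x, `|x| < rho -> {for x, continuous g}) ->
  measurable_fun (tbox d) (fun u : n.-tuple R => g (row_of_tuple u)).
Proof.
move=> dr r0 cg; apply: measurable_funS (measurable_continuous_row (@open_norm_lt R n rho) cg).
  by apply: measurable_open_row; exact: open_norm_lt.
by move=> u; exact: tbox_row.
Qed.

Lemma L1_tbox g d : 0 < d ->
  measurable_fun (tbox d) (fun u : n.-tuple R => g (row_of_tuple u)) ->
  (\int[lebM n]_(u in tbox d) `|g (row_of_tuple u)|%:E < +oo)%E -> L1_on (nball d) g.
Proof.
move=> d0 mg ig; rewrite /L1_on lebME.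
apply: (@integrableS _ _ _ _ (tbox d)); [exact: measurable_tbox|exact: measurable_nball| |].
  by move=> u; exact: row_tbox.
by apply/integrableP; split => //; exact/measurable_EFinP.
Qed.

Lemma bounded_nball g d : continuous g -> exists M, forall x, nball d x -> `|g x| <= M.
Proof.
move=> cg; pose K := [set x : 'rV[R]_n | `|x| <= d].
have cK : compact K.
  apply: bounded_closed_compact.
    by exists d; split; [exact: num_real|move=> M dM x xd; apply: le_trans xd (ltW dM)].
  rewrite (_ : K = (fun x : 'rV[R]_n => `|x|) @^-1` [set y : R | y <= d])//.
  by apply: closed_comp; [move=> x _; exact: norm_continuous|exact: closed_le].
have [M [_ HM]] := compact_bounded (continuous_compact (continuous_subspaceT cg) cK).
exists (M + 1) => x xd; apply: (HM (M + 1)); first by rewrite ltrDl.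
by exists x => //; exact: ltW.
Qed.

Lemma L1_mul_continuous g phi d : L1_on (nball d) g -> continuous phi ->
  L1_on (nball d) (fun x => g x * phi x).
Proof.
move=> Lg cp; have [M HM] := bounded_nball d cp.
have := @integrableMl _ _ _ (lebM n) _ (measurable_nball d) _ (phi \o @row_of_tuple R n).
move=> /(_ (fun t => (g (row_of_tuple t))%:E)); rewrite /L1_on lebME in Lg *.
move=> /(_ Lg); apply.
  apply: measurable_continuous_row; first exact: open_norm_lt.
  by move=> x _; exact: cp.
exists M; split; first exact: num_real.
by move=> M' MM' u Uu /=; apply: le_trans (HM _ Uu) (ltW MM').
Qed.

Lemma L1_lin g1 g2 g d c : (forall x, nball d x -> g x = c * g1 x + g2 x) ->
  L1_on (nball d) g1 -> L1_on (nball d) g2 ->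
  L1_on (nball d) g /\ integral_on (nball d) g =
    (c%:E * integral_on (nball d) g1 + integral_on (nball d) g2)%E.
Proof.
rewrite /L1_on /integral_on lebME => gE L1 L2.
have mU := measurable_nball d.
have L1' := integrableZl mU c L1.
split.
  apply: eq_integrable (integrableD mU L1' L2) => // u; rewrite inE => Uu.
  by rewrite /= gE.
rewrite -integralZl// -integralD//; apply: eq_integral => u; rewrite inE => Uu.
by rewrite gE.
Qed.

Lemma test_derive0 (U : set 'rV[R]_n) phi v : test_function U phi ->
  forall x, ~ U x -> phi x = 0 /\ 'D_v phi x = 0.
Proof.
move=> [_ [K [cK KU p0]]] x Ux; have nK : ~ K x by move=> /KU.
split; first exact: p0.
have oK : open (~` K) by rewrite openC; apply: compact_closed => //; exact: norm_hausdorff.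
have nb : nbhs x (~` K) by apply: open_nbhs_nbhs.
have e : \near x, phi x = (cst 0 : 'rV[R]_n -> R) x.
  by apply: (@filterS _ (nbhs x) (nbhs_filter x) _ _ _ nb) => y; exact: p0.
by rewrite (near_eq_derive v e) derive_cst.
Qed.

Lemma test_C1 (U : set 'rV[R]_n) phi : test_function U phi -> forall x, C1 phi x.
Proof.
move=> [sp _] x w; have [_ d1] := sp [::]; have [c2 _] := sp [:: w]; split.
  by apply: (@filterE _ (nbhs x) (nbhs_filter x)) => y; exact: d1.
exact: c2.
Qed.

Lemma test_continuous (U : set 'rV[R]_n) phi v : test_function U phi ->
  continuous phi /\ continuous ('D_v phi).
Proof. by move=> [sp _]; split; [have [] := sp [::]|have [] := sp [:: v]]. Qed.

End Balls.

Section WeakDir.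
Context {R : realType}.

Definition weak_dir n (d : R) (f : 'rV[R]_n -> R) (v : 'rV[R]_n) :=
  L1_on (nball d) (fun x => 'D_v f x / f x) /\
  forall phi, test_function (nball d) phi ->
    integral_on (nball d) (fun x => ln `|f x| * 'D_v phi x) =
    (- integral_on (nball d) (fun x => ('D_v f x / f x * phi x)%R))%E.

Lemma integral_on_fin n (d : R) (g : 'rV[R]_n -> R) : L1_on (nball d) g ->
  integral_on (nball d) g \is a fin_num.
Proof.
rewrite /L1_on /integral_on lebME => Lg; apply: integrable_fin_num Lg; exact: measurable_nball.
Qed.

(** Both sides of the weak identity are linear in the direction. Finiteness of the integrals is
    needed to add them in the extended reals. *)
Lemma weak_dir_lin n (d : R) (f : 'rV[R]_n -> R) v w c :
  L1_on (nball d) (fun x => ln `|f x|) -> (forall x, `|x| < d -> C1 f x) ->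
  weak_dir d f v -> weak_dir d f w -> weak_dir d f (c *: v + w).
Proof.
move=> Lf fC [Lv Wv] [Lw Ww]; split.
  apply: (L1_lin (c := c) _ Lv Lw).1 => x xd.
  by rewrite derive_lin; [ring|exact: fC].
move=> phi tphi.
have [cp cv] := test_continuous v tphi; have [_ cw] := test_continuous w tphi.
have Lv1 := L1_mul_continuous Lf cv; have Lw1 := L1_mul_continuous Lf cw.
have Lv2 := L1_mul_continuous Lv cp; have Lw2 := L1_mul_continuous Lw cp.
rewrite (L1_lin (c := c) (g := fun x => ln `|f x| * 'D_(c *: v + w) phi x) (g1 := fun x => ln `|f x| * 'D_v phi x)
  (g2 := fun x => ln `|f x| * 'D_w phi x) _ Lv1 Lw1).2; last first.
  by move=> x xd; rewrite derive_lin; [ring|exact: test_C1 tphi x].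
rewrite (L1_lin (c := c) (g := fun x => 'D_(c *: v + w) f x / f x * phi x) (g1 := fun x => 'D_v f x / f x * phi x)
  (g2 := fun x => 'D_w f x / f x * phi x) _ Lv2 Lw2).2; last first.
  by move=> x xd; rewrite derive_lin; [ring|exact: fC].
rewrite Wv// Ww// muleN -fin_num_oppeD//; exact: integral_on_fin.
Qed.

Lemma integral_affine_lty dd (T : measurableType dd) (m : {measure set T -> \bar R}) (D : set T)
    (A B : R) (g : T -> \bar R) : measurable D -> (m D < +oo)%E -> 0 <= A -> 0 <= B ->
  (forall x, 0 <= g x)%E -> measurable_fun D g -> (\int[m]_(x in D) g x < +oo)%E ->
  (\int[m]_(x in D) (A%:E + B%:E * g x) < +oo)%E.
Proof.
move=> mD Doo A0 B0 g0 mg ig; rewrite ge0_integralD//; last 2 first.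
- by move=> x _; rewrite mule_ge0.
- exact: measurable_funeM.
rewrite integral_cst// ge0_integralZl//; apply: lte_add_pinfty.
  by rewrite lte_mul_pinfty.
by rewrite lte_mul_pinfty.
Qed.

Lemma finite_radius (I : finType) (Q : I -> R -> Prop) :
  (forall i, exists2 d0, 0 < d0 & forall d, 0 < d <= d0 -> Q i d) ->
  exists2 d0, 0 < d0 & forall i d, 0 < d <= d0 -> Q i d.
Proof.
move=> H; suff [d0 d00 Hd] : exists2 d0, 0 < d0 & forall i, i \in enum I ->
    forall d, 0 < d <= d0 -> Q i d.
  by exists d0 => // i; apply: Hd; rewrite mem_enum.
elim: (enum I) => [|i s [d1 d10 IH]]; first by exists 1.
have [d2 d20 H2] := H i; exists (Num.min d1 d2); first by rewrite lt_min d10.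
move=> j; rewrite inE => /orP[/eqP ->|js] d /andP[d0]; rewrite le_min => /andP[h1 h2].
  by apply: H2; rewrite d0.
by apply: IH => //; rewrite d0.
Qed.

Lemma C1_An n (f : 'rV[R]_n -> R) rho M (x : 'rV[R]_n) :
  An (fun=> rho) (fun z => f (\row_i z i)) M -> `|x| < rho -> C1 f x.
Proof.
move=> HF xr; have := An_C1 HF xr.
suff -> : (fun x : 'rV[R]_n => f (\row_i x ord0 i)) = f by [].
by apply/funext => y; congr f; apply/rowP => i; rewrite mxE.
Qed.

Lemma An_continuous n (f : 'rV[R]_n -> R) rho M (x : 'rV[R]_n) :
  An (fun=> rho) (fun z => f (\row_i z i)) M -> `|x| < rho -> {for x, continuous f}.
Proof.
move=> HF xr; have := An_continuous_row HF xr.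
suff -> : (fun x : 'rV[R]_n => f (\row_i x ord0 i)) = f by [].
by apply/funext => y; congr f; apply/rowP => i; rewrite mxE.
Qed.

(** A logarithm is dominated by any negative power, and [sg_integrable] provides an integrable
    one. *)
Lemma L1_ln n (f : 'rV[R]_n.+1 -> R) rho M x : 0 < rho ->
  An (fun=> rho) (fun z => f (\row_i z i)) M -> inner (fun=> rho) x -> f (\row_i x i) != 0 ->
  exists2 d0, 0 < d0 & forall d, 0 < d <= d0 -> L1_on (nball d) (fun x => ln `|f x|).
Proof.
move=> r0 HF ix fx; have [d0 [e [d00 d0r /andP[e0 e1] ie]]] := sg_integrable r0 HF ix fx.
exists d0 => // d /andP[d_gt0 dd0].
have dr : d < rho by exact: le_lt_trans d0r.
have cf := fun y => @An_continuous _ f rho M y HF.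
have mf := measurable_continuous_tbox dr r0 cf.
apply: L1_tbox => //.
  apply: (measurableT_comp (@measurable_ln R)); exact: (measurableT_comp (@normr_measurable R setT)).
have M0 := An_ge0 HF.
have subd : tbox d `<=` @tbox R n.+1 d0 by move=> u h i; apply: le_trans (h i) dd0.
have msg : measurable_fun (@tbox R n.+1 d0) (fun u => sg e (f (row_of_tuple u))).
  apply: (measurableT_comp (measurable_sg e)).
  exact: (measurable_continuous_tbox d0r r0 cf).
apply: (@le_lt_trans _ _ (\int[lebM n.+1]_(u in tbox d) (M%:E + e^-1%:E * sg e (f (row_of_tuple u))))%E).
  apply: ge0_le_integral => //.
  - exact: measurable_tbox.
  - apply/measurable_EFinP; apply: (measurableT_comp (@normr_measurable R setT)).
    apply: (measurableT_comp (@measurable_ln R)); exact: (measurableT_comp (@normr_measurable R setT)).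
  - apply: emeasurable_funD => //; apply: measurable_funeM.
    by apply: measurable_funS msg => //; exact: measurable_tbox.
  - move=> u hu; apply: ln_abs_le => //.
    apply: (An_bound HF (x := tnth u)) => i; apply: le_trans (hu i) (ltW dr).
apply: integral_affine_lty => //.
- exact: measurable_tbox.
- exact: lebM_tbox.
- by rewrite invr_ge0 ltW.
- by move=> u; exact: sg_ge0.
- by apply: measurable_funS msg => //; exact: measurable_tbox.
- apply: le_lt_trans ie; apply: ge0_subset_integral => //; try exact: measurable_tbox.
  by move=> u _; exact: sg_ge0.
Qed.

End WeakDir.

Section Direction.
Context {R : realType}.
Local Notation mu := (@lebesgue_measure R).
Variables (n : nat) (V : set 'rV[R]_n.+2) (f : 'rV[R]_n.+2 -> R) (rho M e : R).
Variables (a : 'I_n.+1 -> R) (s0 r0 t0 : R).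
Hypotheses (HF : An (fun=> rho) (fun z => f (\row_i z i)) M) (e0 : 0 < e) (er : e <= rho).
Hypothesis Ve : forall x, `|x| < e -> V x.
Hypothesis ne : forall x, `|x| < e -> ~ smooth_point (zero_set V f) n.+1 x.
Hypothesis good : good_dir (fun z => f (\row_i z i)) rho a s0 r0 t0.

Lemma weak_dir_good : exists2 d0, 0 < d0 & forall d, 0 < d <= d0 ->
  L1_on (nball d) (fun x => ln `|f x|) -> weak_dir d f (dir a).
Proof.
have rho0 : 0 < rho by exact: lt_le_trans er.
have e20 : 0 < e / 2 by rewrite divr_gt0.
(* [q] bounds both [s] and [r1], so that the sheared polydisc of the preparation stays in [|x| < e],
   where the zero set has no smooth point of dimension [n.+1]. *)
have [q1 q10 Hq1] := small_radius a e20.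
pose q := Num.min q1 (e / 2).
have q0 : 0 < q by rewrite lt_min q10.
have qe : q <= e / 2 by rewrite ge_min lexx orbT.
have qj j : q + `|a j| * q <= e / 2 by apply: Hq1; [rewrite ge_min lexx|exact: ltW].
have [ts0 s0r r00 ar Ft0] := good.
have [k [c [s [r1 [Q [r [W sq r1q]]]]]]] := wdata_exists r00 s0r ar HF ts0 Ft0 q0 q0.
have [[c0 s_gt0 s1 r10] _] := W.
have xe t y : `|t| <= s -> polyd (fun=> r1) y -> `|\row_i shr a t y i| < e.
  move=> ts hy; apply/norm_rowP => // i; rewrite mxE.
  case: (unliftP ord0 i) => [j|] ->; rewrite ?shr0 ?shrS.
    apply: le_lt_trans (ler_normD _ _) _; apply: (@le_lt_trans _ _ (e / 2)); last by move: e0; lra.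
    apply: le_trans (qj j); apply: lerD; first exact: le_trans (hy j) r1q.
    by rewrite normrM ler_wpM2l//; exact: le_trans ts sq.
  by move: ts sq qe e0; lra.
have VO t y : `|t| <= s -> polyd (fun=> r1) y -> V (\row_i shr a t y i).
  by move=> ts hy; apply: Ve; exact: xe.
have ns t y : `|t| <= s -> polyd (fun=> r1) y ->
    ~ smooth_point (zero_set V f) n.+1 (\row_i shr a t y i).
  by move=> ts hy; apply: ne; exact: xe.
have [E [N [HE [ys iys Eys] Im]]] := discriminant_exists W.
have nr := codim2_no_root W VO ns HE Im.
(* The exponent [b] that is integrable for [E] is then used to split the singularity in
   [line_grad_bound]. *)
have [dE [b [dE0 dEr bb iE]]] := sg_integrable r10 HE iys Eys.
have [A [B [A0 B0 HAB]]] := line_grad_bound W Im nr bb.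
have [d2 d20 Hd2] := small_radius a dE0.
have s20 : 0 < s / 2 by rewrite divr_gt0.
(* [d2] sends the lines that meet the box to values of [y] where [|E|^-b] is integrable, [s / 2] is
   the range of the gradient bound, and [rho / 2] keeps [f] continuously differentiable. *)
exists (Num.min (Num.min d2 (s / 2)) (rho / 2)).
  by rewrite !lt_min d20 s20 divr_gt0.
move=> d /andP[d0]; rewrite !le_min => /andP[/andP[dd2 ds2] drho] Lln.
have dr : d < rho by move: drho rho0; lra.
have dj j : d + `|a j| * d <= dE by apply: Hd2 => //; exact: ltW.
have ds : d < s by move: ds2 s_gt0; lra.
have inE' (y : n.+1.-tuple R) : tbox dE y -> inner (fun=> r1) (tnth y).
  move=> hy; exists (r1 - dE); first by rewrite subr_gt0.
  by move=> j; rewrite addrCA gerDl subr_le0; exact: hy.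
have rowsh t y : row_of_tuple (shear a (t, y)) = \row_i shr a t (tnth y) i.
  by apply/rowP => i; rewrite tnth_row tnth_shear mxE.
have fC x : `|x| < rho -> C1 f x := @C1_An _ _ f rho M x HF.
have cf x : `|x| < rho -> {for x, continuous f} := @An_continuous _ _ f rho M x HF.
have cD x : `|x| < rho -> {for x, continuous ('D_(dir a) f)}.
  by move=> xr; have [] := fC x xr (dir a).
have mg : measurable_fun (tbox d) (fun u : n.+2.-tuple R =>
    'D_(dir a) f (row_of_tuple u) / f (row_of_tuple u)).
  apply: measurable_funM; first exact: (measurable_continuous_tbox dr rho0 cD).
  apply: (measurableT_comp measurable_invr); exact: (measurable_continuous_tbox dr rho0 cf).
have mE : measurable_fun (tbox dE) (fun y : n.+1.-tuple R => sg b (E (tnth y))).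
  by apply: (measurableT_comp (measurable_sg b)); exact: (measurable_An_tuple r10 HE dEr).
have Lg : L1_on (nball d) (fun x => 'D_(dir a) f x / f x).
  apply: L1_tbox => //.
  apply: (@le_lt_trans _ _ (\int[lebM n.+1]_(y in tbox dE) (A%:E + B%:E * sg b (E (tnth y))))%E).
    apply: (@shear_bound _ _ a d (s / 2) dE) => //.
    - by apply/measurable_EFinP; exact: (measurableT_comp (@normr_measurable R setT)).
    - by move=> y; rewrite adde_ge0 ?lee_fin// mule_ge0 ?lee_fin ?sg_ge0// ltW.
    - by apply: emeasurable_funD => //; apply: measurable_funeM.
    move=> y hy; have [bt [bt0 mbt Hbt ibt]] := HAB _ (inE' y hy).
    exists bt; split => // t ts hu; rewrite rowsh.
    apply: Hbt => //.
    have xr : `|\row_i shr a t (tnth y) i| < rho.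
      by rewrite -rowsh; apply: tbox_row hu.
    rewrite row_shr_line in xr *.
    have := C1_line (fC _ xr); apply: near_eq_is_derive.
    by near=> t'; rewrite -row_shr_line.
  apply: integral_affine_lty => //.
  - exact: measurable_tbox.
  - exact: lebM_tbox.
  - exact: ltW.
  - by move=> y; exact: sg_ge0.
split => // phi tphi.
have [cp cv] := test_continuous (dir a) tphi.
have L1 := L1_mul_continuous Lln cv; have L2 := L1_mul_continuous Lg cp.
pose hh x := ln `|f x| * 'D_(dir a) phi x + 'D_(dir a) f x / f x * phi x.
have [Lh Ih] := L1_lin (c := 1) (g := hh) (fun x _ => congr1 (fun z => z + _) (esym (mul1r _))) L1 L2.
have hh0 x : ~ nball d x -> hh x = 0.
  by move=> /(test_derive0 (dir a) tphi)[h1 h2]; rewrite /hh h1 h2 !mulr0 addr0.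
(* [hh] vanishes off the ball, so it can be integrated over the whole space along complete sheared
   lines. *)
suff : integral_on (nball d) hh = 0%E.
  rewrite Ih mul1e => h0; have J := integral_on_fin L2.
  by rewrite -[LHS](@addeK _ _ _ J) h0 sub0e.
rewrite /L1_on lebME in Lh; rewrite /integral_on lebME integral_mkcond.
have hE : (fun u : n.+2.-tuple R => (hh (row_of_tuple u))%:E) \_ (row_of_tuple @^-1` nball d) =
    (fun u => (hh (row_of_tuple u))%:E).
  apply/funext => u; rewrite patchE; case: ifPn => //; rewrite notin_setE => h.
  by rewrite hh0.
move/(integrable_mkcond _ (measurable_nball d)) : Lh; rewrite hE => Lh.
apply: (@integral_shear_eq0 _ _ a _ [set y | tbox dE y /\ E (tnth y) = 0] Lh).
  (* An integrable function is finite almost everywhere, and [sg b] is [+oo] at the zeros of [E];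
     hence these are negligible. *)
  have iE' : (lebM n.+1).-integrable (tbox dE) (fun y => sg b (E (tnth y))).
    apply/integrableP; split => //; under eq_integral do rewrite gee0_abs ?sg_ge0//.
    exact: iE.
  apply: negligibleS (integrable_ae (@measurable_tbox _ _ dE) iE') => y /= [hy Ey] /(_ hy).
  by rewrite Ey /sg eqxx.
move=> y ny; have hline t : hh (row_of_tuple (shear a (t, y))) =
    hh (\row_i shr a 0 (tnth y) i + t *: dir a) by rewrite rowsh row_shr_line.
under eq_integral do rewrite hline.
have [hy|hy] := pselect (tbox dE y); last first.
  apply: integral0_eq => t _; rewrite hh0// -row_shr_line => /(norm_rowP _ d0) hx; apply: hy => j.
  have h1 := hx ord0; rewrite mxE shr0 in h1.
  have h2 := hx (lift ord0 j); rewrite mxE shrS in h2.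
  exact: le_trans (norm_unshear (ltW h1) (ltW h2)) (dj j).
have Ey : E (tnth y) != 0 by apply/eqP => Ey; apply: ny.
have iy := inE' y hy.
apply: (@line_ibp _ _ f phi _ (dir a) d) => //.
- move=> t td; rewrite -row_shr_line; split.
    apply: fC; apply: lt_le_trans er; apply: xe; last exact: inner_polyd.
    exact/ltW/(le_lt_trans td).
  by apply: (wdata_F_neq0 W nr iy Ey); exact: le_lt_trans ds.
- exact: test_C1 tphi.
- move=> t dt; apply: test_derive0 tphi _ _; rewrite -row_shr_line => /(norm_rowP _ d0)/(_ ord0).
  by rewrite mxE shr0 ltNge dt.
Unshelve. all: by end_near. Qed.

End Direction.

(** * From good directions to coordinate directions *)

Theorem theorem1p1 (R : realType) (n : nat) (V : set 'rV[R]_n)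
  (f : 'rV[R]_n -> R) :
  (2 <= n)%N -> open V -> V 0 -> analytic_on V f ->
  codim_ge (zero_set V f) 0 2 ->
  exists U : set 'rV[R]_n,
    [/\ open U, U 0, U `<=` V &
        W11_with_gradient U (fun x => ln `|f x|)
          (fun i x => partialD i f x / f x)].
Proof.
(* With [n.+2] variables the transversal coordinates [y] are at least one in number, as
   [sg_integrable] requires for [E]. *)
case: n V f => [|[|n]] // V f _ oV V0 aV cX.
have [rho [M [rho0]]] := analytic_An (aV 0 V0).
rewrite (_ : (fun z => _) = (fun z => f (\row_i z i))); last by apply/funext => z; rewrite add0r.
move=> HF.
have /nbhs_ballP[e1 /= e10 He1] : nbhs (0 : 'rV[R]_n.+2) V by apply: open_nbhs_nbhs.
(* Dimensions [n.+1] and [n.+2] are those of codimension below two: hypersurfaces, and zero sets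
   with interior. *)
have [|e2 e20 He2] := codim_avoid (d := n.+1) cX; first by rewrite subSnn.
have [|e3 e30 He3] := codim_avoid (d := n.+2) cX; first by rewrite subnn.
pose e := Num.min (Num.min e1 e2) rho.
have e0 : 0 < e by rewrite !lt_min e10 e20.
have [ee1 ee2 er] : [/\ e <= e1, e <= e2 & e <= rho] by rewrite /e !ge_min !lexx ?orbT.
clearbody e; have ns0 : ~ smooth_point (zero_set V f) n.+2 0 by apply: He3; rewrite normr0.
have [x xr fx] := not_locally_zero oV V0 ns0 rho0.
have ix : inner (fun=> rho) (fun i => x ord0 i).
  exists (rho - `|x|); first by rewrite subr_gt0.
  move=> i; suff : `|x ord0 i| <= `|x| by lra.
  apply/ler_addgt0Pr => h h0.
  have hp : 0 < `|x| + h by rewrite ltr_wpDl.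
  by apply: ltW; apply: (norm_rowP x hp).1; rewrite ltrDl.
have xE : \row_i x ord0 i = x by apply/rowP => i; rewrite mxE.
have Fx : (fun z => f (\row_i z i)) (fun i => x ord0 i) != 0 by rewrite /= xE.
have Ve y : `|y| < e -> V y.
  by move=> ye; apply: He1; rewrite -ball_normE /= sub0r normrN; exact: lt_le_trans ee1.
have ne y : `|y| < e -> ~ smooth_point (zero_set V f) n.+1 y.
  by move=> ye; apply: He2; exact: lt_le_trans ee2.
have [a [s0 [r0 [t0 good]]]] := good_dir_exists rho0 HF ix Fx.
have [eta eta0 near_a] := good_dir_near HF good.
(* [n.+2] good directions: [a] for [None], and [a] moved by [eta] in one coordinate for each
   [Some j]. Together they span the space. *)
pose aa (o : option 'I_n.+1) (j : 'I_n.+1) := a j + (if o == Some j then eta else 0).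
have gaa o : good_dir (fun z => f (\row_i z i)) rho (aa o) s0 (r0 / 2) t0.
  apply: near_a => j; rewrite /aa opprD addNKr normrN; case: ifP => _.
    by rewrite gtr0_norm.
  by rewrite normr0 ltW.
have [d1 d10 H1] := L1_ln rho0 HF ix Fx.
have [d2 d20 H2] := finite_radius (fun o => weak_dir_good HF e0 er Ve ne (gaa o)).
pose d := Num.min (Num.min d1 d2) e.
have d0 : 0 < d by rewrite !lt_min d10 d20 e0.
have [dd1 dd2 de] : [/\ d <= d1, d <= d2 & d <= e] by rewrite /d !ge_min !lexx ?orbT.
have Lln : L1_on (nball d) (fun x => ln `|f x|) by apply: H1; rewrite d0.
have fC y : `|y| < d -> C1 f y.
  by move=> yd; apply: (C1_An HF); apply: lt_le_trans yd _; exact: le_trans er.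
have Wd o : weak_dir d f (dir (aa o)) by apply: H2 => //; rewrite d0.
have lin c v w := @weak_dir_lin _ _ d f v w c Lln fC.
have aN : aa None = a by apply/funext => j; rewrite /aa addr0.
(* Two of the directions differ by [eta] times a basis vector. The zero vector, written as
   [- h + h], turns the rescaling by [eta^-1] into a case of [weak_dir_lin]. *)
have We j : weak_dir d f (basisv (lift ord0 j)).
  have h1 := lin (-1) _ _ (Wd None) (Wd (Some j)).
  have := lin eta^-1 _ _ h1 (lin (-1) _ _ h1 h1).
  suff -> : eta^-1 *: (-1 *: dir (aa None) + dir (aa (Some j))) +
     (-1 *: (-1 *: dir (aa None) + dir (aa (Some j))) +
      (-1 *: dir (aa None) + dir (aa (Some j)))) = basisv (lift ord0 j) by [].
  rewrite !scaleN1r addNr addr0 aN; apply/rowP => i; rewrite !mxE.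
  case: (unliftP ord0 i) => [j'|] ->; rewrite ?shrS ?shr0 /=.
    rewrite /aa (inj_eq lift_inj) (inj_eq Some_inj) [j' == j]eq_sym !add0r !mulr1 addKr.
    by case: eqP => _; rewrite ?mulVf ?gt_eqF// mulr0.
  by rewrite addNr mulr0.
(* The remaining basis vector is [(1, a)] minus the [a j] multiples of the others, added one at a
   time. *)
have Ws (l : seq 'I_n.+1) :
    weak_dir d f (\sum_(j <- l) (- a j) *: basisv (lift ord0 j) + dir (aa None)).
  elim: l => [|j l IH]; first by rewrite big_nil add0r.
  rewrite big_cons -addrA; exact: (lin (- a j) _ _ (We j) IH).
have W0 : weak_dir d f (basisv ord0).
  have := Ws (index_enum _); rewrite aN.
  suff -> : \sum_j (- a j) *: basisv (lift ord0 j) + dir a = basisv (ord0 : 'I_n.+2) by [].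
  apply/rowP => i; rewrite mxE summxE !mxE.
  case: (unliftP ord0 i) => [j'|] ->; rewrite ?shrS ?shr0 /=.
    rewrite (bigD1 j')//= big1 => [|j jj']; last first.
      by rewrite !mxE (inj_eq lift_inj) eq_sym (negbTE jj') mulr0.
    by rewrite !mxE !eqxx /= !mulr1 addr0 add0r addNr.
  by rewrite big1 ?add0r// => j _; rewrite !mxE /= mulr0.
have Wi i : weak_dir d f (basisv i) by case: (unliftP ord0 i) => [j|] ->; [exact: We|exact: W0].
exists (nball d); split.
- exact: open_norm_lt.
- by rewrite /nball /= normr0.
- by move=> y yd; apply: Ve; exact: lt_le_trans de.
- split => // i; first by have [] := Wi i.
  by move=> phi tphi; have [_] := Wi i; apply.
Qed.
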